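(* Let $G=\{(z+w,zw): z,w\in\mathbb C,\ |z|<1,\ |w|<1\}\subset\mathbb C^2$. A subset $V$ of $G$ is a nontrivial retract of $G$ if and only if $V$ is a complex geodesic of $G$.
   Context: $\mathbb D=\{z\in\mathbb C:|z|<1\}$. A (holomorphic) retraction of a domain $U\subset\mathbb C^n$ is a holomorphic map $\rho:U\to U$ with $\rho\circ\rho=\rho$; a retract in $U$ is a set that is the range of a retraction of $U$. A retract is trivial if it is a singleton set or the whole of $U$, and nontrivial otherwise. A complex geodesic of $U$ is a set of the form $k(\mathbb D)$, where $k:\mathbb D\to U$ is holomorphic and there is a holomorphic map $C:U\to\mathbb D$ with $C\circ k=\mathrm{id}_{\mathbb D}$. *)

(* Defs.v *)
From Stdlib Require Import Reals.
From Coquelicot Require Import Coquelicot.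

Open Scope R_scope.

Definition C2 : NormedModule C_AbsRing :=
  prod_NormedModule C_AbsRing C_NormedModule C_NormedModule.

(* Holomorphic maps are represented by total functions whose values outside U
   are irrelevant; U is meant to be open.  The scalar ring is C, so the Frechet
   differential asserted by [ex_filterdiff] is C-linear. *)
Definition holomorphic_on {E F : NormedModule C_AbsRing}
    (U : E -> Prop) (f : E -> F) : Prop :=
  forall x : E, U x -> ex_filterdiff f (locally x).

Definition maps_into {E F : Type} (U : E -> Prop) (W : F -> Prop)
    (f : E -> F) : Prop :=
  forall x : E, U x -> W (f x).

Definition is_image {E F : Type} (f : E -> F) (U : E -> Prop)
    (V : F -> Prop) : Prop :=
  forall y : F, V y <-> exists x : E, U x /\ f x = y.

Definition unit_disc : C_NormedModule -> Prop := fun z => Cmod z < 1.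

Definition retraction {E : NormedModule C_AbsRing}
    (U : E -> Prop) (rho : E -> E) : Prop :=
  holomorphic_on U rho /\ maps_into U U rho /\
  (forall x : E, U x -> rho (rho x) = rho x).

Definition is_retract {E : NormedModule C_AbsRing} (U V : E -> Prop) : Prop :=
  exists rho : E -> E, retraction U rho /\ is_image rho U V.

Definition is_singleton {E : Type} (V : E -> Prop) : Prop :=
  exists a : E, forall x : E, V x <-> x = a.

Definition nontrivial_retract {E : NormedModule C_AbsRing}
    (U V : E -> Prop) : Prop :=
  is_retract U V /\ ~ (is_singleton V \/ forall x : E, V x <-> U x).

Definition complex_geodesic {E : NormedModule C_AbsRing}
    (U V : E -> Prop) : Prop :=
  exists (k : C_NormedModule -> E) (c : E -> C_NormedModule),
    holomorphic_on unit_disc k /\ maps_into unit_disc U k /\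
    holomorphic_on U c /\ maps_into U unit_disc c /\
    (forall z : C_NormedModule, unit_disc z -> c (k z) = z) /\
    is_image k unit_disc V.

(* The open symmetrized bidisc. *)
Definition G : C2 -> Prop := fun x =>
  exists z w : C, Cmod z < 1 /\ Cmod w < 1 /\ x = (Cplus z w, Cmult z w).

(* Main.v *)
(* If k is a right inverse of c : G -> D, then k o c is a retraction, and it is not the identity
   because the differential of the identity of C^2 does not factor through C.

   Conversely let rho be a retraction with range V, and L its differential at a in V.  Strict
   differentiability makes rho the identity near a if L = id, and a an isolated point of V if L = 0;
   both propagate along the connected set G and are excluded.  So L v = v <> 0 for some v.  For
   |o| = 1 the root coordinates z -> (1 + o z) / (1 - o z) identify G with the set of (m, t) such that
   the two numbers m + sqrt t and m - sqrt t have positive real part.  Choose o maximizing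
   |dm(v)| / Re m.  Comparing with the other boundary points shows that, after normalizing m(a) = dm(v) = 1,
   the 1-jet of t at a along v is that of a real-type quadratic t = A m^2 + i b m - c whose graph stays
   in the domain; this graph is a disc k in G with k(0) = a, k'(0) parallel to v and left inverse c
   obtained from m.  No uniqueness of k is
   needed: c o rho o k is a self-map of the disc fixing 0 with derivative 1, hence the identity by
   Cartan's argument, so h = rho o k is already a geodesic inside V.  Finally L has rank one along
   h(D), so c is injective on V near h(D); hence {x in G | rho x in h(D)} is open and closed, and
   V = h(D). *)

Require Import Defs.
From Stdlib Require Import Reals Lra Lia Psatz Classical ClassicalEpsilon.
From Coquelicot Require Import Coquelicot.

Open Scope R_scope.

(** * Goursat's lemma for closed forms on squares *)

(** Holomorphy here means complex differentiability at each point, with no continuity of the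
    differential, yet the study of [rho] compares its values at two nearby points and so needs
    strict differentiability. That comes from bounds on second differences, these from Cauchy's
    estimate, and the estimate from Goursat's bisection applied to [g(w) dw / w] in logarithmic
    coordinates: circles about 0 become opposite sides of squares and the puncture goes to infinity.
    Second differences also replace power series in Cartan's argument, and limits of points where a
    map is locally linear replace the identity principle.

    The coordinate m is no accident. Up to a unimodular factor its Cayley transform is (2 o p - s) /
    (2 - o s), a map of G into the disc, and |dm(v)| / Re m is proportional to the hyperbolic length
    of the image of v. The maximizing o is thus the member of this family that shrinks v least, the
    only candidate in it for a left inverse of a disc tangent to v. *)

Lemma nested_interval_point (x h : nat -> R) :
  (forall n, x n <= x (S n)) -> (forall n, x (S n) + h (S n) <= x n + h n) ->
  (forall n, 0 <= h n) ->
  exists l, forall n, x n <= l <= x n + h n.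
Proof.
  intros Hx Hh H0.
  assert (Hxm : forall n k, x n <= x (n + k)%nat).
  { intros n k; induction k; [rewrite Nat.add_0_r; lra|].
    rewrite Nat.add_succ_r; eapply Rle_trans; [exact IHk | apply Hx]. }
  assert (Hhm : forall n k, x (n + k)%nat + h (n + k)%nat <= x n + h n).
  { intros n k; induction k; [rewrite Nat.add_0_r; lra|].
    rewrite Nat.add_succ_r; eapply Rle_trans; [apply Hh | exact IHk]. }
  assert (Hb : forall n m, x n <= x m + h m).
  { intros n m. destruct (Nat.le_ge_cases n m) as [H|H].
    - specialize (Hxm n (m - n)%nat). replace (n + (m - n))%nat with m in Hxm by lia.
      specialize (H0 m); lra.
    - specialize (Hhm m (n - m)%nat). replace (m + (n - m))%nat with n in Hhm by lia.
      specialize (H0 n); lra. }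
  destruct (completeness (fun r => exists n, r = x n)) as [l [Hl1 Hl2]].
  - exists (x 0%nat + h 0%nat). intros r [n ->]. apply Hb.
  - exists (x 0%nat), 0%nat; reflexivity.
  - exists l; intros n; split.
    + apply Hl1; exists n; reflexivity.
    + apply Hl2; intros r [m ->]; apply Hb.
Qed.

(** A bad square has a bad quarter; nested bad quarters shrink to a point, near which the local
    hypothesis forbids them. Only points with [x <= a + h] are asked about, because the forms met
    later are closed only on a left half-plane. *)
Lemma square_bisection (Pr : R -> R -> R -> Prop) (a c h : R) :
  0 < h ->
  (forall a c h, 0 < h -> Pr a c (h / 2) -> Pr (a + h / 2) c (h / 2) ->
     Pr a (c + h / 2) (h / 2) -> Pr (a + h / 2) (c + h / 2) (h / 2) -> Pr a c h) ->
  (forall x y, x <= a + h -> exists d, 0 < d /\ forall a' c' h', 0 < h' < d ->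
     a' <= x <= a' + h' -> c' <= y <= c' + h' -> Pr a' c' h') ->
  Pr a c h.
Proof.
  intros Hh Hq Hloc. apply NNPP; intros Hbad.
  pose (bad := fun q : R * R * R => let '(a, c, h) := q in 0 < h /\ ~ Pr a c h).
  pose (child := fun q q' : R * R * R => let '(a, c, h) := q in let '(a', c', h') := q' in
     (a' = a \/ a' = a + h / 2) /\ (c' = c \/ c' = c + h / 2) /\ h' = h / 2).
  (* The implication sits under the quantifier so that choice yields a total successor function. *)
  assert (Hst : forall q, exists q', bad q -> bad q' /\ child q q').
  { intros [[a1 c1] h1].
    destruct (classic (bad (a1, c1, h1))) as [[H1 H2]|H2];
      [|exists (a1, c1, h1); intros; contradiction].
    destruct (classic (Pr a1 c1 (h1 / 2))) as [K1|K1];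
      [|exists (a1, c1, h1 / 2); intros _; repeat split; auto; lra].
    destruct (classic (Pr (a1 + h1 / 2) c1 (h1 / 2))) as [K2|K2];
      [|exists (a1 + h1 / 2, c1, h1 / 2); intros _; repeat split; auto; lra].
    destruct (classic (Pr a1 (c1 + h1 / 2) (h1 / 2))) as [K3|K3];
      [|exists (a1, c1 + h1 / 2, h1 / 2); intros _; repeat split; auto; lra].
    destruct (classic (Pr (a1 + h1 / 2) (c1 + h1 / 2) (h1 / 2))) as [K4|K4];
      [|exists (a1 + h1 / 2, c1 + h1 / 2, h1 / 2); intros _; repeat split; auto; lra].
    exfalso; apply H2; auto. }
  pose (nxt := fun q => proj1_sig (constructive_indefinite_description _ (Hst q))).
  assert (Hnxt : forall q, bad q -> bad (nxt q) /\ child q (nxt q)).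
  { intros q; unfold nxt; destruct (constructive_indefinite_description _ (Hst q)); simpl; auto. }
  pose (sq := fun n => Nat.iter n nxt (a, c, h)).
  assert (Hsq : forall n, bad (sq n)).
  { intros n; induction n; [simpl; auto|]. apply (Hnxt _ IHn). }
  assert (Hch : forall n, child (sq n) (sq (S n))).
  { intros n; apply (Hnxt _ (Hsq n)). }
  pose (xs := fun n => fst (fst (sq n))). pose (ys := fun n => snd (fst (sq n))).
  pose (hs := fun n => snd (sq n)).
  assert (E : forall n, (xs (S n) = xs n \/ xs (S n) = xs n + hs n / 2) /\
     (ys (S n) = ys n \/ ys (S n) = ys n + hs n / 2) /\ hs (S n) = hs n / 2 /\
     0 < hs n /\ ~ Pr (xs n) (ys n) (hs n)).
  { intros n; generalize (Hch n) (Hsq n); unfold xs, ys, hs.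
    destruct (sq n) as [[? ?] ?], (sq (S n)) as [[? ?] ?]; simpl; tauto. }
  destruct (nested_interval_point xs hs) as [x Hx];
    try (intros n; destruct (E n) as (? & ? & ? & ? & ?); lra).
  destruct (nested_interval_point ys hs) as [y Hy];
    try (intros n; destruct (E n) as (? & ? & ? & ? & ?); lra).
  destruct (Hloc x y) as [d [Hd Hd']].
  { generalize (Hx 0%nat); unfold xs, hs; simpl; lra. }
  assert (Hhn : forall n, hs n = h * (/ 2) ^ n).
  { induction n; [unfold hs; simpl; lra|].
    destruct (E n) as (_ & _ & -> & _). rewrite IHn; simpl; lra. }
  destruct (pow_lt_1_zero (/ 2) ltac:(rewrite Rabs_pos_eq; lra) (d / h)) as [N HN].
  { apply Rdiv_lt_0_compat; lra. }
  specialize (HN N (le_n N)). rewrite Rabs_pos_eq in HN by (apply pow_le; lra).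
  destruct (E N) as (_ & _ & _ & H1 & H2). apply H2, Hd'; auto.
  split; auto. rewrite Hhn. apply (Rmult_lt_compat_l h) in HN; auto.
  replace (h * (d / h)) with d in HN by (field; lra). exact HN.
Qed.

(* P dx + Q dy is differentiable and closed at (x, y). *)
Definition closed_form_at (P Q : R -> R -> R) (x y : R) :=
  exists px k qy, forall eps, 0 < eps -> exists d, 0 < d /\ forall s t,
    Rabs s < d -> Rabs t < d ->
    Rabs (P (x + s) (y + t) - P x y - px * s - k * t) <= eps * (Rabs s + Rabs t) /\
    Rabs (Q (x + s) (y + t) - Q x y - k * s - qy * t) <= eps * (Rabs s + Rabs t).

Lemma linear_approx_continuous (f : R -> R) (x l : R) :
  (exists d, 0 < d /\ forall s, Rabs s < d -> Rabs (f (x + s) - f x - l * s) <= 1 * Rabs s) ->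
  continuous f x.
Proof.
  intros [d [Hd H]]. apply continuity_pt_filterlim. intros eps He.
  assert (H1 : 0 < 1 + Rabs l) by (generalize (Rabs_pos l); lra).
  assert (H2 : 0 < Rmin d (eps / (1 + Rabs l))).
  { apply Rmin_glb_lt; auto. apply Rdiv_lt_0_compat; auto. }
  exists (Rmin d (eps / (1 + Rabs l))). split; auto. simpl; unfold R_dist. intros u [_ Hu].
  generalize (Rmin_l d (eps / (1 + Rabs l))) (Rmin_r d (eps / (1 + Rabs l))); intros A B.
  specialize (H (u - x)). replace (x + (u - x)) with u in H by ring.
  assert (H3 : Rabs (u - x) < d) by lra. specialize (H H3).
  assert (H4 : Rabs (u - x) * (1 + Rabs l) < eps).
  { apply Rmult_lt_reg_r with (/ (1 + Rabs l)); [apply Rinv_0_lt_compat; auto|].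
    rewrite Rmult_assoc, Rinv_r, Rmult_1_r by lra. unfold Rdiv in B. lra. }
  replace (f u - f x) with ((f u - f x - l * (u - x)) + l * (u - x)) by ring.
  eapply Rle_lt_trans; [apply Rabs_triang|]. rewrite Rabs_mult. nra.
Qed.

Lemma closed_form_continuous (P Q : R -> R -> R) (x y : R) :
  closed_form_at P Q x y ->
  continuous (fun u => P u y) x /\ continuous (fun u => Q x u) y.
Proof.
  intros (px & k & qy & H). destruct (H 1 Rlt_0_1) as [d [Hd H']]. split.
  - apply (linear_approx_continuous _ _ px). exists d; split; auto. intros s Hs.
    destruct (H' s 0 Hs) as [A _]; [rewrite Rabs_R0; auto|].
    rewrite Rabs_R0, Rplus_0_r, Rmult_0_r, Rminus_0_r, Rplus_0_r in A. exact A.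
  - apply (linear_approx_continuous _ _ qy). exists d; split; auto. intros t Ht.
    destruct (H' 0 t) as [_ A]; auto; [rewrite Rabs_R0; auto|].
    rewrite Rabs_R0, Rplus_0_r, Rmult_0_r, Rminus_0_r, Rplus_0_l in A. exact A.
Qed.

Definition square_circulation (P Q : R -> R -> R) (a c h : R) :=
  RInt (fun x => P x c) a (a + h) - RInt (fun x => P x (c + h)) a (a + h)
  + RInt (fun y => Q (a + h) y) c (c + h) - RInt (fun y => Q a y) c (c + h).

(** Circulation is additive under quartering, and near each point it is [o(h^2)] because the linear
    part of a closed form has none. Hence the bound [eps * h^2] passes from small squares to the
    whole one, for every [eps]. *)
Lemma goursat_square (P Q : R -> R -> R) (a c h : R) :
  0 < h ->
  (forall x y, x <= a + h -> closed_form_at P Q x y) ->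
  square_circulation P Q a c h = 0.
Proof.
  intros Hh Hcl. set (X := a + h) in *.
  assert (IP : forall u v y, u <= X -> v <= X -> ex_RInt (fun x => P x y) u v).
  { intros u v y Hu Hv. apply (ex_RInt_continuous (V := R_CompleteNormedModule)). intros z Hz.
    apply (closed_form_continuous P Q), Hcl.
    destruct Hz as [_ Hz]. eapply Rle_trans; [exact Hz|]. apply Rmax_lub; auto. }
  assert (IQ : forall u v x, x <= X -> ex_RInt (fun y => Q x y) u v).
  { intros u v x Hx. apply (ex_RInt_continuous (V := R_CompleteNormedModule)). intros z Hz.
    apply (closed_form_continuous P Q), Hcl; auto. }
  assert (Hall : forall eps, 0 < eps -> Rabs (square_circulation P Q a c h) <= eps * (h * h)).
  2: { apply NNPP; intros H0. set (J := square_circulation P Q a c h) in *.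
       assert (0 < Rabs J) by (apply Rabs_pos_lt; auto).
       specialize (Hall (Rabs J / 2 / (h * h))). assert (0 < h * h) by nra.
       assert (E : Rabs J / 2 / (h * h) * (h * h) = Rabs J / 2) by (field; lra).
       rewrite E in Hall. assert (0 < Rabs J / 2 / (h * h)); [|specialize (Hall H2); lra].
       apply Rdiv_lt_0_compat; lra. }
  intros eps Heps.
  (* The small squares around a point with [x = X] may leave the half-plane; the premise
     [a + h <= X] makes the property vacuous for them. *)
  apply (square_bisection (fun a c h => a + h <= X ->
    Rabs (square_circulation P Q a c h) <= eps * (h * h)) a c h); auto; [| |unfold X; lra].
  - intros a1 c1 h1 H1 K1 K2 K3 K4 HX.
    assert (K1' := K1 ltac:(lra)). assert (K2' := K2 ltac:(lra)).
    assert (K3' := K3 ltac:(lra)). assert (K4' := K4 ltac:(lra)).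
    assert (E : square_circulation P Q a1 c1 h1 =
      square_circulation P Q a1 c1 (h1 / 2) + square_circulation P Q (a1 + h1 / 2) c1 (h1 / 2) +
      square_circulation P Q a1 (c1 + h1 / 2) (h1 / 2) +
      square_circulation P Q (a1 + h1 / 2) (c1 + h1 / 2) (h1 / 2)).
    { unfold square_circulation.
      replace (a1 + h1 / 2 + h1 / 2) with (a1 + h1) by field.
      replace (c1 + h1 / 2 + h1 / 2) with (c1 + h1) by field.
      rewrite <- (RInt_Chasles (fun x => P x c1) a1 (a1 + h1 / 2) (a1 + h1)) by (apply IP; lra).
      rewrite <- (RInt_Chasles (fun x => P x (c1 + h1)) a1 (a1 + h1 / 2) (a1 + h1)) by (apply IP; lra).
      rewrite <- (RInt_Chasles (fun y => Q (a1 + h1) y) c1 (c1 + h1 / 2) (c1 + h1)) by (apply IQ; lra).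
      rewrite <- (RInt_Chasles (fun y => Q a1 y) c1 (c1 + h1 / 2) (c1 + h1)) by (apply IQ; lra).
      unfold plus; simpl. ring. }
    rewrite E. eapply Rle_trans; [apply Rabs_triang|].
    eapply Rle_trans; [apply Rplus_le_compat_r, Rabs_triang|].
    eapply Rle_trans; [apply Rplus_le_compat_r, Rplus_le_compat_r, Rabs_triang|]. nra.
  - intros x y Hx. destruct (Hcl x y Hx) as (px & k & qy & H).
    destruct (H (eps / 8)) as [d [Hd Hd']]; [lra|].
    exists d; split; auto. intros a1 c1 h1 Hh1 Hax Hcy HX.
    assert (BP : forall x' y', a1 <= x' <= a1 + h1 -> c1 <= y' <= c1 + h1 ->
      Rabs (P x' y' - P x y - px * (x' - x) - k * (y' - y)) <= eps / 4 * h1 /\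
      Rabs (Q x' y' - Q x y - k * (x' - x) - qy * (y' - y)) <= eps / 4 * h1).
    { intros x' y' Hx' Hy'. assert (A1 : Rabs (x' - x) <= h1) by (apply Rabs_le; lra).
      assert (A2 : Rabs (y' - y) <= h1) by (apply Rabs_le; lra).
      destruct (Hd' (x' - x) (y' - y)) as [B1 B2]; try lra.
      replace (x + (x' - x)) with x' in B1, B2 by ring.
      replace (y + (y' - y)) with y' in B1, B2 by ring.
      split; (eapply Rle_trans; [eassumption|]); nra. }
    (* The terms [k * h1] here and [- k * h1] in the next bound remove the first-order parts. Their
       integrals cancel in the circulation, since the form is closed: both cross coefficients are
       the same [k]. *)
    assert (B1 : Rabs (RInt (fun x' => P x' c1 - P x' (c1 + h1) + k * h1) a1 (a1 + h1))
       <= (a1 + h1 - a1) * (eps / 2 * h1)).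
    { apply abs_RInt_le_const; [lra| |].
      - apply (ex_RInt_plus (V := R_NormedModule) (fun x' => P x' c1 - P x' (c1 + h1))).
        apply (ex_RInt_minus (V := R_NormedModule)); apply IP; lra.
        apply ex_RInt_const.
      - intros t Ht. destruct (BP t c1) as [U _]; try lra.
        destruct (BP t (c1 + h1)) as [V _]; try lra.
        apply Rabs_le_between in U. apply Rabs_le_between in V. apply Rabs_le. nra. }
    assert (B2 : Rabs (RInt (fun y' => Q (a1 + h1) y' - Q a1 y' - k * h1) c1 (c1 + h1))
       <= (c1 + h1 - c1) * (eps / 2 * h1)).
    { apply abs_RInt_le_const; [lra| |].
      - apply (ex_RInt_minus (V := R_NormedModule) (fun y' => Q (a1 + h1) y' - Q a1 y')).
        apply (ex_RInt_minus (V := R_NormedModule)); apply IQ; lra.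
        apply ex_RInt_const.
      - intros t Ht. destruct (BP (a1 + h1) t) as [_ U]; try lra.
        destruct (BP a1 t) as [_ V]; try lra.
        apply Rabs_le_between in U. apply Rabs_le_between in V. apply Rabs_le. nra. }
    assert (E1 : RInt (fun x' => P x' c1 - P x' (c1 + h1) + k * h1) a1 (a1 + h1) =
      RInt (fun x' => P x' c1) a1 (a1 + h1) - RInt (fun x' => P x' (c1 + h1)) a1 (a1 + h1) + h1 * (k * h1)).
    { rewrite (RInt_plus (fun x' => P x' c1 - P x' (c1 + h1))).
      rewrite (RInt_minus (fun x' => P x' c1)) by (apply IP; lra).
      rewrite RInt_const. unfold plus, minus, scal; simpl; unfold plus, opp, mult; simpl. ring.
      apply (ex_RInt_minus (V := R_NormedModule)); apply IP; lra.
      apply ex_RInt_const. }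
    assert (E2 : RInt (fun y' => Q (a1 + h1) y' - Q a1 y' - k * h1) c1 (c1 + h1) =
      RInt (fun y' => Q (a1 + h1) y') c1 (c1 + h1) - RInt (fun y' => Q a1 y') c1 (c1 + h1) - h1 * (k * h1)).
    { rewrite (RInt_minus (fun y' => Q (a1 + h1) y' - Q a1 y')).
      rewrite (RInt_minus (fun y' => Q (a1 + h1) y')) by (apply IQ; lra).
      rewrite RInt_const. unfold plus, minus, scal; simpl; unfold plus, opp, mult; simpl.
      change (fun y' : R => Q a1 y') with (Q a1). ring.
      apply (ex_RInt_minus (V := R_NormedModule)); apply IQ; lra.
      apply ex_RInt_const. }
    rewrite E1 in B1. rewrite E2 in B2. unfold square_circulation.
    apply Rabs_le_between in B1. apply Rabs_le_between in B2. apply Rabs_le. nra.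
Qed.

(** * Complex differentials *)

Lemma locally_norm_iff {K : AbsRing} {E : NormedModule K} (x : E) (P : E -> Prop) :
  locally x P <-> exists d, 0 < d /\ forall y, norm (minus y x) < d -> P y.
Proof.
  split.
  - intros [d Hd]. exists d; split; [apply cond_pos|].
    intros y Hy; apply Hd, norm_compat1, Hy.
  - intros (d & Hd & H). apply (locally_le_locally_norm x). exists (mkposreal d Hd). exact H.
Qed.

Lemma filterdiff_eps {K : AbsRing} {E F : NormedModule K} (f : E -> F) (x : E) (l : E -> F) :
  filterdiff f (locally x) l <-> is_linear l /\ forall eps, 0 < eps ->
    exists d, 0 < d /\ forall y, norm (minus y x) < d ->
      norm (minus (minus (f y) (f x)) (l (minus y x))) <= eps * norm (minus y x).
Proof.
  split.
  - intros [Hl H]; split; auto. intros eps He.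
    apply (proj1 (locally_norm_iff x _)). exact (H x (fun P HP => HP) (mkposreal eps He)).
  - intros [Hl H]; split; auto. intros x' Hx' eps.
    rewrite <- (is_filter_lim_locally_unique x x' Hx').
    apply (proj2 (locally_norm_iff x _)), H, cond_pos.
Qed.

Lemma ex_filterdiff_continuous_norm {K : AbsRing} {E F : NormedModule K} (f : E -> F) (x : E) :
  ex_filterdiff f (locally x) -> forall eps, 0 < eps ->
  exists d, 0 < d /\ forall y, norm (minus y x) < d -> norm (minus (f y) (f x)) < eps.
Proof.
  intros [l Hl] eps He. apply filterdiff_eps in Hl. destruct Hl as [Hlin Hl].
  destruct (linear_norm l Hlin) as (M & HM & HlM).
  destruct (Hl 1 Rlt_0_1) as (d & Hd & H).
  assert (H2 : 0 < Rmin d (eps / (M + 1))).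
  { apply Rmin_glb_lt; auto. apply Rdiv_lt_0_compat; lra. }
  exists (Rmin d (eps / (M + 1))); split; auto. intros y Hy.
  assert (Hy1 : norm (minus y x) < d) by (eapply Rlt_le_trans; [exact Hy|apply Rmin_l]).
  assert (Hy2 : norm (minus y x) < eps / (M + 1)) by (eapply Rlt_le_trans; [exact Hy|apply Rmin_r]).
  apply (Rmult_lt_compat_r (M + 1)) in Hy2; [|lra].
  replace (eps / (M + 1) * (M + 1)) with eps in Hy2 by (field; lra).
  specialize (H y Hy1). specialize (HlM (minus y x)).
  assert (E1 : minus (f y) (f x) =
     plus (minus (minus (f y) (f x)) (l (minus y x))) (l (minus y x))).
  { unfold minus at 2. rewrite <- plus_assoc, plus_opp_l, plus_zero_r. reflexivity. }
  rewrite E1. eapply Rle_lt_trans; [apply norm_triangle|]. lra.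
Qed.

(* [C] carries two normed module structures over itself, with distinct but equivalent uniform structures. *)
Lemma filterdiff_C_AbsRing {E : NormedModule C_AbsRing} (f : E -> C) (x : E) (l : E -> C) :
  filterdiff (V := C_NormedModule) f (locally x) l <->
  filterdiff (V := AbsRing_NormedModule C_AbsRing) f (locally x) l.
Proof.
  split; intros [[H1 H2 H3] H]; (split; [split; assumption | exact H]).
Qed.

Notation cdiff f x l := (filterdiff (V := C_NormedModule) f (locally x) l).

Lemma cdiff_mult {E : NormedModule C_AbsRing} (f g : E -> C) (x : E) (lf lg : E -> C) :
  cdiff f x lf -> cdiff g x lg ->
  cdiff (fun y => Cmult (f y) (g y)) x (fun h => Cplus (Cmult (lf h) (g x)) (Cmult (f x) (lg h))).
Proof.
  rewrite !filterdiff_C_AbsRing. apply (filterdiff_mult_fct (K := C_AbsRing) f g). exact Cmult_comm.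
Qed.

Lemma cdiff_const {E : NormedModule C_AbsRing} (c : C) (x : E) : cdiff (fun _ => c) x (fun _ => RtoC 0).
Proof. apply (filterdiff_const (V := C_NormedModule)). Qed.

Lemma cdiff_plus {E : NormedModule C_AbsRing} (f g : E -> C) (x : E) (lf lg : E -> C) :
  cdiff f x lf -> cdiff g x lg -> cdiff (fun y => Cplus (f y) (g y)) x (fun h => Cplus (lf h) (lg h)).
Proof. apply (filterdiff_plus_fct (V := C_NormedModule)). Qed.

Lemma cdiff_minus {E : NormedModule C_AbsRing} (f g : E -> C) (x : E) (lf lg : E -> C) :
  cdiff f x lf -> cdiff g x lg -> cdiff (fun y => Cminus (f y) (g y)) x (fun h => Cminus (lf h) (lg h)).
Proof. apply (filterdiff_minus_fct (V := C_NormedModule)). Qed.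

Lemma C_is_linear_scal (c : C) :
  is_linear (U := C_NormedModule) (V := C_NormedModule) (fun h => Cmult c h).
Proof.
  split.
  - intros x y. apply Cmult_plus_distr_l.
  - intros k x. change (Cmult c (Cmult k x) = Cmult k (Cmult c x)). ring.
  - exists (Cmod c + 1). split; [generalize (Cmod_ge_0 c); lra|].
    intros x. change (Cmod (Cmult c x) <= (Cmod c + 1) * Cmod x). rewrite Cmod_mult.
    generalize (Cmod_ge_0 x); nra.
Qed.

Lemma cdiff_Cinv (z : C) : z <> RtoC 0 ->
  filterdiff (U := C_NormedModule) (V := C_NormedModule) Cinv (locally (z : C_NormedModule))
    (fun h => Cmult (Copp (Cinv (Cmult z z))) h).
Proof.
  intros Hz. apply filterdiff_eps. split; [apply C_is_linear_scal|]. intros eps He.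
  assert (Hz' : 0 < Cmod z) by (apply Cmod_gt_0; auto).
  set (m := Cmod z) in *.
  assert (Hd : 0 < Rmin (m / 2) (eps * m ^ 3 / 2)).
  { apply Rmin_glb_lt; [lra|]. apply Rdiv_lt_0_compat; [|lra]. apply Rmult_lt_0_compat; auto. apply pow_lt; auto. }
  (* The remainder is exactly [h^2 / (z^2 y)], and [|y| > m / 2] makes it at most
     [2 |h|^2 / m^3]. *)
  exists (Rmin (m / 2) (eps * m ^ 3 / 2)). split; auto. intros y Hy.
  change (Cmod (Cminus y z) < Rmin (m / 2) (eps * m ^ 3 / 2)) in Hy.
  change (Cmod (Cminus (Cminus (/ y) (/ z)) (Cmult (Copp (/ (z * z))) (Cminus y z)))
     <= eps * Cmod (Cminus y z))%C.
  set (h := Cminus y z) in *.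
  assert (A1 : Cmod h < m / 2) by (eapply Rlt_le_trans; [exact Hy|apply Rmin_l]).
  assert (A2 : Cmod h < eps * m ^ 3 / 2) by (eapply Rlt_le_trans; [exact Hy|apply Rmin_r]).
  assert (A3 : m / 2 < Cmod y).
  { assert (m <= Cmod y + Cmod h); [|lra]. unfold m. replace z with (Cplus y (Copp h)) by (unfold h; ring).
    rewrite <- (Cmod_opp h). apply Cmod_triangle. }
  assert (Hy0 : y <> RtoC 0) by (apply Cmod_gt_0; lra).
  replace (Cminus (Cminus (/ y) (/ z)) (Cmult (Copp (/ (z * z))) h))%C
    with (h * h * (/ (z * z * y)))%C by (unfold h; field; auto).
  rewrite !Cmod_mult, Cmod_inv, !Cmod_mult by (repeat apply Cmult_neq_0; auto). fold m.
  assert (B : Cmod h * / (m * m * Cmod y) <= eps).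
  { assert (M2 : 0 < m * m) by nra.
    assert (M3 : m * m * (m / 2) < m * m * Cmod y) by (apply Rmult_lt_compat_l; auto).
    assert (M4 : 0 < m * m * (m / 2)) by (apply Rmult_lt_0_compat; lra).
    apply Rmult_le_reg_r with (m * m * Cmod y); [lra|].
    rewrite Rmult_assoc, Rinv_l by lra. simpl in A2. apply (Rmult_lt_compat_l eps) in M3; lra. }
  generalize (Cmod_ge_0 h). nra.
Qed.

Lemma cdiff_inv {E : NormedModule C_AbsRing} (f : E -> C) (x : E) (lf : E -> C) :
  cdiff f x lf -> f x <> RtoC 0 ->
  cdiff (fun y => Cinv (f y)) x (fun h => Cmult (Copp (Cinv (Cmult (f x) (f x)))) (lf h)).
Proof.
  intros Hf Hx.
  apply (filterdiff_comp' (V := C_NormedModule) (W := C_NormedModule) f Cinv x lf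
    (fun h => Cmult (Copp (Cinv (Cmult (f x) (f x)))) h)); auto. apply cdiff_Cinv; auto.
Qed.

Lemma cdiff_div {E : NormedModule C_AbsRing} (f g : E -> C) (x : E) (lf lg : E -> C) :
  cdiff f x lf -> cdiff g x lg -> g x <> RtoC 0 ->
  cdiff (fun y => Cdiv (f y) (g y)) x
     (fun h => Cdiv (Cminus (Cmult (lf h) (g x)) (Cmult (f x) (lg h))) (Cmult (g x) (g x))).
Proof.
  intros Hf Hg Hx. eapply filterdiff_ext_lin.
  - apply cdiff_mult; [exact Hf|]. apply cdiff_inv; eauto.
  - intros h. simpl. field. auto.
Qed.

Lemma cdiff_pair {E : NormedModule C_AbsRing} (f g : E -> C) (x : E) (lf lg : E -> C) :
  cdiff f x lf -> cdiff g x lg ->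
  filterdiff (V := C2) (fun y => (f y, g y)) (locally x) (fun h => (lf h, lg h)).
Proof.
  intros Hf Hg.
  refine (filterdiff_comp'_2 (U := C_NormedModule) (V := C_NormedModule) (W := C2) f g
     (fun a b => (a, b)) x lf lg (fun a b => (a, b)) Hf Hg _).
  apply (filterdiff_linear (U := C2) (V := C2)).
  apply (is_linear_prod (T := C2)); [apply is_linear_fst | apply is_linear_snd].
Qed.

(** * Cauchy's estimate *)

Lemma C_linear_eq (l : C -> C) (h : C) :
  is_linear (U := C_NormedModule) (V := C_NormedModule) l -> l h = Cmult (l (RtoC 1)) h.
Proof.
  intros Hl. generalize (linear_scal l Hl h (RtoC 1)).
  change (scal h (RtoC 1)) with (Cmult h (RtoC 1)).
  change (scal h (l (RtoC 1))) with (Cmult h (l (RtoC 1))).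
  rewrite Cmult_1_r. intros ->. apply Cmult_comm.
Qed.

Lemma C_diff_eps (f : C -> C) (z : C) (l : C -> C) :
  cdiff f (z : C_NormedModule) l -> forall eps, 0 < eps -> exists d, 0 < d /\ forall h, Cmod h < d ->
    Cmod (f (z + h) - f z - l (RtoC 1) * h)%C <= eps * Cmod h.
Proof.
  intros H eps He. apply filterdiff_eps in H. destruct H as [Hl H].
  destruct (H eps He) as (d & Hd & H'). exists d; split; auto. intros h Hh.
  specialize (H' (Cplus z h)).
  change (minus (Cplus z h) z) with (Cminus (Cplus z h) z) in H'.
  replace (Cminus (Cplus z h) z) with h in H' by ring.
  rewrite <- (C_linear_eq l h Hl). exact (H' Hh).
Qed.

(** The complex exponential of [x + i y]: a vertical segment of length [2 PI] covers a circle about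
    0, and [x <= ln r] covers the punctured closed disc of radius [r]. *)
Definition polar_exp (x y : R) : C := (exp x * cos y, exp x * sin y).

Lemma polar_exp_plus (x y s t : R) :
  polar_exp (x + s) (y + t) = Cmult (polar_exp x y) (polar_exp s t).
Proof.
  unfold polar_exp, Cmult; simpl. rewrite exp_plus, cos_plus, sin_plus. f_equal; ring.
Qed.

Lemma Cmod_polar_exp (x y : R) : Cmod (polar_exp x y) = exp x.
Proof.
  unfold Cmod, polar_exp; simpl.
  replace (exp x * cos y * (exp x * cos y * 1) + exp x * sin y * (exp x * sin y * 1))
    with (exp x * exp x * ((sin y)² + (cos y)²)) by (unfold Rsqr; ring).
  rewrite sin2_cos2, Rmult_1_r. apply sqrt_square. left; apply exp_pos.
Qed.

Lemma Cmod_le_abs (z : C) : Cmod z <= Rabs (Re z) + Rabs (Im z).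
Proof.
  replace z with (RtoC (Re z) + RtoC (Im z) * Ci)%C at 1.
  - eapply Rle_trans; [apply Cmod_triangle|]. rewrite Cmod_mult, !Cmod_R, Cmod_Ci. lra.
  - destruct z; unfold Re, Im, RtoC, Ci, Cplus, Cmult; simpl; f_equal; ring.
Qed.

Lemma im_le_Cmod (z : C) : Rabs (Im z) <= Cmod z.
Proof. eapply Rle_trans; [|apply Rmax_Cmod]. apply Rmax_r. Qed.

Lemma derivable_at_0_eps (f : R -> R) (l eps : R) : derivable_pt_lim f 0 l -> 0 < eps ->
  exists d, 0 < d /\ forall h, Rabs h < d -> Rabs (f h - f 0 - l * h) <= eps * Rabs h.
Proof.
  intros H He. destruct (H eps He) as [d Hd]. exists d; split; [apply cond_pos|]. intros h Hh.
  destruct (Req_dec h 0) as [->|Hh0].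
  - replace (f 0 - f 0 - l * 0) with 0 by ring. rewrite Rabs_R0; lra.
  - specialize (Hd h Hh0 Hh). rewrite Rplus_0_l in Hd.
    replace (f h - f 0 - l * h) with (((f h - f 0) / h - l) * h) by (field; auto).
    rewrite Rabs_mult. apply Rmult_le_compat_r; [apply Rabs_pos|]. lra.
Qed.

Lemma polar_exp_diff_0 (eps : R) : 0 < eps -> exists d, 0 < d /\ forall s t,
  Rabs s < d -> Rabs t < d ->
  Cmod (polar_exp s t - 1 - (s, t))%C <= eps * (Rabs s + Rabs t).
Proof.
  intros He.
  assert (He' : 0 < eps / 8) by lra.
  destruct (derivable_at_0_eps exp 1 _ (derivable_pt_lim_exp_0) He') as (d1 & Hd1 & H1).
  destruct (derivable_at_0_eps cos (- sin 0) _ (derivable_pt_lim_cos 0) He') as (d2 & Hd2 & H2).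
  destruct (derivable_at_0_eps sin (cos 0) _ (derivable_pt_lim_sin 0) He') as (d3 & Hd3 & H3).
  rewrite exp_0 in H1. rewrite cos_0, sin_0 in H2. rewrite sin_0, cos_0 in H3.
  set (d := Rmin (Rmin d1 d2) (Rmin d3 (Rmin 1 (eps / 4)))).
  assert (Hd : 0 < d) by (unfold d; repeat apply Rmin_glb_lt; lra).
  assert (D1 : d <= d1) by (unfold d; eapply Rle_trans; [apply Rmin_l|apply Rmin_l]).
  assert (D2 : d <= d2) by (unfold d; eapply Rle_trans; [apply Rmin_l|apply Rmin_r]).
  assert (D3 : d <= d3) by (unfold d; eapply Rle_trans; [apply Rmin_r|apply Rmin_l]).
  assert (D4 : d <= Rmin 1 (eps / 4)) by (unfold d; eapply Rle_trans; [apply Rmin_r|apply Rmin_r]).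
  assert (D5 : d <= 1) by (eapply Rle_trans; [exact D4|apply Rmin_l]).
  assert (D6 : d <= eps / 4) by (eapply Rle_trans; [exact D4|apply Rmin_r]).
  exists d; split; auto. intros s t Hs Ht.
  specialize (H1 s ltac:(lra)). specialize (H2 t ltac:(lra)). specialize (H3 t ltac:(lra)).
  replace (cos t - 1 - - 0 * t) with (cos t - 1) in H2 by ring.
  replace (exp s - 1 - 1 * s) with (exp s - 1 - s) in H1 by ring.
  replace (sin t - 0 - 1 * t) with (sin t - t) in H3 by ring.
  assert (Hs0 := Rabs_pos s). assert (Ht0 := Rabs_pos t).
  assert (H5 : 0 < exp s <= 3).
  { split; [apply exp_pos|]. apply Rle_trans with (exp 1); [|exact exp_le_3].
    destruct (Rle_lt_or_eq_dec s 1) as [L| ->]; [|left; apply exp_increasing; auto|lra].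
    apply Rle_trans with (Rabs s); [apply Rle_abs|lra]. }
  assert (H6 : Rabs (exp s - 1) <= (1 + eps / 8) * Rabs s).
  { replace (exp s - 1) with ((exp s - 1 - s) + s) by ring.
    eapply Rle_trans; [apply Rabs_triang|]. lra. }
  eapply Rle_trans; [apply Cmod_le_abs|]. unfold polar_exp, Cminus, Cplus, Copp, RtoC, Re, Im; simpl.
  replace (exp s * cos t + - (1) + - s) with (exp s * (cos t - 1) + (exp s - 1 - s)) by ring.
  replace (exp s * sin t + - 0 + - t) with (exp s * (sin t - t) + (exp s - 1) * t) by ring.
  assert (B1 : Rabs (exp s * (cos t - 1)) <= 3 * (eps / 8 * Rabs t)).
  { rewrite Rabs_mult, (Rabs_pos_eq (exp s)) by lra.
    apply Rmult_le_compat; try lra. apply Rabs_pos. }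
  assert (B2 : Rabs (exp s * (sin t - t)) <= 3 * (eps / 8 * Rabs t)).
  { rewrite Rabs_mult, (Rabs_pos_eq (exp s)) by lra.
    apply Rmult_le_compat; try lra. apply Rabs_pos. }
  assert (B3 : Rabs ((exp s - 1) * t) <= (1 + eps / 8) * Rabs s * Rabs t).
  { rewrite Rabs_mult. apply Rmult_le_compat_r; auto. }
  assert (B4 : (1 + eps / 8) * Rabs s * Rabs t <= eps / 4 * Rabs t + eps / 8 * Rabs s).
  { assert (Rabs s * Rabs t <= eps / 4 * Rabs t) by (apply Rmult_le_compat_r; lra).
    assert (Rabs s * Rabs t <= Rabs s * 1) by (apply Rmult_le_compat_l; lra). nra. }
  generalize (Rabs_triang (exp s * (cos t - 1)) (exp s - 1 - s))
    (Rabs_triang (exp s * (sin t - t)) ((exp s - 1) * t)). nra.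
Qed.

(** With [F = g o exp], the form is the imaginary part of [F(x + i y) (dx + i dy)]. Closedness is
    the Cauchy-Riemann equation for [F], whose complex derivative is [D]. *)
Lemma polar_pullback_closed (g : C -> C) (x y : R) (l : C -> C) :
  cdiff g (polar_exp x y : C_NormedModule) l ->
  closed_form_at (fun x y => Im (g (polar_exp x y))) (fun x y => Re (g (polar_exp x y))) x y.
Proof.
  intros Hg. set (w := polar_exp x y) in *. set (D := (l (RtoC 1) * w)%C).
  exists (Im D), (Re D), (- Im D). intros eps He.
  assert (Hw : 0 < Cmod w) by (unfold w; rewrite Cmod_polar_exp; apply exp_pos).
  set (L := Cmod D). assert (HL : 0 <= L) by apply Cmod_ge_0.
  (* Half of [eps] pays for the error of [g] on increments up to [2 |w| (|s| + |t|)], the other half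
     for the error [e] of the exponential, magnified by [|D|]. *)
  assert (E1 : 0 < eps / (4 * Cmod w)) by (apply Rdiv_lt_0_compat; lra).
  assert (E2 : 0 < Rmin 1 (eps / (2 * (L + 1)))).
  { apply Rmin_glb_lt; [lra|]. apply Rdiv_lt_0_compat; lra. }
  destruct (C_diff_eps _ _ _ Hg _ E1) as (d1 & Hd1 & H1).
  destruct (polar_exp_diff_0 _ E2) as (d2 & Hd2 & H2).
  assert (Hd : 0 < Rmin d2 (d1 / (4 * Cmod w))).
  { apply Rmin_glb_lt; auto. apply Rdiv_lt_0_compat; lra. }
  exists (Rmin d2 (d1 / (4 * Cmod w))); split; auto. intros s t Hs Ht.
  assert (Hs2 : Rabs s < d2) by (eapply Rlt_le_trans; [exact Hs|apply Rmin_l]).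
  assert (Ht2 : Rabs t < d2) by (eapply Rlt_le_trans; [exact Ht|apply Rmin_l]).
  assert (Hs1 : Rabs s < d1 / (4 * Cmod w)) by (eapply Rlt_le_trans; [exact Hs|apply Rmin_r]).
  assert (Ht1 : Rabs t < d1 / (4 * Cmod w)) by (eapply Rlt_le_trans; [exact Ht|apply Rmin_r]).
  specialize (H2 s t Hs2 Ht2). set (e := (polar_exp s t - 1 - (s, t))%C) in *.
  set (sg := Rabs s + Rabs t) in *.
  assert (Hsg : 0 <= sg) by (unfold sg; generalize (Rabs_pos s) (Rabs_pos t); lra).
  assert (He1 : Cmod e <= sg).
  { eapply Rle_trans; [exact H2|]. generalize (Rmin_l 1 (eps / (2 * (L + 1)))). nra. }
  assert (He2 : L * Cmod e <= eps / 2 * sg).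
  { assert (A : Cmod e <= eps / (2 * (L + 1)) * sg).
    { eapply Rle_trans; [exact H2|]. apply Rmult_le_compat_r; auto. apply Rmin_r. }
    apply Rle_trans with ((L + 1) * Cmod e); [generalize (Cmod_ge_0 e); nra|].
    apply (Rmult_le_compat_l (L + 1)) in A; [|lra].
    replace ((L + 1) * (eps / (2 * (L + 1)) * sg)) with (eps / 2 * sg) in A by (field; lra). exact A. }
  set (h := (w * ((s, t) + e))%C).
  assert (Hst : Cmod (s, t) <= sg) by apply Cmod_le_abs.
  assert (Hh : Cmod h <= 2 * Cmod w * sg).
  { unfold h; rewrite Cmod_mult. generalize (Cmod_triangle (s, t) e). nra. }
  assert (Hh1 : Cmod h < d1).
  { eapply Rle_lt_trans; [exact Hh|].
    assert (A : sg < d1 / (2 * Cmod w)).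
    { replace (d1 / (2 * Cmod w)) with (d1 / (4 * Cmod w) + d1 / (4 * Cmod w)) by (field; lra).
      unfold sg; lra. }
    apply (Rmult_lt_compat_l (2 * Cmod w)) in A; [|lra].
    replace (2 * Cmod w * (d1 / (2 * Cmod w))) with d1 in A by (field; lra). exact A. }
  specialize (H1 h Hh1).
  assert (Ew : polar_exp (x + s) (y + t) = (w + h)%C).
  { rewrite polar_exp_plus. fold w. unfold h, e. ring. }
  set (r := (g (w + h) - g w - l (RtoC 1) * h)%C) in *.
  assert (Er : (g (w + h) - g w - D * (s, t) = r + D * e)%C) by (unfold r, D, h; ring).
  assert (B : Cmod (g (w + h) - g w - D * (s, t))%C <= eps * sg).
  { rewrite Er. eapply Rle_trans; [apply Cmod_triangle|]. rewrite Cmod_mult. fold L.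
    assert (A : Cmod r <= eps / 2 * sg); [|lra].
    eapply Rle_trans; [exact H1|].
    replace (eps / 2 * sg) with (eps / (4 * Cmod w) * (2 * Cmod w * sg)) by (field; lra).
    apply Rmult_le_compat_l; lra. }
  rewrite Ew. fold w. split.
  - eapply Rle_trans; [|exact B]. eapply Rle_trans; [|apply im_le_Cmod]. right. f_equal.
    unfold Cminus, Cplus, Copp, Cmult, Re, Im; simpl; ring.
  - eapply Rle_trans; [|exact B]. eapply Rle_trans; [|apply re_le_Cmod]. right. f_equal.
    unfold Cminus, Cplus, Copp, Cmult, Re, Im; simpl; ring.
Qed.

(** On a square of side [2 PI] the two horizontal sides cancel by periodicity, so the vertical ones
    carry equal integrals. Iterating goes left by whole multiples of [2 PI], that is, to circles as
    small as desired. *)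
Lemma periodic_flux (P Q : R -> R -> R) (X : R) (n : nat) :
  (forall x y, x <= X -> closed_form_at P Q x y) ->
  (forall x, P x (2 * PI) = P x 0) ->
  RInt (Q X) 0 (2 * PI) = RInt (Q (X - 2 * PI * INR n)) 0 (2 * PI).
Proof.
  intros Hcl HP. assert (Hpi := PI_RGT_0). induction n.
  - simpl. f_equal. f_equal. ring.
  - rewrite IHn. assert (J := goursat_square P Q (X - 2 * PI * INR (S n)) 0 (2 * PI) ltac:(lra)).
    assert (Hn := pos_INR n).
    replace (X - 2 * PI * INR (S n) + 2 * PI) with (X - 2 * PI * INR n) in J by (rewrite S_INR; ring).
    unfold square_circulation in J. rewrite !Rplus_0_l in J.
    replace (X - 2 * PI * INR (S n) + 2 * PI) with (X - 2 * PI * INR n) in J by (rewrite S_INR; ring).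
    rewrite (RInt_ext (fun x => P x (2 * PI)) (fun x => P x 0)) in J by (intros; apply HP).
    specialize (J ltac:(intros; apply Hcl; nra)).
    change (fun y => Q (X - 2 * PI * INR n) y) with (Q (X - 2 * PI * INR n)) in J.
    change (fun y => Q (X - 2 * PI * INR (S n)) y) with (Q (X - 2 * PI * INR (S n))) in J.
    lra.
Qed.

Lemma difference_quotient_cdiff (f : C -> C) (z : C) :
  z <> RtoC 0 -> ex_filterdiff (V := C_NormedModule) f (locally (z : C_NormedModule)) ->
  exists l, cdiff (fun w => (f w - f 0) / w)%C (z : C_NormedModule) l.
Proof.
  intros Hz [l Hl]. eexists.
  apply (cdiff_div (E := C_NormedModule) (fun w => f w - f 0)%C (fun w => w)).
  - apply (cdiff_minus (E := C_NormedModule)); [exact Hl | apply cdiff_const].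
  - apply filterdiff_id.
  - exact Hz.
Qed.

(** The mean of [Re g], for [g = (f - f 0) / w], is the same on the circle of radius [r] as on
    arbitrarily small circles. There [g] is close to the derivative at 0, while on the large circle
    [|g| <= 2 B / r]. *)
Lemma cauchy_estimate_re (f l : C -> C) (r B : R) : 0 < r ->
  (forall z : C_NormedModule, Cmod z <= r -> ex_filterdiff (V := C_NormedModule) f (locally z)) ->
  cdiff f (RtoC 0 : C_NormedModule) l ->
  (forall z, Cmod z <= r -> Cmod (f z) <= B) ->
  Re (l (RtoC 1)) <= 2 * B / r.
Proof.
  intros Hr Hf Hl HB. set (c := l (RtoC 1)). set (g := fun w => ((f w - f 0) / w)%C).
  set (X := ln r). assert (Hpi := PI_RGT_0).
  assert (Hexp : forall x, x <= X -> exp x <= r).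
  { intros x Hx. rewrite <- (exp_ln r Hr). destruct (Rle_lt_or_eq_dec x X Hx) as [H| ->];
      [left; apply exp_increasing; auto | apply Rle_refl]. }
  assert (Hne : forall x y, polar_exp x y <> RtoC 0).
  { intros x y. apply Cmod_gt_0. rewrite Cmod_polar_exp. apply exp_pos. }
  set (P := fun x y => Im (g (polar_exp x y))). set (Q := fun x y => Re (g (polar_exp x y))).
  assert (Hcl : forall x y, x <= X -> closed_form_at P Q x y).
  { intros x y Hx. destruct (difference_quotient_cdiff f (polar_exp x y) (Hne x y)) as [lg Hlg].
    - apply Hf. rewrite Cmod_polar_exp; auto.
    - exact (polar_pullback_closed g x y lg Hlg). }
  assert (HP : forall x, P x (2 * PI) = P x 0).
  { intros x. unfold P, polar_exp. rewrite cos_2PI, sin_2PI, cos_0, sin_0. reflexivity. }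
  assert (IQ : forall x, x <= X -> ex_RInt (Q x) 0 (2 * PI)).
  { intros x Hx. apply (ex_RInt_continuous (V := R_CompleteNormedModule)). intros z _.
    apply (closed_form_continuous P Q), Hcl; auto. }
  assert (U : RInt (Q X) 0 (2 * PI) <= 2 * PI * (2 * B / r)).
  { replace (2 * PI * (2 * B / r)) with (RInt (fun _ => 2 * B / r) 0 (2 * PI)).
    2: { rewrite RInt_const. unfold scal; simpl; unfold mult; simpl; ring. }
    apply RInt_le; [lra|apply IQ; lra|apply ex_RInt_const|]. intros y _.
    unfold Q, g. eapply Rle_trans; [apply Rle_abs|]. eapply Rle_trans; [apply re_le_Cmod|].
    rewrite Cmod_div, Cmod_polar_exp by auto. unfold X; rewrite exp_ln by auto.
    unfold Rdiv. apply Rmult_le_compat_r; [left; apply Rinv_0_lt_compat; auto|].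
    unfold Cminus. eapply Rle_trans; [apply Cmod_triangle|]. rewrite Cmod_opp.
    assert (Cmod (f (polar_exp (ln r) y)) <= B) by (apply HB; rewrite Cmod_polar_exp, exp_ln; lra).
    assert (Cmod (f 0) <= B) by (apply HB; rewrite Cmod_0; lra). lra. }
  apply le_epsilon. intros eps He.
  destruct (C_diff_eps f (RtoC 0) l Hl eps He) as (d & Hd & H).
  assert (Hn : exists n, exp (X - 2 * PI * INR n) < d).
  { destruct (INR_unbounded ((X - ln d) / (2 * PI))) as [n Hn]. exists n.
    rewrite <- (exp_ln d Hd) at 1. apply exp_increasing.
    apply (Rmult_lt_compat_l (2 * PI)) in Hn; [|lra].
    replace (2 * PI * ((X - ln d) / (2 * PI))) with (X - ln d) in Hn by (field; lra). lra. }
  destruct Hn as [n Hn]. set (x := X - 2 * PI * INR n) in *.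
  assert (Hx : x <= X) by (unfold x; generalize (pos_INR n); nra).
  assert (W : 2 * PI * (Re c - eps) <= RInt (Q x) 0 (2 * PI)).
  { replace (2 * PI * (Re c - eps)) with (RInt (fun _ => Re c - eps) 0 (2 * PI)).
    2: { rewrite RInt_const. unfold scal; simpl; unfold mult; simpl; ring. }
    apply RInt_le; [lra|apply ex_RInt_const|apply IQ; auto|]. intros y _.
    unfold Q, g. set (w := polar_exp x y). assert (Hw := Hne x y). fold w in Hw.
    specialize (H w). unfold w in H at 1. rewrite Cmod_polar_exp in H. specialize (H Hn).
    rewrite Cplus_0_l in H. fold c in H.
    replace ((f w - f 0) / w)%C with ((f w - f 0 - c * w) / w + c)%C by (field; auto).
    assert (A : Rabs (Re ((f w - f 0 - c * w) / w)%C) <= eps).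
    { eapply Rle_trans; [apply re_le_Cmod|]. rewrite Cmod_div by auto.
      apply Cmod_gt_0 in Hw. apply Rmult_le_reg_r with (Cmod w); auto.
      unfold Rdiv. rewrite Rmult_assoc, Rinv_l by lra. lra. }
    apply Rabs_le_between in A. rewrite re_plus. lra. }
  unfold x in W. rewrite <- (periodic_flux P Q X n Hcl HP) in W.
  assert (2 * PI * (Re c - eps) <= 2 * PI * (2 * B / r)) by lra.
  apply Rmult_le_reg_l in H0; lra.
Qed.

Lemma Cmod_le_Re (z : C) (M : R) :
  (forall c, Cmod c = 1 -> Re (c * z)%C <= M) -> Cmod z <= M.
Proof.
  intros H. destruct (Ceq_dec z (RtoC 0)) as [->|Hz].
  - specialize (H (RtoC 1) Cmod_1). rewrite Cmult_0_r in H. rewrite Cmod_0. exact H.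
  - assert (Hz' : 0 < Cmod z) by (apply Cmod_gt_0; auto).
    assert (Hm : RtoC (Cmod z) <> RtoC 0) by (intros F; apply RtoC_inj in F; lra).
    specialize (H (Cconj z / RtoC (Cmod z))%C).
    rewrite Cmod_div, Cmod_conj, Cmod_R, Rabs_pos_eq in H by (auto; lra).
    assert (E2 := Cmod2_conj z). simpl in E2. rewrite Rmult_1_r, RtoC_mult in E2.
    replace (Cconj z / RtoC (Cmod z) * z)%C with (RtoC (Cmod z)) in H.
    + apply H. field; lra.
    + replace (Cconj z / RtoC (Cmod z) * z)%C with ((z * Cconj z) / RtoC (Cmod z))%C by (field; auto).
      rewrite <- E2. field; auto.
Qed.

Lemma cauchy_estimate (f l : C -> C) (r B : R) : 0 < r ->
  (forall z : C_NormedModule, Cmod z <= r -> ex_filterdiff (V := C_NormedModule) f (locally z)) ->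
  cdiff f (RtoC 0 : C_NormedModule) l ->
  (forall z, Cmod z <= r -> Cmod (f z) <= B) ->
  Cmod (l (RtoC 1)) <= 2 * B / r.
Proof.
  intros Hr Hf Hl HB. apply Cmod_le_Re. intros k Hk.
  apply (cauchy_estimate_re (fun z => k * f z)%C (fun h => k * l h)%C r B Hr).
  - intros z Hz. destruct (Hf z Hz) as [lz Hlz]. eexists.
    apply (cdiff_mult (E := C_NormedModule)); [apply cdiff_const | exact Hlz].
  - eapply filterdiff_ext_lin.
    + apply (cdiff_mult (E := C_NormedModule)); [apply cdiff_const | exact Hl].
    + intros h. simpl. ring.
  - intros z Hz. rewrite Cmod_mult, Hk. specialize (HB z Hz). lra.
Qed.

(** * Strict differentiability of holomorphic functions *)

(** Vector-valued maps have no mean value equality, but [Re (c f)] has one for each unimodular [c],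
    and one such [c] turns the increment into its modulus. *)
Lemma C_mean_value (f : C -> C) (M : R) :
  (forall t, 0 <= t <= 1 -> exists l, cdiff f (RtoC t : C_NormedModule) l /\ Cmod (l (RtoC 1)) <= M) ->
  Cmod (f 1 - f 0)%C <= M.
Proof.
  intros H. apply Cmod_le_Re. intros c Hc.
  pose (u := fun t : R => Re (c * f (RtoC t))%C).
  assert (Hder : forall t, 0 <= t <= 1 -> exists d, is_derive u t d /\ d <= M).
  { unfold u. intros t Ht. destruct (H t Ht) as (l & Hl & Hb). exists (Re (c * l (RtoC 1))%C). split.
    - apply is_derive_Reals. intros eps He.
      destruct (C_diff_eps f t l Hl (eps / 2)) as (d & Hd & Hd'); [lra|].
      exists (mkposreal d Hd). intros h Hh0 Hh. simpl in Hh.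
      specialize (Hd' (RtoC h)). rewrite Cmod_R in Hd'. specialize (Hd' Hh).
      rewrite RtoC_plus.
      assert (Hh1 : RtoC h <> RtoC 0) by (intros F; apply RtoC_inj in F; lra).
      replace ((Re (c * f (t + h)%C) - Re (c * f t)%C) / h - Re (c * l (RtoC 1))%C)
        with (Re (c * ((f (t + h) - f t - l (RtoC 1) * h) / h))%C).
      + eapply Rle_lt_trans; [apply re_le_Cmod|].
        rewrite Cmod_mult, Hc, Cmod_div, Cmod_R by auto. rewrite Rmult_1_l.
        assert (0 < Rabs h) by (apply Rabs_pos_lt; auto).
        apply Rle_lt_trans with (eps / 2); [|lra]. apply Rmult_le_reg_r with (Rabs h); auto.
        unfold Rdiv at 1. rewrite Rmult_assoc, Rinv_l; lra.
      + replace (c * ((f (t + h) - f t - l (RtoC 1) * h) / h))%C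
          with (c * f (t + h) * RtoC (/ h) - c * f t * RtoC (/ h) - c * l (RtoC 1))%C
          by (rewrite RtoC_inv by auto; field; auto).
        unfold Re, Cminus, Cplus, Copp, Cmult, RtoC; simpl. field; auto.
    - eapply Rle_trans; [apply Rle_abs|]. eapply Rle_trans; [apply re_le_Cmod|].
      rewrite Cmod_mult, Hc. lra. }
  destruct (MVT_gen u 0 1 (Derive u)) as (t & Ht & E).
  - rewrite Rmin_left, Rmax_right by lra. intros t Ht. destruct (Hder t) as (d & Hd & _); [lra|].
    apply Derive_correct. exists d; auto.
  - rewrite Rmin_left, Rmax_right by lra. intros t Ht. destruct (Hder t) as (d & Hd & _); [lra|].
    apply derivable_continuous_pt. exists d. apply is_derive_Reals; auto.
  - rewrite Rmin_left, Rmax_right in Ht by lra. destruct (Hder t Ht) as (d & Hd & Hd').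
    rewrite (is_derive_unique u t d Hd) in E. unfold u in E.
    replace (c * (f 1 - f 0))%C with (c * f 1 - c * f 0)%C by ring.
    replace (Re (c * f 1 - c * f 0)%C) with (Re (c * f (RtoC 1))%C - Re (c * f (RtoC 0))%C)
      by (unfold Re, Cminus, Cplus, Copp; simpl; ring). lra.
Qed.

Lemma minus_plus_l {K : AbsRing} {E : NormedModule K} (x d w : E) :
  minus (plus x d) w = plus (minus x w) d.
Proof.
  assert (H : forall (G : AbelianGroup) (x d w : G), minus (plus x d) w = plus (minus x w) d).
  { intros. unfold minus. rewrite <- !plus_assoc. f_equal. apply plus_comm. }
  apply H.
Qed.

Lemma plus_minus_cancel {K : AbsRing} {E : NormedModule K} (x y : E) : plus x (minus y x) = y.
Proof.
  assert (H : forall (G : AbelianGroup) (x y : G), plus x (minus y x) = y).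
  { intros. unfold minus. rewrite (plus_comm y0), plus_assoc, plus_opp_r, plus_zero_l. reflexivity. }
  apply H.
Qed.

Lemma plus_minus_r {K : AbsRing} {E : NormedModule K} (x h : E) : minus (plus x h) x = h.
Proof.
  rewrite minus_plus_l.
  assert (H : forall (G : AbelianGroup) (x h : G), plus (minus x x) h = h).
  { intros. rewrite minus_eq_zero, plus_zero_l. reflexivity. }
  apply H.
Qed.

Lemma norm_minus_plus_le {K : AbsRing} {E : NormedModule K} (x d w : E) :
  norm (minus (plus x d) w) <= norm (minus x w) + norm d.
Proof.
  replace (minus (plus x d) w) with (plus (minus x w) d) by (symmetry; apply minus_plus_l).
  apply @norm_triangle.
Qed.

Lemma minus_self_norm {K : AbsRing} {E : NormedModule K} (x : E) : norm (minus x x) = 0.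
Proof. rewrite (minus_eq_zero x). apply @norm_zero. Qed.

Lemma filterdiff_affine {E : NormedModule C_AbsRing} (x d : E) (z : C_NormedModule) :
  filterdiff (U := C_NormedModule) (fun k => plus x (scal (k : C) d)) (locally z) (fun k => scal (k : C) d).
Proof.
  eapply filterdiff_ext_lin.
  - apply (filterdiff_plus_fct (U := C_NormedModule) (V := E)).
    + apply filterdiff_const.
    + apply filterdiff_linear. destruct (is_linear_scal_l (K := C_AbsRing) d) as [A B D].
      split; [exact A | exact B | exact D].
  - intros k. simpl. apply plus_zero_l.
Qed.

Section Regularity.

Context {E : NormedModule C_AbsRing}.

Lemma norm_minus_triangle (x y w : E) :
  norm (minus y x) <= norm (minus x w) + norm (minus y w).
Proof.
  rewrite (minus_trans w y x). eapply Rle_trans; [apply norm_triangle|].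
  rewrite <- (opp_minus x w), norm_opp. lra.
Qed.

(** Restricted to the complex line through [x] and [y], [f] is a bounded function of one variable on
    discs of radius [rho] about each point of the segment; Cauchy's estimate bounds its derivative
    along the segment. *)
Lemma holomorphic_lipschitz (f : E -> C) (w : E) (R B : R) : 0 < R ->
  (forall x : E, norm (minus x w) < R -> ex_filterdiff (V := C_NormedModule) f (locally x)) ->
  (forall x : E, norm (minus x w) < R -> Cmod (f x) <= B) ->
  forall x y : E, norm (minus x w) < R / 4 -> norm (minus y w) < R / 4 ->
    Cmod (f y - f x)%C <= 16 * B / R * norm (minus y x).
Proof.
  intros HR Hf HB x y Hx Hy. set (d := minus y x).
  assert (Hd0 := norm_ge_0 d).
  destruct (Req_dec (norm d) 0) as [Hd|Hd].
  - assert (Ed := norm_eq_zero _ Hd). assert (Exy : y = x).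
    { rewrite <- (plus_minus_cancel x y). fold d. rewrite Ed. apply plus_zero_r. }
    rewrite Exy. replace (f x - f x)%C with (RtoC 0) by ring. rewrite Cmod_0, Hd. lra.
  - assert (Hd' : 0 < norm d) by lra. clear Hd0 Hd.
    assert (Hd2 : norm d < R / 2).
    { generalize (norm_minus_triangle x y w). fold d. lra. }
    (* The points [x + k d] with [|k| <= 1 + rho] stay in the ball, since
       [R / 4 + R / 2 + R / 8 < R]. *)
    set (rho := R / (8 * norm d)).
    assert (Hrho : 0 < rho) by (apply Rdiv_lt_0_compat; lra).
    assert (Hin : forall k : C, Cmod k <= 1 + rho -> norm (minus (plus x (scal k d)) w) < R).
    { intros k Hk. eapply Rle_lt_trans; [apply norm_minus_plus_le|].
      assert (Cmod k * norm d <= (1 + rho) * norm d) by (apply Rmult_le_compat_r; lra).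
      replace ((1 + rho) * norm d) with (norm d + R / 8) in H by (unfold rho; field; apply Rgt_not_eq, Hd').
      apply Rle_lt_trans with (norm (minus x w) + (norm d + R / 8)); [|lra].
      apply Rplus_le_compat_l. eapply Rle_trans; [apply (norm_scal k d)|]. exact H. }
    replace (16 * B / R * norm d) with (2 * B / rho) by (unfold rho; field; split; [apply Rgt_not_eq, HR | apply Rgt_not_eq, Hd']).
    assert (E1 : f y = f (plus x (scal (RtoC 1) d))).
    { f_equal. transitivity (plus x d); [symmetry; apply plus_minus_cancel|].
      f_equal. symmetry. exact (scal_one (K := C_AbsRing) d). }
    assert (E0 : f x = f (plus x (scal (RtoC 0) d))).
    { f_equal. transitivity (plus x (zero : E)); [symmetry; exact (plus_zero_r x)|].
      f_equal. symmetry. exact (scal_zero_l (K := C_AbsRing) d). }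
    rewrite E1, E0. apply (C_mean_value (fun k => f (plus x (scal k d)))). intros t Ht.
    assert (Hline : forall z : C_NormedModule, Cmod z <= 1 + rho ->
      ex_filterdiff (U := C_NormedModule) (V := C_NormedModule) (fun k => f (plus x (scal (k : C) d))) (locally z)).
    { intros z Hz. destruct (Hf _ (Hin z Hz)) as [l Hl]. eexists.
      apply (filterdiff_comp' (U := C_NormedModule) (V := E) (W := C_NormedModule) _ f z _ l (filterdiff_affine x d z) Hl). }
    destruct (Hline (RtoC t)) as [l Hl].
    { rewrite Cmod_R, Rabs_pos_eq; lra. }
    exists l; split; auto.
    assert (Htz : forall z, Cmod z <= rho -> Cmod (RtoC t + z)%C <= 1 + rho).
    { intros z Hz. eapply Rle_trans; [apply Cmod_triangle|]. rewrite Cmod_R, Rabs_pos_eq; lra. }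
    assert (Hshift : forall z : C_NormedModule, filterdiff (U := C_NormedModule) (V := C_NormedModule)
       (fun z => Cplus (RtoC t) z) (locally z) (fun h => h)).
    { intros z. eapply filterdiff_ext_lin.
      - apply (cdiff_plus (E := C_NormedModule)); [apply cdiff_const | apply filterdiff_id].
      - intros h. simpl. apply Cplus_0_l. }
    apply (cauchy_estimate (fun z => f (plus x (scal (RtoC t + z)%C d))) l rho B); auto.
    + intros z Hz. destruct (Hline (RtoC t + z)%C (Htz z Hz)) as [lz Hlz]. exists lz.
      apply (filterdiff_comp' (U := C_NormedModule) (V := C_NormedModule) (W := C_NormedModule)
        (fun z => Cplus (RtoC t) z) (fun k => f (plus x (scal (k : C) d))) z (fun h => h) lz (Hshift z) Hlz).
    + apply (filterdiff_comp' (U := C_NormedModule) (V := C_NormedModule) (W := C_NormedModule)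
        (fun z => Cplus (RtoC t) z) (fun k => f (plus x (scal (k : C) d))) (RtoC 0) (fun h => h) l (Hshift _)).
      rewrite Cplus_0_r. exact Hl.
Qed.

(** The Lipschitz bound is used twice: once to bound the function [x -> f (x + h) - f x] by a
    multiple of [|h|], once on that function over a ball of radius [R / 8]. Hence
    [2048 = 16 * 16 * 8]. *)
Lemma holomorphic_second_difference (f : E -> C) (w : E) (R B : R) : 0 < R ->
  (forall x : E, norm (minus x w) < R -> ex_filterdiff (V := C_NormedModule) f (locally x)) ->
  (forall x : E, norm (minus x w) < R -> Cmod (f x) <= B) ->
  forall x y h : E, norm (minus x w) < R / 32 -> norm (minus y w) < R / 32 -> norm h < R / 8 ->
    Cmod ((f (plus y h) - f y) - (f (plus x h) - f x))%C <= 2048 * B / R ^ 2 * norm h * norm (minus y x).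
Proof.
  intros HR Hf HB x y h Hx Hy Hh.
  assert (Hin : forall z : E, norm (minus z w) < R / 8 -> norm (minus (plus z h) w) < R / 4).
  { intros z Hz. eapply Rle_lt_trans; [apply norm_minus_plus_le|]. lra. }
  replace (2048 * B / R ^ 2 * norm h) with (16 * (16 * B / R * norm h) / (R / 8)) by (field; lra).
  apply (holomorphic_lipschitz (fun x => f (plus x h) - f x)%C w (R / 8) (16 * B / R * norm h)); try lra.
  - intros z Hz. destruct (Hf z) as [l1 Hl1]; [lra|].
    destruct (Hf (plus z h)) as [l2 Hl2]; [specialize (Hin z Hz); lra|].
    eexists. apply cdiff_minus; [|exact Hl1].
    apply (filterdiff_comp' (V := E) (W := C_NormedModule) (fun z => plus z h) f z (fun k => k) l2); auto.
    eapply filterdiff_ext_lin.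
    + apply (filterdiff_plus_fct (U := E) (V := E)); [apply filterdiff_id | apply filterdiff_const].
    + intros k. simpl. apply plus_zero_r.
  - intros z Hz. assert (A := holomorphic_lipschitz f w R B HR Hf HB z (plus z h) ltac:(lra) (Hin z Hz)).
    replace (minus (plus z h) z) with h in A by (symmetry; apply plus_minus_r). exact A.
Qed.

(** The increment of [f] by [h = y - x] is moved from [x] to [w], at a cost of [K |h| |x - w|]; at
    [w] plain differentiability concludes. *)
Lemma holomorphic_strict_diff (f : E -> C) (w : E) (R : R) (l : E -> C) : 0 < R ->
  (forall x : E, norm (minus x w) < R -> ex_filterdiff (V := C_NormedModule) f (locally x)) ->
  cdiff f w l ->
  forall eps, 0 < eps -> exists d, 0 < d /\ forall x y : E, norm (minus x w) < d -> norm (minus y w) < d ->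
    Cmod (f y - f x - l (minus y x))%C <= eps * norm (minus y x).
Proof.
  intros HR Hf Hl eps He.
  destruct (ex_filterdiff_continuous_norm (F := C_NormedModule) f w (ex_intro _ l Hl) 1 Rlt_0_1)
    as (d0 & Hd0 & Hc).
  set (r := Rmin R d0). assert (Hr : 0 < r) by (apply Rmin_glb_lt; auto).
  set (B := Cmod (f w) + 1). assert (HBp : 0 < B) by (unfold B; generalize (Cmod_ge_0 (f w)); lra).
  assert (Hf' : forall x : E, norm (minus x w) < r -> ex_filterdiff (V := C_NormedModule) f (locally x)).
  { intros x Hx. apply Hf. eapply Rlt_le_trans; [exact Hx|apply Rmin_l]. }
  assert (HB : forall x : E, norm (minus x w) < r -> Cmod (f x) <= B).
  { intros x Hx. specialize (Hc x). unfold B. 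
    change (norm (minus (f x) (f w))) with (Cmod (f x - f w)%C) in Hc.
    assert (norm (minus x w) < d0) by (eapply Rlt_le_trans; [exact Hx|apply Rmin_r]).
    specialize (Hc H). replace (f x) with (f w + (f x - f w))%C by ring.
    eapply Rle_trans; [apply Cmod_triangle|]. lra. }
  destruct (proj1 (filterdiff_eps (F := C_NormedModule) f w l) Hl) as [Hlin Hl'].
  destruct (Hl' (eps / 2)) as (d1 & Hd1 & H1); [lra|].
  set (K := 2048 * B / r ^ 2).
  assert (HK : 0 < K) by (apply Rdiv_lt_0_compat; [lra|apply pow_lt; auto]).
  set (d := Rmin (Rmin (r / 32) (d1 / 2)) (eps / (2 * K))).
  assert (Hd : 0 < d).
  { unfold d. repeat apply Rmin_glb_lt; try lra. apply Rdiv_lt_0_compat; lra. }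
  assert (D1 : d <= r / 32) by (unfold d; eapply Rle_trans; [apply Rmin_l|apply Rmin_l]).
  assert (D2 : d <= d1 / 2) by (unfold d; eapply Rle_trans; [apply Rmin_l|apply Rmin_r]).
  assert (D3 : d <= eps / (2 * K)) by (unfold d; apply Rmin_r).
  exists d; split; auto. intros x y Hx Hy. set (h := minus y x).
  assert (Hh : norm h < 2 * d).
  { generalize (norm_minus_triangle x y w). fold h. lra. }
  assert (A : norm (minus w w) < r / 32) by (apply Rle_lt_trans with 0; [right; exact (minus_self_norm w)|lra]).
  assert (S := holomorphic_second_difference f w r B Hr Hf' HB w x h A ltac:(lra) ltac:(lra)).
  replace (plus x h) with y in S by (symmetry; apply plus_minus_cancel).
  specialize (H1 (plus w h)).
  replace (minus (plus w h) w) with h in H1 by (symmetry; apply plus_minus_r). specialize (H1 ltac:(lra)).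
  change (Cmod ((f (plus w h) - f w) - l h)%C <= eps / 2 * norm h) in H1.
  replace (f y - f x - l h)%C with
    ((f y - f x) - (f (plus w h) - f w) + ((f (plus w h) - f w) - l h))%C by ring.
  eapply Rle_trans; [apply Cmod_triangle|].
  assert (T : K * norm h * norm (minus x w) <= eps / 2 * norm h).
  { replace (eps / 2 * norm h) with (K * norm h * (eps / (2 * K))) by (field; lra).
    apply Rmult_le_compat_l; [|lra]. apply Rmult_le_pos; [lra|apply norm_ge_0]. }
  unfold K in T at 1. lra.
Qed.

End Regularity.

(** * Cartan's uniqueness theorem in the disc *)

(** The indicator of [A], extended past the interval by clamping, has derivative 0 on it, so the
    mean value theorem equates its end values. *)
Lemma unit_interval_connected (A : R -> Prop) :
  (forall t, 0 <= t <= 1 -> exists d, 0 < d /\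
     forall t', 0 <= t' <= 1 -> Rabs (t' - t) < d -> (A t' <-> A t)) ->
  A 0 -> A 1.
Proof.
  intros H H0.
  pose (cl := fun t => Rmax 0 (Rmin t 1)).
  assert (Hcl : forall t, 0 <= cl t <= 1).
  { intros t. unfold cl. split; [apply Rmax_l|]. apply Rmax_lub; [lra|apply Rmin_r]. }
  assert (Hcl1 : forall t, 0 <= t <= 1 -> cl t = t).
  { intros t Ht. unfold cl. rewrite Rmin_left, Rmax_right; lra. }
  assert (Hcl2 : forall t t', 0 <= t <= 1 -> Rabs (cl t' - t) <= Rabs (t' - t)).
  { intros t t' Ht. unfold cl, Rmax, Rmin. destruct (Rle_dec t' 1); destruct (Rle_dec 0 _);
      unfold Rabs; repeat destruct (Rcase_abs _); lra. }
  pose (f := fun t => if excluded_middle_informative (A (cl t)) then 1 else 0).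
  assert (Hf : forall t, 0 <= t <= 1 -> is_derive f t 0).
  { intros t Ht. apply is_derive_Reals. intros eps He. destruct (H t Ht) as (d & Hd & Hd').
    exists (mkposreal d Hd). intros h Hh0 Hh. simpl in Hh.
    assert (E : f (t + h) = f t).
    { assert (K : A (cl (t + h)) <-> A (cl t)).
      { rewrite (Hcl1 t Ht). apply Hd'; auto. eapply Rle_lt_trans; [apply Hcl2; auto|].
        replace (t + h - t) with h by ring. exact Hh. }
      unfold f. destruct (excluded_middle_informative (A (cl (t + h))));
        destruct (excluded_middle_informative (A (cl t))); tauto. }
    rewrite E. replace ((f t - f t) / h - 0) with 0 by (field; auto). rewrite Rabs_R0; auto. }
  destruct (MVT_gen f 0 1 (fun _ => 0)) as (t & _ & E).
  - rewrite Rmin_left, Rmax_right by lra. intros t Ht. apply Hf; lra.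
  - rewrite Rmin_left, Rmax_right by lra. intros t Ht.
    apply derivable_continuous_pt. exists 0. apply is_derive_Reals, Hf; auto.
  - revert E. unfold f. rewrite !Hcl1 by lra.
    destruct (excluded_middle_informative (A 1)); auto.
    destruct (excluded_middle_informative (A 0)); [lra|contradiction].
Qed.

(** The closedness half of an identity principle. The open sets where [f = lam] may shrink as their
    points [x] approach [w], so the increments from [x] to [x + s v] are compared with [l] by strict
    differentiability at [w]. *)
Lemma agree_linear_limit {E : NormedModule C_AbsRing} (f : E -> C) (w : E) (R : R) (l lam : E -> C) :
  0 < R -> (forall x : E, norm (minus x w) < R -> ex_filterdiff (V := C_NormedModule) f (locally x)) ->
  cdiff f w l -> is_linear (V := C_NormedModule) lam ->
  (forall d, 0 < d -> exists x : E, norm (minus x w) < d /\ locally x (fun y => f y = lam y)) ->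
  f w = lam w /\ forall v, l v = lam v.
Proof.
  intros HR Hf Hl Hlam Hnear. split.
  - assert (Hdiff : cdiff (fun x => Cminus (f x) (lam x)) w (fun v => Cminus (l v) (lam v))).
    { apply cdiff_minus; auto. apply filterdiff_linear, Hlam. }
    apply NNPP; intros Hne. set (c := Cminus (f w) (lam w)).
    assert (Hc : 0 < Cmod c).
    { apply Cmod_gt_0. intros F. apply Hne. unfold c in F.
      replace (f w) with (Cplus (Cminus (f w) (lam w)) (lam w)) by ring. rewrite F. ring. }
    destruct (ex_filterdiff_continuous_norm (F := C_NormedModule) _ w (ex_intro _ _ Hdiff) (Cmod c) Hc)
      as (d & Hd & Hd').
    destruct (Hnear d Hd) as (x & Hx & Hloc). specialize (Hd' x Hx).
    apply locally_singleton in Hloc. rewrite Hloc in Hd'.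
    change (Cmod ((lam x - lam x) - c)%C < Cmod c) in Hd'.
    replace ((lam x - lam x) - c)%C with (Copp c) in Hd' by ring. rewrite Cmod_opp in Hd'. lra.
  - intros v. assert (Hv := norm_ge_0 v).
    assert (Hall : forall eps, 0 < eps -> Cmod (lam v - l v)%C <= eps * norm v).
    { intros eps He. destruct (holomorphic_strict_diff f w R l HR Hf Hl eps He) as (d & Hd & Hd').
      destruct (Hnear d Hd) as (x & Hx & Hloc).
      apply locally_norm_iff in Hloc. destruct Hloc as (d1 & Hd1 & Hloc).
      set (m := Rmin d1 (d - norm (minus x w))). assert (Hm : 0 < m) by (apply Rmin_glb_lt; lra).
      set (s := m / (2 * (norm v + 1))). assert (Hs : 0 < s) by (apply Rdiv_lt_0_compat; lra).
      set (sv := scal (RtoC s) v).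
      assert (Hsv : norm sv < m).
      { eapply Rle_lt_trans; [apply (norm_scal (K := C_AbsRing))|].
        change (Cmod (RtoC s) * norm v < m). rewrite Cmod_R, Rabs_pos_eq by lra.
        apply Rlt_le_trans with (s * (2 * (norm v + 1))).
        - apply Rmult_lt_compat_l; lra.
        - unfold s. right. field. lra. }
      assert (Exy : minus (plus x sv) x = sv) by apply plus_minus_r.
      assert (Hy : norm (minus (plus x sv) w) < d).
      { eapply Rle_lt_trans; [apply norm_minus_plus_le|].
        assert (m <= d - norm (minus x w)) by apply Rmin_r. lra. }
      specialize (Hd' x (plus x sv) Hx Hy). rewrite (Hloc (plus x sv)) in Hd'.
      2: { replace (minus (plus x sv) x) with sv by (symmetry; exact Exy).
           eapply Rlt_le_trans; [exact Hsv|apply Rmin_l]. }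
      rewrite (Hloc x) in Hd' by (apply Rle_lt_trans with 0; [right; apply minus_self_norm|lra]).
      replace (minus (plus x sv) x) with sv in Hd' by (symmetry; exact Exy).
      assert (Lp : lam (plus x sv) = Cplus (lam x) (lam sv)) by apply (linear_plus lam Hlam).
      assert (Ls : lam sv = Cmult (RtoC s) (lam v)) by apply (linear_scal lam Hlam).
      assert (Ll : l sv = Cmult (RtoC s) (l v)) by (destruct Hl as [Hl _]; apply (linear_scal l Hl)).
      rewrite Lp, Ls, Ll in Hd'.
      replace (lam x + s * lam v - lam x - s * l v)%C with (s * (lam v - l v))%C in Hd' by ring.
      rewrite Cmod_mult, Cmod_R, Rabs_pos_eq in Hd' by lra.
      assert (N : norm sv <= s * norm v).
      { eapply Rle_trans; [apply (norm_scal (K := C_AbsRing))|].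
        change (Cmod (RtoC s) * norm v <= s * norm v). rewrite Cmod_R, Rabs_pos_eq by lra. lra. }
      apply Rmult_le_reg_l with s; auto. nra. }
    assert (Z : Cmod (lam v - l v)%C <= 0).
    { apply le_epsilon. intros e He. 
      assert (A := Hall (e / (norm v + 1)) ltac:(apply Rdiv_lt_0_compat; lra)).
      eapply Rle_trans; [exact A|]. apply Rle_trans with (e / (norm v + 1) * (norm v + 1)).
      - apply Rmult_le_compat_l; [left; apply Rdiv_lt_0_compat; lra|lra].
      - right; field; lra. }
    assert (Z' : (lam v - l v)%C = RtoC 0).
    { apply Cmod_eq_0. generalize (Cmod_ge_0 (lam v - l v)%C). lra. }
    replace (lam v) with ((lam v - l v) + l v)%C by ring. rewrite Z'. ring.
Qed.

(** The second difference with increment [t], divided by [t], tends to the difference of the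
    derivatives. *)
Lemma derivative_lipschitz (f lw ly : C -> C) (w y : C) (R B : R) : 0 < R ->
  (forall x : C_NormedModule, Cmod (x - w)%C < R -> ex_filterdiff (V := C_NormedModule) f (locally x)) ->
  (forall x : C, Cmod (x - w)%C < R -> Cmod (f x) <= B) ->
  cdiff f (w : C_NormedModule) lw -> cdiff f (y : C_NormedModule) ly -> Cmod (y - w)%C < R / 32 ->
  Cmod (ly (RtoC 1) - lw (RtoC 1))%C <= 2048 * B / R ^ 2 * Cmod (y - w)%C.
Proof.
  intros HR Hf HB Hlw Hly Hy. apply le_epsilon. intros eps He.
  destruct (C_diff_eps f w lw Hlw (eps / 2)) as (d1 & Hd1 & H1); [lra|].
  destruct (C_diff_eps f y ly Hly (eps / 2)) as (d2 & Hd2 & H2); [lra|].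
  set (t := Rmin (Rmin d1 d2) (R / 8) / 2).
  assert (Ht : 0 < t).
  { unfold t. assert (0 < Rmin (Rmin d1 d2) (R / 8)) by (repeat apply Rmin_glb_lt; lra). lra. }
  assert (T1 : t < d1).
  { unfold t in *. generalize (Rmin_l (Rmin d1 d2) (R / 8)) (Rmin_l d1 d2). lra. }
  assert (T2 : t < d2).
  { unfold t in *. generalize (Rmin_l (Rmin d1 d2) (R / 8)) (Rmin_r d1 d2). lra. }
  assert (T3 : t < R / 8).
  { unfold t in *. generalize (Rmin_r (Rmin d1 d2) (R / 8)). lra. }
  assert (Ct : Cmod (RtoC t) = t) by (rewrite Cmod_R, Rabs_pos_eq; lra).
  specialize (H1 (RtoC t)). specialize (H2 (RtoC t)). rewrite Ct in H1, H2.
  specialize (H1 T1). specialize (H2 T2).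
  assert (S : Cmod ((f (y + t) - f y) - (f (w + t) - f w))%C <= 2048 * B / R ^ 2 * t * Cmod (y - w)%C).
  { rewrite <- Ct at 3. apply (holomorphic_second_difference (E := C_NormedModule) f w R B HR Hf HB w y (RtoC t)).
    - change (Cmod (w - w)%C < R / 32). replace (w - w)%C with (RtoC 0) by ring. rewrite Cmod_0. lra.
    - exact Hy.
    - change (Cmod (RtoC t) < R / 8). lra. }
  apply Rmult_le_reg_l with t; auto. rewrite <- Ct at 1. rewrite <- Cmod_mult.
  replace (t * (ly (RtoC 1) - lw (RtoC 1)))%C with
    (((f (y + t) - f y) - (f (w + t) - f w)) + (f (w + t) - f w - lw (RtoC 1) * t)
       - (f (y + t) - f y - ly (RtoC 1) * t))%C by ring.
  unfold Cminus at 1. eapply Rle_trans; [apply Cmod_triangle|]. rewrite Cmod_opp.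
  assert (A := Cmod_triangle ((f (y + t) - f y) - (f (w + t) - f w))%C (f (w + t) - f w - lw (RtoC 1) * t)%C).
  lra.
Qed.

(** The base point is a parameter because the local argument is restarted at other points of the
    disc. For fixed [w] the class is closed under composition. *)
Definition disc_selfmap_tangent_id (w : C) (f : C -> C) :=
  holomorphic_on (E := C_NormedModule) (F := C_NormedModule) unit_disc f /\
  maps_into unit_disc unit_disc f /\ f w = w /\
  exists l, cdiff f (w : C_NormedModule) l /\ l (RtoC 1) = RtoC 1.

(* If [f] moves a point near [w] by [e], then [f o f] moves it by nearly [2 e]: since all maps
   of the class are uniformly bounded, no displacement is possible. *)
Lemma cartan_rigidity_local (w : C) : Cmod w < 1 ->
  exists d, 0 < d /\ forall f z, disc_selfmap_tangent_id w f -> Cmod (z - w)%C < d -> f z = z.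
Proof.
  intros Hw. set (R := 1 - Cmod w). assert (HR : 0 < R) by (unfold R; lra).
  assert (Hball : forall x, Cmod (x - w)%C < R -> Cmod x < 1).
  { intros x Hx. replace x with ((x - w) + w)%C by ring.
    eapply Rle_lt_trans; [apply Cmod_triangle|]. unfold R in Hx; lra. }
  set (K := 2048 * 1 / R ^ 2). assert (HK : 0 < K) by (apply Rdiv_lt_0_compat; [lra|apply pow_lt; auto]).
  (* [K] is a Lipschitz constant for the derivative, so within [rho] of [w] the derivative differs
     from 1 by at most 1/2. *)
  set (rho := Rmin (R / 64) (/ (2 * K))).
  assert (Hrho : 0 < rho) by (apply Rmin_glb_lt; [lra|apply Rinv_0_lt_compat; lra]).
  assert (R1 : rho <= R / 64) by apply Rmin_l.
  assert (R2 : K * rho <= / 2).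
  { assert (rho <= / (2 * K)) by apply Rmin_r.
    apply Rle_trans with (K * / (2 * K)); [apply Rmult_le_compat_l; lra|right; field; lra]. }
  set (Lam := 16 * 1 / R). assert (HLam : 1 < Lam).
  { unfold Lam. apply Rmult_lt_reg_r with R; auto. unfold Rdiv. rewrite Rmult_assoc, Rinv_l by lra.
    unfold R; generalize (Cmod_ge_0 w); lra. }
  (* [Lam] is a Lipschitz constant for the whole class, so [f z] is still within [rho] of [w]. *)
  set (d := rho / Lam). assert (Hd : 0 < d) by (apply Rdiv_lt_0_compat; lra).
  assert (Hdl : Lam * d = rho) by (unfold d; field; lra).
  assert (Hdr : d <= rho) by nra.
  exists d; split; auto. intros f0 z Hf0 Hz.
  (* The induction is uniform in [f]. The bound at rank [k] for [f o f] gives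
     [3/2 |f z - z| <= 2 (3/4)^k], a gain of [2/3], which is better than [3/4]. *)
  assert (Hstep : forall k f, disc_selfmap_tangent_id w f -> Cmod (f z - z)%C <= 2 * (3 / 4) ^ k).
  { intros k; induction k; intros f (Hhol & Hmap & Hfix & l & Hl & Hl1).
    - assert (Hz1 : Cmod z < 1) by (apply Hball; lra). assert (Cmod (f z) < 1) by (apply Hmap, Hz1).
      unfold Cminus. eapply Rle_trans; [apply Cmod_triangle|]. rewrite Cmod_opp. simpl. lra.
    - assert (Hff : disc_selfmap_tangent_id w (fun x => f (f x))).
      { split; [|split; [|split]].
        - intros x Hx. destruct (Hhol x Hx) as [l1 H1]. destruct (Hhol (f x) (Hmap x Hx)) as [l2 H2].
          eexists. exact (filterdiff_comp' (U := C_NormedModule) (V := C_NormedModule) (W := C_NormedModule) f f x l1 l2 H1 H2).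
        - intros x Hx. apply Hmap, Hmap, Hx.
        - rewrite Hfix. exact Hfix.
        - exists (fun h => l (l h)). split; [|rewrite Hl1; exact Hl1].
          apply (filterdiff_comp' (U := C_NormedModule) (V := C_NormedModule) (W := C_NormedModule) f f); auto.
          rewrite Hfix. exact Hl. }
      specialize (IHk _ Hff) as I2. specialize (IHk f) as I1.
      assert (I1' : Cmod (f z - z)%C <= 2 * (3 / 4) ^ k) by (apply I1; repeat split; auto; exists l; auto).
      clear I1 IHk. simpl in I2.
      assert (Hf' : forall x : C_NormedModule, Cmod (x - w)%C < R -> ex_filterdiff (V := C_NormedModule) f (locally x)).
      { intros x Hx. apply Hhol, Hball, Hx. }
      assert (HB : forall x : C, Cmod (x - w)%C < R -> Cmod (f x) <= 1).
      { intros x Hx. left. apply Hmap, Hball, Hx. }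
      assert (Hfz : Cmod (f z - w)%C <= rho).
      { rewrite <- Hfix at 1. rewrite <- Hdl.
        eapply Rle_trans; [apply (holomorphic_lipschitz (E := C_NormedModule) f w R 1 HR Hf' HB w z)|].
        - change (Cmod (w - w)%C < R / 4). replace (w - w)%C with (RtoC 0) by ring. rewrite Cmod_0. lra.
        - change (Cmod (z - w)%C < R / 4). lra.
        - apply Rmult_le_compat_l; [fold Lam; lra|]. left. exact Hz. }
      (* The displacement of [f] along the segment from [z] to [f z]: its derivative is
         [(f' - 1) (f z - z)], and its end values are the first and second displacements in the
         iteration. *)
      set (u := fun k => (f (z + k * (f z - z)) - (z + k * (f z - z)))%C).
      assert (M : Cmod (u (RtoC 1) - u (RtoC 0))%C <= / 2 * Cmod (f z - z)%C).
      { apply (C_mean_value u). intros t Ht. set (x := (z + t * (f z - z))%C).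
        assert (Hx : Cmod (x - w)%C <= rho).
        { replace (x - w)%C with (RtoC (1 - t) * (z - w) + RtoC t * (f z - w))%C
            by (unfold x; rewrite RtoC_minus; ring).
          eapply Rle_trans; [apply Cmod_triangle|]. rewrite !Cmod_mult, !Cmod_R, !Rabs_pos_eq by lra. nra. }
        destruct (Hf' x) as [lx Hlx]; [lra|].
        assert (Haff : filterdiff (U := C_NormedModule) (V := C_NormedModule)
           (fun k => (z + k * (f z - z))%C) (locally (RtoC t)) (fun h => (h * (f z - z))%C)).
        { exact (filterdiff_affine (E := C_NormedModule) z (f z - z)%C (RtoC t)). }
        exists (fun h => (lx (h * (f z - z)) - h * (f z - z))%C). split.
        - apply (cdiff_minus (E := C_NormedModule)); [|exact Haff].
          exact (filterdiff_comp' (U := C_NormedModule) (V := C_NormedModule) (W := C_NormedModule)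
             _ f _ _ lx Haff Hlx).
        - rewrite Cmult_1_l, (C_linear_eq lx _ (proj1 Hlx)).
          replace (lx (RtoC 1) * (f z - z) - (f z - z))%C with ((lx (RtoC 1) - l (RtoC 1)) * (f z - z))%C
            by (rewrite Hl1; ring).
          rewrite Cmod_mult. apply Rmult_le_compat_r; [apply Cmod_ge_0|].
          assert (D := derivative_lipschitz f l lx w x R 1 HR Hf' HB Hl Hlx ltac:(lra)).
          fold K in D. assert (K * Cmod (x - w)%C <= K * rho) by (apply Rmult_le_compat_l; lra). lra. }
      unfold u in M.
      replace (z + 1 * (f z - z))%C with (f z) in M by ring.
      replace (z + 0 * (f z - z))%C with z in M by ring.
      assert (T : Cmod (2 * (f z - z))%C <= 2 * (3 / 4) ^ k + / 2 * Cmod (f z - z)%C).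
      { replace (2 * (f z - z))%C with ((f (f z) - z) + Copp (f (f z) - f z - (f z - z)))%C by ring.
        eapply Rle_trans; [apply Cmod_triangle|]. rewrite Cmod_opp. lra. }
      rewrite Cmod_mult, Cmod_R, Rabs_pos_eq in T by lra. simpl. lra. }
  assert (Z : Cmod (f0 z - z)%C <= 0).
  { apply le_epsilon. intros e He.
    destruct (pow_lt_1_zero (3 / 4) ltac:(rewrite Rabs_pos_eq; lra) (e / 2) ltac:(lra)) as [N HN].
    specialize (HN N (le_n N)). rewrite Rabs_pos_eq in HN by (apply pow_le; lra).
    specialize (Hstep N f0 Hf0). lra. }
  assert (Z' : (f0 z - z)%C = RtoC 0).
  { apply Cmod_eq_0. generalize (Cmod_ge_0 (f0 z - z)%C). lra. }
  replace (f0 z) with ((f0 z - z) + z)%C by ring. rewrite Z'. ring.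
Qed.

Definition locally_constant_on {E : NormedModule C_AbsRing} (U A : E -> Prop) :=
  forall x : E, U x -> exists d, 0 < d /\ forall y : E, U y -> norm (minus y x) < d -> (A y <-> A x).

Lemma locally_constant_path {E : NormedModule C_AbsRing} (U A : E -> Prop) (g : R -> E) (L : R) :
  locally_constant_on U A -> (forall t, 0 <= t <= 1 -> U (g t)) ->
  (forall t t', 0 <= t <= 1 -> 0 <= t' <= 1 -> norm (minus (g t') (g t)) <= L * Rabs (t' - t)) ->
  (A (g 0) <-> A (g 1)).
Proof.
  intros HA HU HL.
  assert (Hloc : forall t, 0 <= t <= 1 -> exists d, 0 < d /\
     forall t', 0 <= t' <= 1 -> Rabs (t' - t) < d -> (A (g t') <-> A (g t))).
  { intros t Ht. destruct (HA (g t) (HU t Ht)) as (d & Hd & H).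
    assert (HL0 : 0 < Rabs L + 1) by (generalize (Rabs_pos L); lra).
    exists (d / (Rabs L + 1)). split; [apply Rdiv_lt_0_compat; lra|]. intros t' Ht' Htt.
    apply H; [apply HU; auto|]. eapply Rle_lt_trans; [apply HL; auto|].
    apply Rle_lt_trans with (Rabs L * Rabs (t' - t)).
    - apply Rmult_le_compat_r; [apply Rabs_pos|apply Rle_abs].
    - apply Rle_lt_trans with ((Rabs L + 1) * Rabs (t' - t)); [generalize (Rabs_pos (t' - t)); lra|].
      apply (Rmult_lt_compat_l (Rabs L + 1)) in Htt; auto.
      replace ((Rabs L + 1) * (d / (Rabs L + 1))) with d in Htt by (field; lra). exact Htt. }
  split.
  - apply (unit_interval_connected (fun t => A (g t)) Hloc).
  - intros H1. apply NNPP. intros H0.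
    apply (unit_interval_connected (fun t => ~ A (g t))) in H0; [contradiction|].
    intros t Ht. destruct (Hloc t Ht) as (d & Hd & H). exists d; split; auto.
    intros t' Ht' Htt. specialize (H t' Ht' Htt). tauto.
Qed.

(** An interior is always open, so only its relative closedness in [U] has to be supplied. *)
Lemma locally_constant_locally {E : NormedModule C_AbsRing} (U P : E -> Prop) :
  (forall x : E, U x ->
     (forall d, 0 < d -> exists y : E, norm (minus y x) < d /\ locally y P) -> locally x P) ->
  locally_constant_on U (fun x => locally x P).
Proof.
  intros H x Hx. destruct (classic (locally x P)) as [Lx|Lx].
  - assert (Lx' := locally_locally x P Lx). apply locally_norm_iff in Lx'.
    destruct Lx' as (d & Hd & Hd'). exists d; split; auto. intros y _ Hy. split; auto.
  - destruct (classic (exists d, 0 < d /\ forall y : E, norm (minus y x) < d -> ~ locally y P))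
      as [(d & Hd & Hd')|N].
    + exists d; split; auto. intros y _ Hy. specialize (Hd' y Hy). tauto.
    + exfalso. apply Lx, H; auto. intros d Hd. apply NNPP. intros N'. apply N.
      exists d; split; auto. intros y Hy Ly. apply N'. exists y; auto.
Qed.

(** At a limit [x] of points near which [f] is the identity, [agree_linear_limit] recovers [f x = x]
    and derivative 1, so the local rigidity starts afresh at [x]; the segment from 0 to [z] is then
    exhausted. *)
Lemma cartan_rigidity_disc (f : C -> C) (z : C) :
  disc_selfmap_tangent_id (RtoC 0) f -> Cmod z < 1 -> f z = z.
Proof.
  intros Hf Hz.
  assert (Hloc : forall w, Cmod w < 1 -> disc_selfmap_tangent_id w f ->
     locally (w : C_NormedModule) (fun y : C_NormedModule => f y = y)).
  { intros w Hw Hfw. destruct (cartan_rigidity_local w Hw) as (d & Hd & H).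
    apply locally_norm_iff. exists d; split; auto. }
  apply (locally_singleton (T := C_NormedModule) z (fun y => f y = y)).
  assert (H01 : locally (0 * z : C_NormedModule)%C (fun y : C_NormedModule => f y = y) <->
                locally (1 * z : C_NormedModule)%C (fun y : C_NormedModule => f y = y)).
  { apply (locally_constant_path unit_disc
      (fun x : C_NormedModule => locally x (fun y : C_NormedModule => f y = y)) (fun t => (RtoC t * z)%C) (Cmod z)).
    - apply locally_constant_locally. intros x Hx Hnear. apply Hloc; auto.
      destruct Hf as (Hhol & Hmap & _ & _). destruct (Hhol x Hx) as [l Hl].
      change (Cmod x < 1) in Hx.
      destruct (agree_linear_limit f x (1 - Cmod x) l (fun h => h)) as [E1 E2]; auto; try lra.
      + intros y Hy. apply Hhol. change (Cmod (y - x)%C < 1 - Cmod x) in Hy. change (Cmod y < 1).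
        replace (y : C) with ((y - x) + x)%C by ring.
        eapply Rle_lt_trans; [apply Cmod_triangle|]. lra.
      + apply (is_linear_id (V := C_NormedModule)).
      + split; auto. split; auto. split; auto. exists l. split; auto.
    - intros t Ht. change (Cmod (t * z)%C < 1).
      rewrite Cmod_mult, Cmod_R, Rabs_pos_eq by lra. generalize (Cmod_ge_0 z). nra.
    - intros t t' _ _. change (Cmod (t' * z - t * z)%C <= Cmod z * Rabs (t' - t)).
      replace (t' * z - t * z)%C with (RtoC (t' - t) * z)%C by (rewrite RtoC_minus; ring).
      rewrite Cmod_mult, Cmod_R. lra. }
  rewrite Cmult_0_l, Cmult_1_l in H01. apply H01, Hloc; auto. rewrite Cmod_0; lra.
Qed.

(** * Topology of the symmetrized bidisc *)

Lemma Csqrt_exists (c : C) : exists d : C, (d * d)%C = c.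
Proof.
  destruct c as [a b]. set (r := Cmod (a, b)).
  assert (Hr : r * r = a * a + b * b).
  { unfold r, Cmod; simpl. rewrite sqrt_sqrt; [ring|nra]. }
  assert (Hr0 : 0 <= r) by apply Cmod_ge_0.
  assert (H1 : 0 <= (r + a) / 2) by nra.
  assert (H2 : 0 <= (r - a) / 2) by nra.
  assert (S1 := sqrt_sqrt _ H1). assert (S2 := sqrt_sqrt _ H2).
  assert (S0 : 2 * (sqrt ((r + a) / 2) * sqrt ((r - a) / 2)) = Rabs b).
  { rewrite <- sqrt_mult by auto.
    replace ((r + a) / 2 * ((r - a) / 2)) with (b * b / 4) by (field_simplify; nra).
    replace (b * b / 4) with (Rsqr (b / 2)) by (unfold Rsqr; field). rewrite sqrt_Rsqr_abs.
    unfold Rdiv. rewrite Rabs_mult, (Rabs_pos_eq (/ 2)) by lra. lra. }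
  destruct (Rle_dec 0 b) as [Hb|Hb].
  - exists (sqrt ((r + a) / 2), sqrt ((r - a) / 2)). rewrite Rabs_pos_eq in S0 by auto.
    unfold Cmult; simpl. f_equal; lra.
  - exists (sqrt ((r + a) / 2), - sqrt ((r - a) / 2)). rewrite Rabs_left in S0 by lra.
    unfold Cmult; simpl. f_equal; lra.
Qed.

Lemma Cmod_sqr (z : C) : Cmod z * Cmod z = Re z * Re z + Im z * Im z.
Proof. generalize (Cmod2_alt z). simpl. lra. Qed.

Lemma cayley_re_pos (z : C) : Cmod z < 1 -> (1 - z)%C <> RtoC 0 /\ 0 < Re ((1 + z) / (1 - z))%C.
Proof.
  intros Hz. assert (Hs := Cmod_sqr z). assert (H0 := Cmod_ge_0 z).
  destruct z as [a b]. unfold Re, Im in *; simpl in *.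
  assert (Hab : a * a + b * b < 1) by nra.
  assert (Ha : a < 1) by nra.
  split.
  - intros E. apply (f_equal fst) in E. simpl in E. lra.
  - unfold Cdiv, Cinv, Cmult; simpl.
    assert (Hd : 0 < (1 + - a) * ((1 + - a) * 1) + (0 + - b) * ((0 + - b) * 1)) by nra.
    match goal with |- 0 < ?x => replace x with
      ((1 - (a * a + b * b)) / ((1 + - a) * ((1 + - a) * 1) + (0 + - b) * ((0 + - b) * 1))) end.
    + apply Rdiv_lt_0_compat; lra.
    + field. lra.
Qed.

Lemma inverse_cayley_disc (z : C) : 0 < Re z ->
  (z + 1)%C <> RtoC 0 /\ Cmod ((z - 1) / (z + 1))%C < 1.
Proof.
  intros Hz. assert (H1 : (z + 1)%C <> RtoC 0).
  { intros E. apply (f_equal Re) in E. unfold Re in *. simpl in E. lra. }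
  split; auto. rewrite Cmod_div by auto. assert (0 < Cmod (z + 1)%C) by (apply Cmod_gt_0; auto).
  apply Rmult_lt_reg_r with (Cmod (z + 1)%C); auto. unfold Rdiv. rewrite Rmult_assoc, Rinv_l by lra.
  assert (A := Cmod_sqr (z - 1)%C). assert (B := Cmod_sqr (z + 1)%C).
  assert (C0 := Cmod_ge_0 (z - 1)%C). destruct z as [a b]; unfold Re, Im in *; simpl in *. nra.
Qed.

Lemma C2_fst_le (x : C2) : Cmod (fst x) <= norm x.
Proof.
  change (norm x) with (sqrt (Cmod (fst x) ^ 2 + Cmod (snd x) ^ 2)).
  rewrite <- (sqrt_Rsqr (Cmod (fst x))) at 1 by apply Cmod_ge_0. apply sqrt_le_1_alt.
  unfold Rsqr. nra.
Qed.

Lemma C2_snd_le (x : C2) : Cmod (snd x) <= norm x.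
Proof.
  change (norm x) with (sqrt (Cmod (fst x) ^ 2 + Cmod (snd x) ^ 2)).
  rewrite <- (sqrt_Rsqr (Cmod (snd x))) at 1 by apply Cmod_ge_0. apply sqrt_le_1_alt.
  unfold Rsqr. nra.
Qed.

Lemma C2_norm_le (x : C2) : norm x <= Cmod (fst x) + Cmod (snd x).
Proof.
  change (norm x) with (sqrt (Cmod (fst x) ^ 2 + Cmod (snd x) ^ 2)).
  assert (A := Cmod_ge_0 (fst x)). assert (B := Cmod_ge_0 (snd x)).
  rewrite <- (sqrt_Rsqr (Cmod (fst x) + Cmod (snd x))) by lra. apply sqrt_le_1_alt.
  unfold Rsqr. nra.
Qed.

(** The classical inequality [|s - conj(s) p| + |p|^2 < 1] describes G without reference to the
    roots, and makes its openness visible. *)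
Definition G_defect (x : C2) : R :=
  Cmod (fst x - Cconj (fst x) * snd x)%C + Cmod (snd x) * Cmod (snd x).

Lemma G_defect_split (z w : C) :
  (z + w - Cconj (z + w) * (z * w))%C =
  (z * RtoC (1 - Cmod w * Cmod w) + w * RtoC (1 - Cmod z * Cmod z))%C.
Proof.
  assert (Ez := Cmod2_conj z). assert (Ew := Cmod2_conj w).
  simpl in Ez, Ew. rewrite Rmult_1_r, RtoC_mult in Ez, Ew.
  rewrite !RtoC_minus, !RtoC_mult, Ez, Ew, Cplus_conj. ring.
Qed.

(** With [a = |z|] and [b = |w|] the defect is at least [(a + b) (1 - a b) + (a b)^2]. If [a b < 1],
    then [a + b >= 1 + a b] because [(a - 1) (1 - b) >= 0]; otherwise [|p|^2] alone suffices. *)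
Lemma G_defect_ge_1 (z w : C) : 1 <= Cmod z -> 1 <= G_defect ((z + w)%C, (z * w)%C).
Proof.
  intros Hz. unfold G_defect; simpl. rewrite G_defect_split, Cmod_mult.
  set (a := Cmod z) in *. set (b := Cmod w). assert (Hb : 0 <= b) by apply Cmod_ge_0.
  assert (T : a * (1 - b * b) - b * (a * a - 1) <=
     Cmod (z * RtoC (1 - b * b) + w * RtoC (1 - a * a))%C).
  { assert (T := Cmod_triangle (z * RtoC (1 - b * b) + w * RtoC (1 - a * a))%C
      (w * RtoC (a * a - 1))%C).
    replace (z * RtoC (1 - b * b) + w * RtoC (1 - a * a) + w * RtoC (a * a - 1))%C
      with (z * RtoC (1 - b * b))%C in T by (rewrite !RtoC_minus; ring).
    rewrite (Cmod_mult z), (Cmod_mult w (RtoC (a * a - 1))), !Cmod_R in T. fold a b in T.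
    rewrite (Rabs_pos_eq (a * a - 1)) in T by nra.
    assert (a * (1 - b * b) <= a * Rabs (1 - b * b)).
    { apply Rmult_le_compat_l; [lra|apply Rle_abs]. } lra. }
  destruct (Rle_dec 1 (a * b)) as [H|H].
  2: { assert (b <= 1) by nra. assert (0 <= (a - 1) * (1 - b)) by nra.
       assert (0 <= ((a + b) - (1 + a * b)) * (1 - a * b)) by (apply Rmult_le_pos; lra). nra. }
  assert (C0 := Cmod_ge_0 (z * RtoC (1 - b * b) + w * RtoC (1 - a * a))%C). nra.
Qed.

(** The triangle inequality now bounds the defect above by the same expression, and
    [(1 - a) (1 - b) > 0] gives [a + b < 1 + a b]. *)
Lemma G_defect_lt_1 (z w : C) : Cmod z < 1 -> Cmod w < 1 -> G_defect ((z + w)%C, (z * w)%C) < 1.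
Proof.
  intros Hz Hw. unfold G_defect; simpl. rewrite G_defect_split, Cmod_mult.
  assert (Hz0 := Cmod_ge_0 z). assert (Hw0 := Cmod_ge_0 w).
  assert (T := Cmod_triangle (z * RtoC (1 - Cmod w * Cmod w))%C (w * RtoC (1 - Cmod z * Cmod z))%C).
  rewrite (Cmod_mult z), (Cmod_mult w), !Cmod_R, !Rabs_pos_eq in T by nra.
  set (a := Cmod z) in *. set (b := Cmod w) in *.
  assert (a * (1 - b * b) + b * (1 - a * a) < 1 - (a * b) * (a * b)); [|lra].
  assert (0 < (1 - a) * (1 - b)) by nra. assert (a * b < 1) by nra.
  replace (a * (1 - b * b) + b * (1 - a * a)) with ((a + b) * (1 - a * b)) by ring. nra.
Qed.

Lemma G_iff_defect (s p : C) : G (s, p) <-> G_defect (s, p) < 1.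
Proof.
  split.
  - intros (z & w & Hz & Hw & ->). apply G_defect_lt_1; auto.
  - intros H. destruct (Csqrt_exists (s * s - 4 * p)%C) as [d Hd].
    set (z := ((s + d) / 2)%C). set (w := ((s - d) / 2)%C).
    assert (Es : s = (z + w)%C) by (unfold z, w; field).
    assert (Ep : p = (z * w)%C).
    { transitivity ((s * s - d * d) / 4)%C.
      - rewrite Hd. field.
      - unfold z, w. field. }
    exists z, w. rewrite Es, Ep in H. split; [|split].
    + apply Rnot_le_lt. intros F. generalize (G_defect_ge_1 z w F). lra.
    + apply Rnot_le_lt. intros F. generalize (G_defect_ge_1 w z F).
      rewrite (Cplus_comm w z), (Cmult_comm w z). lra.
    + rewrite Es, Ep. reflexivity.
Qed.

Lemma G_open (x : C2) : G x -> exists d, 0 < d /\ forall y : C2, norm (minus y x) < d -> G y.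
Proof.
  destruct x as [s0 p0]. pose (s := s0 : C). pose (p := p0 : C).
  change (s0, p0) with (s, p). clearbody s p. clear s0 p0.
  intros Hx. apply G_iff_defect in Hx. unfold G_defect in Hx; simpl in Hx.
  set (A := Cmod (s - Cconj s * p)%C) in *. set (S := Cmod s). set (P := Cmod p) in *.
  assert (HS : 0 <= S) by apply Cmod_ge_0. assert (HP : 0 <= P) by apply Cmod_ge_0.
  assert (HK : 0 < 4 + S + 3 * P) by lra.
  set (d := Rmin 1 ((1 - (A + P * P)) / (4 + S + 3 * P))).
  assert (Hd : 0 < d) by (apply Rmin_glb_lt; [lra|apply Rdiv_lt_0_compat; lra]).
  assert (Hd1 : d <= 1) by apply Rmin_l.
  assert (Hd2 : d * (4 + S + 3 * P) <= 1 - (A + P * P)).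
  { apply Rle_trans with ((1 - (A + P * P)) / (4 + S + 3 * P) * (4 + S + 3 * P)).
    - apply Rmult_le_compat_r; [lra|apply Rmin_r].
    - right. field. lra. }
  exists d; split; auto. intros [s0 p0] Hy. pose (s' := s0 : C). pose (p' := p0 : C).
  change (s0, p0) with (s', p') in *. clearbody s' p'. clear s0 p0. apply G_iff_defect.
  assert (Ha : Cmod (s' - s)%C < d) by (eapply Rle_lt_trans; [apply (C2_fst_le (minus (s', p') (s, p)))|exact Hy]).
  assert (Hb : Cmod (p' - p)%C < d) by (eapply Rle_lt_trans; [apply (C2_snd_le (minus (s', p') (s, p)))|exact Hy]).
  unfold G_defect; simpl.
  assert (Hp' : Cmod p' <= P + d).
  { replace p' with (p + (p' - p))%C by ring. eapply Rle_trans; [apply Cmod_triangle|]. fold P; lra. }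
  assert (Hs' : Cmod s' <= S + d).
  { replace s' with (s + (s' - s))%C by ring. eapply Rle_trans; [apply Cmod_triangle|]. fold S; lra. }
  assert (E : (s' - Cconj s' * p')%C =
    ((s - Cconj s * p) + ((s' - s) + (Copp (Cconj s' * (p' - p)) + Copp (Cconj (s' - s) * p))))%C).
  { unfold Cminus. rewrite Cplus_conj, Copp_conj. ring. }
  assert (T : Cmod (s' - Cconj s' * p')%C <= A + (d + ((S + d) * d + d * P))).
  { rewrite E. eapply Rle_trans; [apply Cmod_triangle|]. apply Rplus_le_compat_l.
    eapply Rle_trans; [apply Cmod_triangle|]. apply Rplus_le_compat; [lra|].
    eapply Rle_trans; [apply Cmod_triangle|]. rewrite !Cmod_opp, !Cmod_mult, !Cmod_conj.
    apply Rplus_le_compat; apply Rmult_le_compat; try apply Cmod_ge_0; fold P; lra. }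
  assert (P2 : Cmod p' * Cmod p' <= (P + d) * (P + d)).
  { apply Rmult_le_compat; auto; apply Cmod_ge_0. }
  assert (d * d <= d * 1) by (apply Rmult_le_compat_l; lra). nra.
Qed.

Lemma G_scale (s p : C) (t : R) : 0 <= t <= 1 -> G (s, p) -> G ((t * s)%C, (t * t * p)%C).
Proof.
  intros Ht (z & w & Hz & Hw & E). injection E as -> ->. exists (t * z)%C, (t * w)%C.
  rewrite !Cmod_mult, !Cmod_R, !Rabs_pos_eq by lra.
  generalize (Cmod_ge_0 z) (Cmod_ge_0 w). intros. split; [nra|split; [nra|]]. f_equal; ring.
Qed.

(** G is not convex, but scaling both roots by [t] is the weighted dilation [(t s, t^2 p)], which
    joins every point to the origin inside G. *)
Lemma G_connected (A : C2 -> Prop) (x y : C2) :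
  locally_constant_on G A -> G x -> G y -> A x -> A y.
Proof.
  intros HA Hx Hy.
  assert (H : forall s p : C, G (s, p) -> (A (RtoC 0, RtoC 0) <-> A (s, p))).
  { intros s p Hsp.
    pose (g := fun t : R => ((t * s)%C, (t * t * p)%C) : C2).
    assert (E0 : g 0 = (RtoC 0, RtoC 0)) by (unfold g; rewrite !Cmult_0_l; reflexivity).
    assert (E1 : g 1 = (s, p)) by (unfold g; rewrite !Cmult_1_l; reflexivity).
    rewrite <- E0, <- E1. apply (locally_constant_path G A g (Cmod s + 2 * Cmod p)); auto.
    - intros t Ht. apply G_scale; auto.
    - intros t t' Ht Ht'. eapply Rle_trans; [apply C2_norm_le|].
      change (Cmod (t' * s - t * s)%C + Cmod (t' * t' * p - t * t * p)%C
        <= (Cmod s + 2 * Cmod p) * Rabs (t' - t)).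
      replace (t' * s - t * s)%C with (RtoC (t' - t) * s)%C by (rewrite RtoC_minus; ring).
      replace (t' * t' * p - t * t * p)%C with (RtoC (t' - t) * (RtoC (t' + t) * p))%C
        by (rewrite RtoC_minus, RtoC_plus; ring).
      rewrite !Cmod_mult, !Cmod_R, (Rabs_pos_eq (t' + t)) by lra.
      assert (0 <= Rabs (t' - t)) by apply Rabs_pos. assert (0 <= Cmod p) by apply Cmod_ge_0.
      assert (Rabs (t' - t) * ((t' + t) * Cmod p) <= Rabs (t' - t) * (2 * Cmod p)).
      { apply Rmult_le_compat_l; auto. apply Rmult_le_compat_r; lra. } lra. }
  destruct x as [s p], y as [s' p']. intros Ax. apply (H s' p' Hy), (H s p Hx), Ax.
Qed.

(** * Fixed points of a retraction *)

Lemma norm_minus_zero_eq {E : NormedModule C_AbsRing} (x y : E) : norm (minus x y) = 0 -> x = y.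
Proof.
  intros H. apply norm_eq_zero in H. rewrite <- (plus_minus_cancel y x). rewrite H.
  exact (plus_zero_r y).
Qed.

Lemma cdiff_unique {E : NormedModule C_AbsRing} (f : E -> C) (x : E) (l1 l2 : E -> C) :
  cdiff f x l1 -> cdiff f x l2 -> forall v, l1 v = l2 v.
Proof.
  intros H1 H2 v.
  assert (H := cdiff_minus f f x l1 l2 H1 H2). apply filterdiff_eps in H. destruct H as [Hlin H].
  set (r := Cminus (l1 v) (l2 v)). assert (Hv := norm_ge_0 v).
  assert (Z : Cmod r <= 0).
  { apply le_epsilon. intros e He.
    destruct (H (e / (norm v + 1))) as (d & Hd & Hd'); [apply Rdiv_lt_0_compat; lra|].
    set (s := d / (2 * (norm v + 1))). assert (Hs : 0 < s) by (apply Rdiv_lt_0_compat; lra).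
    set (sv := scal (RtoC s) v).
    assert (N : norm sv <= s * norm v).
    { eapply Rle_trans; [apply (norm_scal (K := C_AbsRing))|].
      change (Cmod (RtoC s) * norm v <= s * norm v). rewrite Cmod_R, Rabs_pos_eq by lra. lra. }
    specialize (Hd' (plus x sv)).
    replace (minus (plus x sv) x) with sv in Hd' by (symmetry; apply plus_minus_r).
    assert (N2 : norm sv < d).
    { eapply Rle_lt_trans; [exact N|]. apply Rlt_le_trans with (s * (2 * (norm v + 1))).
      - apply Rmult_lt_compat_l; lra.
      - unfold s; right; field; lra. }
    specialize (Hd' N2).
    assert (E1 : Cminus (l1 sv) (l2 sv) = Cmult (RtoC s) r).
    { unfold r, sv. rewrite (linear_scal l1 (proj1 H1)), (linear_scal l2 (proj1 H2)).
      change (RtoC s * l1 v - RtoC s * l2 v = RtoC s * (l1 v - l2 v))%C. ring. }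
    rewrite E1 in Hd'.
    change (Cmod ((f (plus x sv) - f (plus x sv)) - (f x - f x) - RtoC s * r)%C
      <= e / (norm v + 1) * norm sv) in Hd'.
    replace ((f (plus x sv) - f (plus x sv)) - (f x - f x) - RtoC s * r)%C
      with (Copp (RtoC s * r))%C in Hd' by ring.
    rewrite Cmod_opp, Cmod_mult, Cmod_R, Rabs_pos_eq in Hd' by lra.
    apply Rmult_le_reg_l with s; auto. rewrite Rplus_0_l.
    eapply Rle_trans; [exact Hd'|].
    apply Rle_trans with (e / (norm v + 1) * (s * (norm v + 1))).
    - apply Rmult_le_compat_l; [left; apply Rdiv_lt_0_compat; lra|nra].
    - right; field; lra. }
  assert (Z' : r = RtoC 0) by (apply Cmod_eq_0; generalize (Cmod_ge_0 r); lra).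
  replace (l1 v) with (r + l2 v)%C by (unfold r; ring). rewrite Z'. ring.
Qed.

Notation cdiff2 f x l := (filterdiff (V := C2) f (locally x) l).

Lemma cdiff2_fst {E : NormedModule C_AbsRing} (f : E -> C2) (x : E) (l : E -> C2) :
  cdiff2 f x l -> cdiff (fun y => fst (f y)) x (fun v => fst (l v)).
Proof.
  intros H. apply (filterdiff_comp' (V := C2) (W := C_NormedModule) f (fun y => fst y) x l (fun y => fst y) H).
  apply filterdiff_linear. apply is_linear_fst.
Qed.

Lemma cdiff2_snd {E : NormedModule C_AbsRing} (f : E -> C2) (x : E) (l : E -> C2) :
  cdiff2 f x l -> cdiff (fun y => snd (f y)) x (fun v => snd (l v)).
Proof.
  intros H. apply (filterdiff_comp' (V := C2) (W := C_NormedModule) f (fun y => snd y) x l (fun y => snd y) H).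
  apply filterdiff_linear. apply is_linear_snd.
Qed.

Lemma cdiff2_unique {E : NormedModule C_AbsRing} (f : E -> C2) (x : E) (l1 l2 : E -> C2) :
  cdiff2 f x l1 -> cdiff2 f x l2 -> forall v, l1 v = l2 v.
Proof.
  intros H1 H2 v. apply injective_projections.
  - exact (cdiff_unique _ x _ _ (cdiff2_fst f x l1 H1) (cdiff2_fst f x l2 H2) v).
  - exact (cdiff_unique _ x _ _ (cdiff2_snd f x l1 H1) (cdiff2_snd f x l2 H2) v).
Qed.

Section Retraction.

Context (rho : C2 -> C2) (Hrho : retraction G rho).

Let Hhol : holomorphic_on G rho := proj1 Hrho.
Let Hid : forall x : C2, G x -> rho (rho x) = rho x := proj2 (proj2 Hrho).

Lemma G_ball_ex_filterdiff {F : NormedModule C_AbsRing} (f : C2 -> F) (x : C2) :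
  holomorphic_on G f -> G x ->
  exists R, 0 < R /\ forall y : C2, norm (minus y x) < R -> ex_filterdiff f (locally y).
Proof.
  intros Hf Hx. destruct (G_open x Hx) as (d & Hd & H). exists d; split; auto.
Qed.

Lemma retraction_strict_diff (x : C2) (L : C2 -> C2) : G x -> cdiff2 rho x L ->
  forall eps, 0 < eps -> exists d, 0 < d /\ forall y y' : C2,
    norm (minus y x) < d -> norm (minus y' x) < d ->
    norm (minus (minus (rho y') (rho y)) (L (minus y' y))) <= eps * norm (minus y' y).
Proof.
  intros Hx HL eps He. destruct (G_ball_ex_filterdiff rho x Hhol Hx) as (R & HR & HRd).
  destruct (holomorphic_strict_diff (fun y => fst (rho y)) x R (fun v => fst (L v)) HR) with (eps := eps / 2)
    as (d1 & Hd1 & H1); try lra.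
  { intros y Hy. destruct (HRd y Hy) as [l Hl]. eexists. apply (cdiff2_fst rho y l Hl). }
  { apply cdiff2_fst, HL. }
  destruct (holomorphic_strict_diff (fun y => snd (rho y)) x R (fun v => snd (L v)) HR) with (eps := eps / 2)
    as (d2 & Hd2 & H2); try lra.
  { intros y Hy. destruct (HRd y Hy) as [l Hl]. eexists. apply (cdiff2_snd rho y l Hl). }
  { apply cdiff2_snd, HL. }
  exists (Rmin d1 d2). split; [apply Rmin_glb_lt; auto|]. intros y y' Hy Hy'.
  assert (m1 := Rmin_l d1 d2). assert (m2 := Rmin_r d1 d2).
  specialize (H1 y y' ltac:(lra) ltac:(lra)). specialize (H2 y y' ltac:(lra) ltac:(lra)).
  eapply Rle_trans; [apply C2_norm_le|].
  change (Cmod (fst (rho y') - fst (rho y) - fst (L (minus y' y)))%C +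
    Cmod (snd (rho y') - snd (rho y) - snd (L (minus y' y)))%C <= eps * norm (minus y' y)). lra.
Qed.

Lemma retraction_differential_idempotent (x : C2) (L : C2 -> C2) :
  G x -> rho x = x -> cdiff2 rho x L -> forall v, L (L v) = L v.
Proof.
  intros Hx Hfix HL v.
  assert (H2 : cdiff2 (fun y => rho (rho y)) x (fun v => L (L v))).
  { apply (filterdiff_comp' (U := C2) (V := C2) (W := C2) rho rho x L L HL). rewrite Hfix. exact HL. }
  apply (cdiff2_unique rho x (fun v => L (L v)) L); auto.
  apply (filterdiff_ext_locally (fun y => rho (rho y))); auto.
  apply locally_norm_iff. destruct (G_open x Hx) as (d & Hd & H). exists d; split; auto.
Qed.

(** Strict differentiability is applied to the pair [y], [rho y]. Both have the same image, while
    [L = id] predicts the increment [e = rho y - y]; so [|e| <= |e| / 2]. *)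
Lemma retraction_fixes_nbhd (x : C2) (L : C2 -> C2) :
  G x -> rho x = x -> cdiff2 rho x L -> (forall v, L v = v) -> locally x (fun y => rho y = y).
Proof.
  intros Hx Hfix HL HLid. apply locally_norm_iff.
  destruct (retraction_strict_diff x L Hx HL (/ 2) ltac:(lra)) as (d & Hd & H).
  destruct (ex_filterdiff_continuous_norm rho x (ex_intro _ L HL) d Hd) as (d1 & Hd1 & H1).
  destruct (G_open x Hx) as (d2 & Hd2 & H2).
  exists (Rmin d (Rmin d1 d2)). split; [repeat apply Rmin_glb_lt; auto|]. intros y Hy.
  assert (m1 := Rmin_l d (Rmin d1 d2)). assert (m2 := Rmin_r d (Rmin d1 d2)).
  assert (m3 := Rmin_l d1 d2). assert (m4 := Rmin_r d1 d2).
  assert (Hyd : norm (minus (rho y) x) < d).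
  { rewrite <- Hfix at 1. apply H1. lra. }
  specialize (H y (rho y) ltac:(lra) Hyd). rewrite HLid, Hid in H by (apply H2; lra).
  set (e := minus (rho y) y) in *.
  assert (Ez : norm (minus (minus (rho y) (rho y)) e) = norm e).
  { rewrite <- (norm_opp e). f_equal. rewrite (minus_eq_zero (rho y)). exact (plus_zero_l (opp e)). }
  rewrite Ez in H. assert (He := norm_ge_0 e).
  apply norm_minus_zero_eq. fold e. lra.
Qed.

(** Near [x] the map [rho] contracts distances by 1/2, which leaves no room for a second fixed
    point. *)
Lemma retraction_isolated_fixpoint (x : C2) (L : C2 -> C2) :
  G x -> rho x = x -> cdiff2 rho x L -> (forall v, L v = zero) ->
  exists d, 0 < d /\ forall y : C2, norm (minus y x) < d -> rho y = y -> y = x.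
Proof.
  intros Hx Hfix HL HL0.
  destruct (retraction_strict_diff x L Hx HL (/ 2) ltac:(lra)) as (d & Hd & H).
  exists d; split; auto. intros y Hy Hy'.
  specialize (H x y). rewrite (minus_self_norm x) in H. specialize (H Hd Hy).
  rewrite Hy', Hfix, HL0 in H. set (e := minus y x).
  assert (Ez : norm e = norm (minus e (zero : C2))) by (f_equal; symmetry; exact (minus_zero_r e)).
  assert (H' : norm e <= / 2 * norm e) by (rewrite Ez at 1; exact H).
  assert (He := norm_ge_0 e).
  apply norm_minus_zero_eq. fold e. lra.
Qed.

Lemma retraction_identity_propagates (x : C2) :
  G x -> locally x (fun y => rho y = y) -> forall y, G y -> rho y = y.
Proof.
  intros Hx Hloc y Hy. apply (locally_singleton (T := C2) y (fun y => rho y = y)).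
  apply (G_connected (fun x : C2 => locally x (fun y : C2 => rho y = y)) x y); auto.
  apply locally_constant_locally. clear x y Hx Hloc Hy. intros x Hx Hnear.
  destruct (Hhol x Hx) as [L HL]. destruct (G_ball_ex_filterdiff rho x Hhol Hx) as (R & HR & HRd).
  destruct (agree_linear_limit (fun y : C2 => fst (rho y)) x R (fun v => fst (L v)) (fun y => fst y))
    as [A1 A2]; auto.
  { intros y Hy. destruct (HRd y Hy) as [l Hl]. eexists. apply (cdiff2_fst rho y l Hl). }
  { apply cdiff2_fst, HL. }
  { apply is_linear_fst. }
  { intros d Hd. destruct (Hnear d Hd) as (y & H1 & H2). exists y; split; auto.
    revert H2. apply filter_imp. intros z Hz. rewrite Hz. reflexivity. }
  destruct (agree_linear_limit (fun y : C2 => snd (rho y)) x R (fun v => snd (L v)) (fun y => snd y))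
    as [B1 B2]; auto.
  { intros y Hy. destruct (HRd y Hy) as [l Hl]. eexists. apply (cdiff2_snd rho y l Hl). }
  { apply cdiff2_snd, HL. }
  { apply is_linear_snd. }
  { intros d Hd. destruct (Hnear d Hd) as (y & H1 & H2). exists y; split; auto.
    revert H2. apply filter_imp. intros z Hz. rewrite Hz. reflexivity. }
  apply (retraction_fixes_nbhd x L); auto.
  - apply injective_projections; auto.
  - intros v. apply injective_projections; auto.
Qed.

(** Every value [rho y'] is a fixed point of [rho], so it equals [x] as soon as it is close to [x]:
    the fibre over [x] is open, and closed by continuity. *)
Lemma retraction_point_propagates (x : C2) (L : C2 -> C2) :
  G x -> rho x = x -> cdiff2 rho x L -> (forall v, L v = zero) -> forall y, G y -> rho y = x.
Proof.
  intros Hx Hfix HL HL0 y Hy.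
  destruct (retraction_isolated_fixpoint x L Hx Hfix HL HL0) as (d & Hd & H).
  apply (G_connected (fun y => rho y = x) x y); auto. clear y Hy. intros y Hy.
  destruct (classic (rho y = x)) as [E|E].
  - destruct (ex_filterdiff_continuous_norm rho y (Hhol y Hy) d Hd) as (d1 & Hd1 & H1).
    exists d1; split; auto. intros y' Hy' Hyy. split; auto. intros _. apply H; auto.
    rewrite <- E. apply H1; auto.
  - assert (Hn : 0 < norm (minus x (rho y))).
    { destruct (norm_ge_0 (minus x (rho y))) as [N|N]; auto.
      symmetry in N. apply norm_minus_zero_eq in N. symmetry in N. contradiction. }
    destruct (ex_filterdiff_continuous_norm rho y (Hhol y Hy) _ Hn) as (d1 & Hd1 & H1).
    exists d1; split; auto. intros y' Hy' Hyy. split; [|tauto]. intros E'.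
    specialize (H1 y' Hyy). rewrite E' in H1. lra.
Qed.

End Retraction.

(** * Retracts that contain a geodesic disc *)

Lemma C_cramer (v1 v2 r1 r2 w1 w2 : C) : (v1 * r2 - v2 * r1)%C <> RtoC 0 ->
  let D := (v1 * r2 - v2 * r1)%C in
  (w1 = (w1 * r2 - w2 * r1) / D * v1 + (v1 * w2 - v2 * w1) / D * r1)%C /\
  (w2 = (w1 * r2 - w2 * r1) / D * v2 + (v1 * w2 - v2 * w1) / D * r2)%C.
Proof. intros H D. unfold D. split; field; exact H. Qed.

Lemma C2_linear_combination (L : C2 -> C2) (v r : C2) :
  is_linear L -> L v = v -> L r = r ->
  (fst v * snd r - snd v * fst r)%C <> RtoC 0 -> forall w, L w = w.
Proof.
  intros HL Hv Hr Hdet w. set (D := (fst v * snd r - snd v * fst r)%C) in *.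
  set (a := ((fst w * snd r - snd w * fst r) / D)%C).
  set (b := ((fst v * snd w - snd v * fst w) / D)%C).
  assert (E : w = plus (scal a v) (scal b r)).
  { apply injective_projections.
    - exact (proj1 (C_cramer (fst v) (snd v) (fst r) (snd r) (fst w) (snd w) Hdet)).
    - exact (proj2 (C_cramer (fst v) (snd v) (fst r) (snd r) (fst w) (snd w) Hdet)). }
  rewrite E at 1. rewrite (linear_plus L HL), !(linear_scal L HL), Hv, Hr. symmetry; exact E.
Qed.

(** A zero determinant gives the relations [v_i r - r_i v = 0]; applying [l], which kills [r] and
    sends [v] to 1, gives [r_i = 0]. *)
Lemma linear_functional_separates (l : C2 -> C) (v r : C2) :
  is_linear (V := C_NormedModule) l -> l v = RtoC 1 -> l r = RtoC 0 ->
  (fst v * snd r - snd v * fst r)%C = RtoC 0 -> r = zero.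
Proof.
  intros Hl Hv Hr HD.
  assert (A : forall a b : C, l (plus (scal a r) (scal b v)) = b).
  { intros a b. rewrite (linear_plus l Hl), !(linear_scal l Hl), Hv, Hr.
    change (@eq C (a * 0 + b * 1)%C b). ring. }
  assert (Z : forall a b : C, plus (scal a r) (scal b v) = (zero : C2) -> b = RtoC 0).
  { intros a b E. rewrite <- (A a b), E. apply (linear_zero l Hl). }
  assert (C1 : forall v1 v2 r1 r2 : C, (v1 * r2 - v2 * r1)%C = RtoC 0 ->
    (v1 * r2 + - r1 * v2)%C = RtoC 0 /\ (v2 * r1 + - r2 * v1)%C = RtoC 0 /\
    (v1 * r1 + - r1 * v1)%C = RtoC 0 /\ (v2 * r2 + - r2 * v2)%C = RtoC 0).
  { intros v1 v2 r1 r2 H. repeat split; try ring; (transitivity (v1 * r2 - v2 * r1)%C; [ring|exact H]) ||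
      (transitivity (- (v1 * r2 - v2 * r1))%C; [ring|rewrite H; ring]). }
  destruct (C1 (fst v) (snd v) (fst r) (snd r) HD) as (E1 & E2 & E3 & E4).
  assert (opp0 : forall x : C, (- x)%C = RtoC 0 -> x = RtoC 0).
  { intros x Hx. replace x with (- - x)%C by ring. rewrite Hx. ring. }
  apply injective_projections; apply opp0.
  - apply (Z (fst v) (Copp (fst r))). apply injective_projections; [exact E3|exact E1].
  - apply (Z (snd v) (Copp (snd r))). apply injective_projections; [exact E2|exact E4].
Qed.

Section Disc.

Context (rho : C2 -> C2) (Hrho : retraction G rho).
Context (h : C_NormedModule -> C2) (c : C2 -> C_NormedModule).
Context (Hh : holomorphic_on unit_disc h) (HhG : maps_into unit_disc G h).
Context (Hc : holomorphic_on G c) (HcD : maps_into G unit_disc c).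
Context (Hch : forall z, unit_disc z -> c (h z) = z).
Context (Hrh : forall z, unit_disc z -> rho (h z) = h z).
Context (Hne : exists y, G y /\ rho y <> y).

(** For fixed points [p], [q] with [c p = c q], the difference [e = q - p] is nearly [L e]. That is
    the multiple of [v] by [lc (L e)], which is nearly [lc e], hence nearly 0. All errors are small
    multiples of [|e|], so [e = 0]. *)
Lemma retract_disc_local_injectivity (z : C_NormedModule) : unit_disc z ->
  exists d, 0 < d /\ forall p q : C2, norm (minus p (h z)) < d -> norm (minus q (h z)) < d ->
    rho p = p -> rho q = q -> c p = c q -> p = q.
Proof.
  intros Hz. set (b := h z). assert (Hb : G b) by (apply HhG, Hz).
  destruct (proj1 Hrho b Hb) as [L HL]. destruct (Hc b Hb) as [lc Hlc]. destruct (Hh z Hz) as [lh Hlh].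
  assert (HLl := proj1 HL). assert (Hcl := proj1 Hlc).
  assert (Hzd : locally z unit_disc).
  { apply locally_norm_iff. change (Cmod z < 1) in Hz. exists (1 - Cmod z). split; [lra|].
    intros y Hy. change (Cmod (y - z)%C < 1 - Cmod z) in Hy. change (Cmod y < 1).
    replace (y : C) with ((y - z) + z)%C by ring. eapply Rle_lt_trans; [apply Cmod_triangle|]. lra. }
  set (v := lh (RtoC 1)).
  assert (Hv : lc v = RtoC 1).
  { assert (H1 : cdiff (fun y => c (h y)) z (fun k => lc (lh k))).
    { apply (filterdiff_comp' (V := C2) (W := C_NormedModule) h c z lh lc Hlh Hlc). }
    apply (cdiff_unique (fun y => c (h y)) z (fun k => lc (lh k)) (fun k => k)); auto.
    apply (filterdiff_ext_locally (fun y => y)); [|apply filterdiff_id].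
    revert Hzd. apply filter_imp. intros y Hy. symmetry; auto. }
  assert (HLv : L v = v).
  { assert (H1 : cdiff2 (fun y => rho (h y)) z (fun k => L (lh k))).
    { apply (filterdiff_comp' (V := C2) (W := C2) h rho z lh L Hlh HL). }
    apply (cdiff2_unique (fun y => rho (h y)) z (fun k => L (lh k)) lh H1).
    apply (filterdiff_ext_locally h); auto.
    revert Hzd. apply filter_imp. intros y Hy. symmetry; auto. }
  assert (Hfix : rho b = b) by (apply Hrh, Hz).
  assert (HLL := retraction_differential_idempotent rho Hrho b L Hb Hfix HL).
  (* The part [r] of [L w] killed by [lc] is still fixed by [L]. Were it independent of [v], [L]
     would be the identity and so would [rho] on G, against [Hne]. *)
  assert (Hrange : forall w, L w = scal (lc (L w) : C) v).
  { intros w. set (u := L w). set (r := minus u (scal (lc u : C) v)).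
    assert (Hr : L r = r).
    { unfold r. rewrite (linear_minus L _ _ HLl), (linear_scal L HLl), HLv. unfold u. rewrite HLL. reflexivity. }
    assert (Hlr : lc r = RtoC 0).
    { unfold r. rewrite (linear_minus lc _ _ Hcl), (linear_scal lc Hcl), Hv.
      change (@eq C (lc u - lc u * 1)%C (RtoC 0)). ring. }
    destruct (Ceq_dec (fst v * snd r - snd v * fst r)%C (RtoC 0)) as [E|E].
    - assert (Er := linear_functional_separates lc v r Hcl Hv Hlr E).
      transitivity (plus (scal (lc u : C) v) r); [symmetry; exact (plus_minus_cancel (scal (lc u : C) v) u)|].
      rewrite Er. exact (plus_zero_r (scal (lc u : C) v)).
    - exfalso. destruct Hne as (y & Hy & Hy'). apply Hy'.
      apply (retraction_identity_propagates rho Hrho b Hb); auto.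
      apply (retraction_fixes_nbhd rho Hrho b L); auto.
      apply (C2_linear_combination L v r); auto. }
  destruct (linear_norm lc Hcl) as (M & HM & HlM).
  assert (Hv0 := norm_ge_0 v).
  (* Chosen so that the accumulated factor [eps * (1 + (1 + M) * norm v)] is 1/2. *)
  set (eps := / (2 * (1 + (1 + M) * norm v))).
  assert (HK : 0 < 1 + (1 + M) * norm v) by nra.
  assert (He : 0 < eps) by (apply Rinv_0_lt_compat; lra).
  destruct (retraction_strict_diff rho Hrho b L Hb HL eps He) as (d1 & Hd1 & H1).
  destruct (G_ball_ex_filterdiff (F := C_NormedModule) c b Hc Hb) as (R & HR & HRd).
  destruct (holomorphic_strict_diff c b R lc HR HRd Hlc eps He) as (d2 & Hd2 & H2).
  exists (Rmin d1 d2). split; [apply Rmin_glb_lt; auto|]. intros p q Hp Hq Hfp Hfq Hcpq.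
  assert (m1 := Rmin_l d1 d2). assert (m2 := Rmin_r d1 d2).
  specialize (H1 p q ltac:(lra) ltac:(lra)). specialize (H2 p q ltac:(lra) ltac:(lra)).
  rewrite Hfp, Hfq in H1. rewrite Hcpq in H2. set (e := minus q p) in *.
  replace (c q - c q - lc e)%C with (Copp (lc e)) in H2 by ring. rewrite Cmod_opp in H2.
  assert (H3 : Cmod (lc (L e)) <= (1 + M) * eps * norm e).
  { assert (A := HlM (minus e (L e))). rewrite (linear_minus lc _ _ Hcl) in A.
    change (Cmod (lc e - lc (L e))%C <= M * norm (minus e (L e))) in A.
    replace (lc (L e)) with (lc e + Copp (lc e - lc (L e)))%C by ring.
    eapply Rle_trans; [apply Cmod_triangle|]. rewrite Cmod_opp.
    assert (M * norm (minus e (L e)) <= M * (eps * norm e)) by (apply Rmult_le_compat_l; [lra|exact H1]).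
    lra. }
  assert (H4 : norm (L e) <= (1 + M) * eps * norm e * norm v).
  { rewrite Hrange. eapply Rle_trans; [apply (norm_scal (K := C_AbsRing))|].
    apply Rmult_le_compat_r; auto. }
  assert (H5 : norm e <= norm (minus e (L e)) + norm (L e)).
  { rewrite <- (plus_minus_cancel (L e) e) at 1. eapply Rle_trans; [apply @norm_triangle|].
    rewrite Rplus_comm. apply Rle_refl. }
  assert (H6 : norm e <= eps * (1 + (1 + M) * norm v) * norm e).
  { eapply Rle_trans; [exact H5|].
    replace (eps * (1 + (1 + M) * norm v) * norm e) with (eps * norm e + (1 + M) * eps * norm e * norm v) by ring.
    apply Rplus_le_compat; auto. }
  assert (H7 : eps * (1 + (1 + M) * norm v) = / 2) by (unfold eps; field; lra).
  rewrite H7 in H6. assert (H8 := norm_ge_0 e).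
  symmetry. apply norm_minus_zero_eq. fold e. lra.
Qed.

(** Near a point sent into the disc, [p = rho y'] and [h (c p)] are two fixed points of [rho] with
    equal [c], so local injectivity identifies them and puts [p] on the disc. *)
Lemma retract_contained_in_disc (y : C2) : G y -> exists z, unit_disc z /\ h z = rho y.
Proof.
  intros Hy. assert (H0 : unit_disc (RtoC 0)) by (change (Cmod 0 < 1); rewrite Cmod_0; lra).
  apply (G_connected (fun y => exists z, unit_disc z /\ h z = rho y) (h (RtoC 0)) y); auto.
  2: { exists (RtoC 0). split; auto. symmetry; auto. }
  clear y Hy. intros y Hy. set (x := rho y). assert (Hx : G x) by (apply (proj1 (proj2 Hrho)), Hy).
  assert (Hid := proj2 (proj2 Hrho)).
  assert (Hhc : ex_filterdiff (fun p => h (c p)) (locally x)).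
  { destruct (Hc x Hx) as [l1 Hl1]. destruct (Hh (c x) (HcD x Hx)) as [l2 Hl2]. eexists.
    exact (filterdiff_comp' (V := C_NormedModule) (W := C2) c h x l1 l2 Hl1 Hl2). }
  destruct (classic (exists z, unit_disc z /\ h z = x)) as [(z & Hz & E)|N].
  - destruct (retract_disc_local_injectivity z Hz) as (d & Hd & Hinj).
    destruct (ex_filterdiff_continuous_norm _ x Hhc d Hd) as (d1 & Hd1 & H1).
    assert (Hm : 0 < Rmin d d1) by (apply Rmin_glb_lt; auto).
    destruct (ex_filterdiff_continuous_norm rho y (proj1 Hrho y Hy) _ Hm) as (d2 & Hd2 & H2).
    exists d2; split; auto. intros y' Hy' Hyy. split; [intros _; exists z; auto|]. intros _.
    specialize (H2 y' Hyy). fold x in H2. set (p := rho y') in *.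
    assert (Hp : G p) by (apply (proj1 (proj2 Hrho)), Hy').
    assert (m1 := Rmin_l d d1). assert (m2 := Rmin_r d d1).
    exists (c p). split; [apply HcD, Hp|]. apply Hinj.
    + specialize (H1 p ltac:(lra)). cbv beta in H1. rewrite <- E, (Hch z Hz) in H1. exact H1.
    + rewrite E. lra.
    + apply Hrh, HcD, Hp.
    + apply Hid, Hy'.
    + apply Hch, HcD, Hp.
  (* The points of the disc satisfy [h (c p) = p], and [x] does not; by continuity neither do the
     points near [x]. *)
  - assert (Hn : 0 < norm (minus (h (c x)) x)).
    { destruct (norm_ge_0 (minus (h (c x)) x)) as [K|K]; auto.
      exfalso. apply N. exists (c x). split; [apply HcD, Hx|]. symmetry in K.
      apply norm_minus_zero_eq, K. }
    set (n := norm (minus (h (c x)) x)) in *.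
    destruct (ex_filterdiff_continuous_norm _ x Hhc (n / 2) ltac:(lra)) as (d1 & Hd1 & H1).
    assert (Hm : 0 < Rmin (n / 2) d1) by (apply Rmin_glb_lt; lra).
    destruct (ex_filterdiff_continuous_norm rho y (proj1 Hrho y Hy) _ Hm) as (d2 & Hd2 & H2).
    exists d2; split; auto. intros y' Hy' Hyy. split; [|intros A; contradiction].
    intros (z & Hz & E). exfalso. specialize (H2 y' Hyy). fold x in H2. set (p := rho y') in *.
    assert (m1 := Rmin_l (n / 2) d1). assert (m2 := Rmin_r (n / 2) d1).
    specialize (H1 p ltac:(lra)). cbv beta in H1.
    assert (Ep : h (c p) = p) by (rewrite <- E, (Hch z Hz); reflexivity).
    rewrite Ep in H1. assert (T := norm_minus_triangle x (h (c x)) p). fold n in T.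
    assert (S1 : norm (minus x p) = norm (minus p x)) by (rewrite <- (opp_minus x p); symmetry; apply @norm_opp).
    assert (S2 : norm (minus (h (c x)) p) = norm (minus p (h (c x))))
      by (rewrite <- (opp_minus (h (c x)) p); symmetry; apply @norm_opp).
    lra.
Qed.

End Disc.

(** * Half-plane coordinates on the symmetrized bidisc *)

(* For (s, p) = (z + w, z w), [chart_m] and [chart_t] are the half sum and the squared half difference
   of the Cayley transforms of o z and o w; [chart_dm] and [chart_dt] are their differentials at (s, p)
   along (v1, v2). *)
Definition chart_den (o s p : C) : C := (1 - o * s + o * o * p)%C.
Definition chart_m (o s p : C) : C := ((1 - o * o * p) / chart_den o s p)%C.
Definition chart_t (o s p : C) : C :=
  ((o * s * (o * s) - 4 * (o * o * p)) / (chart_den o s p * chart_den o s p))%C.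
Definition chart_dm (o s p v1 v2 : C) : C :=
  ((o * v1 - 2 * (o * o * v2) + o * o * o * (s * v2 - p * v1))
    / (chart_den o s p * chart_den o s p))%C.
Definition chart_dt (o s p v1 v2 : C) : C :=
  ((2 * (o * s) * (o * v1) - 4 * (o * o * v2)) / (chart_den o s p * chart_den o s p)
   - 2 * (o * s * (o * s) - 4 * (o * o * p)) * (o * o * v2 - o * v1)
     / (chart_den o s p * chart_den o s p * chart_den o s p))%C.

Lemma chart_image (o s p : C) : Cmod o = 1 -> G (s, p) ->
  chart_den o s p <> RtoC 0 /\
  exists d, (d * d)%C = chart_t o s p /\ Rabs (Re d) < Re (chart_m o s p).
Proof.
  intros Ho (z & w & Hz & Hw & E). injection E as -> ->.
  assert (Hoz : Cmod (o * z)%C < 1) by (rewrite Cmod_mult, Ho; lra).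
  assert (How : Cmod (o * w)%C < 1) by (rewrite Cmod_mult, Ho; lra).
  destruct (cayley_re_pos _ Hoz) as [Nz Rz]. destruct (cayley_re_pos _ How) as [Nw Rw].
  assert (ED : chart_den o (z + w) (z * w) = ((1 - o * z) * (1 - o * w))%C) by (unfold chart_den; ring).
  split; [rewrite ED; apply Cmult_neq_0; auto|].
  set (a := ((1 + o * z) / (1 - o * z))%C) in *. set (b := ((1 + o * w) / (1 - o * w))%C) in *.
  exists ((a - b) / 2)%C. split.
  - unfold chart_t. rewrite ED. unfold a, b. field. auto.
  - replace (chart_m o (z + w) (z * w)) with ((a + b) / 2)%C.
    2: { unfold chart_m. rewrite ED. unfold a, b. field. auto. }
    assert (E1 : forall x : C, Re (x / 2)%C = Re x / 2).
    { intros [x1 x2]. unfold Re, Cdiv, Cmult, Cinv, RtoC; simpl. field. }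
    rewrite !E1. unfold Cminus. rewrite !re_plus. replace (Re (- b)%C) with (- Re b) by reflexivity.
    apply Rabs_def1; lra.
Qed.

Lemma chart_inverse_den (m d : C) : Rabs (Re d) < Re m ->
  (m * m - d * d + 2 * m + 1)%C <> RtoC 0.
Proof.
  intros H. replace (m * m - d * d + 2 * m + 1)%C with ((m + d + 1) * (m - d + 1))%C by ring.
  apply Rabs_def2 in H.
  apply Cmult_neq_0; apply inverse_cayley_disc; unfold Cminus; rewrite re_plus;
    try replace (Re (- d)%C) with (- Re d) by reflexivity; lra.
Qed.

Lemma chart_inverse_G (o m d : C) : Cmod o = 1 -> Rabs (Re d) < Re m ->
  G ((2 * (m * m - d * d - 1) / ((m * m - d * d + 2 * m + 1) * o))%C,
     ((m * m - d * d - 2 * m + 1) / ((m * m - d * d + 2 * m + 1) * (o * o)))%C).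
Proof.
  intros Ho H. assert (Hden := chart_inverse_den m d H). apply Rabs_def2 in H.
  assert (Ho0 : o <> RtoC 0) by (apply Cmod_gt_0; lra).
  destruct (inverse_cayley_disc (m + d)%C) as [N1 D1]; [rewrite re_plus; lra|].
  destruct (inverse_cayley_disc (m - d)%C) as [N2 D2].
  { unfold Cminus; rewrite re_plus. replace (Re (- d)%C) with (- Re d) by reflexivity. lra. }
  exists ((m + d - 1) / (m + d + 1) / o)%C, ((m - d - 1) / (m - d + 1) / o)%C.
  split; [|split].
  - rewrite Cmod_div, Ho by auto. lra.
  - rewrite Cmod_div, Ho by auto. lra.
  - replace (m * m - d * d + 2 * m + 1)%C with ((m + d + 1) * (m - d + 1))%C by ring.
    match goal with |- (?a, ?b) = (?c, ?d) =>
      assert (E1 : @eq C a c) by (field; auto); assert (E2 : @eq C b d) by (field; auto) end.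
    rewrite E1, E2. reflexivity.
Qed.

(* [j] purely imaginary: passing from the boundary point [o] to this one is [z -> -j + (1 - j^2) / (z - j)]
   in the half-plane coordinate. *)
Definition boundary_shift (o j : C) : C := (- o * (1 + j) / (1 - j))%C.

(** The half sum of [1 / (m - j + d)] and [1 / (m - j - d)], with [d * d = t], is
    [(m - j) / ((m - j)^2 - t)]. *)
Lemma chart_m_shift (o s p j : C) : chart_den o s p <> RtoC 0 -> (1 - j)%C <> RtoC 0 ->
  let m := chart_m o s p in let t := chart_t o s p in
  ((m - j) * (m - j) - t)%C <> RtoC 0 ->
  chart_m (boundary_shift o j) s p = (- j + (1 - j * j) * ((m - j) / ((m - j) * (m - j) - t)))%C.
Proof.
  intros H1 H2 m t H4.
  assert (E3 : chart_den (boundary_shift o j) s p =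
     (((m - j) * (m - j) - t) * chart_den o s p / ((1 - j) * (1 - j)))%C).
  { unfold m, t, chart_m, chart_t, boundary_shift. unfold chart_den in *. field. auto. }
  unfold chart_m at 1. rewrite E3.
  transitivity ((1 - boundary_shift o j * boundary_shift o j * p) * ((1 - j) * (1 - j))
     / chart_den o s p / ((m - j) * (m - j) - t))%C; [field; auto|].
  transitivity ((- j * ((m - j) * (m - j) - t) + (1 - j * j) * (m - j)) / ((m - j) * (m - j) - t))%C;
    [|field; auto].
  f_equal. unfold m, t, chart_m, chart_t, boundary_shift. unfold chart_den in *. field. auto.
Qed.

(** The right-hand side is the derivative along [(v1, v2)] of the formula for the shifted m. *)
Lemma chart_dm_shift (o s p v1 v2 j : C) : chart_den o s p <> RtoC 0 -> (1 - j)%C <> RtoC 0 ->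
  let m := chart_m o s p in let t := chart_t o s p in
  let dm := chart_dm o s p v1 v2 in let dt := chart_dt o s p v1 v2 in
  ((m - j) * (m - j) - t)%C <> RtoC 0 ->
  chart_dm (boundary_shift o j) s p v1 v2 =
  ((1 - j * j) * (((m - j) * dt - (m - j) * (m - j) * dm - t * dm)
      / (((m - j) * (m - j) - t) * ((m - j) * (m - j) - t))))%C.
Proof.
  intros H1 H2 m t dm dt H4.
  assert (E3 : chart_den (boundary_shift o j) s p =
     (((m - j) * (m - j) - t) * chart_den o s p / ((1 - j) * (1 - j)))%C).
  { unfold m, t, chart_m, chart_t, boundary_shift. unfold chart_den in *. field. auto. }
  unfold chart_dm at 1. rewrite E3.
  set (W := ((m - j) * (m - j) - t)%C) in *.
  set (N := (boundary_shift o j * v1 - 2 * (boundary_shift o j * boundary_shift o j * v2) +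
    boundary_shift o j * boundary_shift o j * boundary_shift o j * (s * v2 - p * v1))%C).
  set (N' := ((m - j) * dt - (m - j) * (m - j) * dm - t * dm)%C).
  assert (EN : (N * ((1 - j) * (1 - j) * ((1 - j) * (1 - j))) / (chart_den o s p * chart_den o s p)
     = (1 - j * j) * N')%C).
  { unfold N, N', m, t, dm, dt, chart_m, chart_t, chart_dm, chart_dt, boundary_shift.
    unfold chart_den in *. field. auto. }
  transitivity ((N * ((1 - j) * (1 - j) * ((1 - j) * (1 - j))) / (chart_den o s p * chart_den o s p)) / (W * W))%C;
    [field; auto|].
  rewrite EN. field. auto.
Qed.

(** * Extremal discs *)

Lemma nonneg_cubic_lead (a b c d : R) :
  (forall y, 0 <= a * y ^ 3 + b * y ^ 2 + c * y + d) -> a <= 0.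
Proof.
  intros H. apply Rnot_lt_le. intros Ha.
  (* Large enough that at [- K] the cubic term outweighs the other three together. *)
  set (K := (Rabs b + Rabs c + Rabs d) / a + 1).
  assert (HK : a * K = Rabs b + Rabs c + Rabs d + a) by (unfold K; field; lra).
  assert (Hb := Rabs_pos b). assert (Hc := Rabs_pos c). assert (Hd := Rabs_pos d).
  assert (H1 : 1 <= K).
  { unfold K. assert (0 <= (Rabs b + Rabs c + Rabs d) / a) by (apply Rle_mult_inv_pos; lra). lra. }
  specialize (H (- K)).
  assert (B1 : b <= Rabs b) by apply Rle_abs.
  assert (B2 : - c <= Rabs c) by (rewrite <- Rabs_Ropp; apply Rle_abs).
  assert (B3 : d <= Rabs d) by apply Rle_abs.
  assert (K2 : 1 <= K ^ 2) by (simpl; nra).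
  assert (K3 : K <= K ^ 2) by (simpl; nra).
  assert (b * K ^ 2 <= Rabs b * K ^ 2) by (apply Rmult_le_compat_r; lra).
  assert (- c * K <= Rabs c * K ^ 2).
  { apply Rle_trans with (Rabs c * K); [apply Rmult_le_compat_r; lra|apply Rmult_le_compat_l; lra]. }
  assert (d <= Rabs d * K ^ 2) by nra.
  assert (a * K ^ 3 = (Rabs b + Rabs c + Rabs d + a) * K ^ 2) by (rewrite <- HK; ring).
  assert (0 < a * K ^ 2) by nra. simpl in *. nra.
Qed.

Lemma nonneg_quadratic (a b c : R) :
  (forall y, 0 <= a * y ^ 2 + b * y + c) -> 0 <= a /\ 0 <= c /\ b * b <= 4 * a * c.
Proof.
  intros H. assert (Hc : 0 <= c) by (specialize (H 0); simpl in H; lra).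
  assert (Ha : 0 <= a).
  { apply Rnot_lt_le. intros Ha. set (K := (Rabs b + c) / - a + 1).
    assert (HK : a * K = - (Rabs b + c) + a) by (unfold K; field; lra).
    assert (Hb := Rabs_pos b). assert (B1 : b <= Rabs b) by apply Rle_abs.
    assert (H1 : 1 <= K).
    { unfold K. assert (0 <= (Rabs b + c) / - a) by (apply Rle_mult_inv_pos; lra). lra. }
    specialize (H K). simpl in H. nra. }
  split; [|split]; auto. destruct Ha as [Ha|Ha].
  - specialize (H (- b / (2 * a))).
    replace (a * (- b / (2 * a)) ^ 2 + b * (- b / (2 * a)) + c) with ((4 * a * c - b * b) / (4 * a)) in H
      by (field; lra).
    apply (Rmult_le_compat_r (4 * a)) in H; [|lra].
    replace ((4 * a * c - b * b) / (4 * a) * (4 * a)) with (4 * a * c - b * b) in H by (field; lra). lra.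
  - subst a. destruct (Req_dec b 0) as [->|Hb]; [lra|].
    specialize (H (- (c + 1) / b)). simpl in H.
    replace (b * (- (c + 1) / b)) with (- (c + 1)) in H by (field; auto). lra.
Qed.

(** Exactly what keeps the graph of [A n^2 + i b n - c] in the domain: [A y^2 + b y + c] is
    nonnegative on the line, and strictness comes from [A < 1] in the first case and from
    [b^2 < 4 c] in the second. *)
Definition admissible_coefficients (A b c : R) :=
  (0 <= A < 1 /\ 0 <= c /\ b * b <= 4 * A * c) \/ (A = 1 /\ b * b < 4 * c).

(* After squaring, the hypothesis is a cubic inequality in y.  Its leading coefficient forces
   Im T = Im T', and what remains is 0 <= (1 - A) (A y^2 + b y + c). *)
Lemma extremal_coefficients (T T' d : C) :
  (d * d)%C = T -> Rabs (Re d) < 1 ->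
  (forall y : R, let M := (1, - y)%R : C in
     Cmod (M * M - T' * M + T)%C <= Re (M * Cconj (M * M - T))%C) ->
  exists A b c, admissible_coefficients A b c /\ T = (A - c, b) /\ T' = (2 * A, b).
Proof.
  intros Hd Hd1 H. destruct T as [Tr Ti], T' as [Pr Pi].
  assert (Hy : forall y, (1 - y * y - Pr - y * Pi + Tr) ^ 2 + (- 2 * y - Pi + y * Pr + Ti) ^ 2
     <= (1 + y * y - Tr + y * Ti) ^ 2).
  { intros y. specialize (H y). cbv zeta in H.
    set (M := (1, - y)%R : C) in *. set (X := (M * M - (Pr, Pi) * M + (Tr, Ti))%C) in *.
    assert (HX := Cmod_sqr X). assert (HX0 := Cmod_ge_0 X).
    replace (Re (M * Cconj (M * M - (Tr, Ti)))%C)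
      with (1 + y * y - Tr + y * Ti) in H
      by (unfold M, Re, Cmult, Cconj, Cminus, Cplus, Copp; simpl; ring).
    replace (Re X) with (1 - y * y - Pr - y * Pi + Tr) in HX
      by (unfold X, M, Re, Cmult, Cconj, Cminus, Cplus, Copp; simpl; ring).
    replace (Im X) with (- 2 * y - Pi + y * Pr + Ti) in HX
      by (unfold X, M, Im, Cmult, Cconj, Cminus, Cplus, Copp; simpl; ring).
    simpl. nra. }
  assert (E : Ti = Pi).
  { apply Rle_antisym.
    - assert (2 * (Ti - Pi) <= 0); [|lra].
      eapply (nonneg_cubic_lead _ (2 * (2 - Pr) + (Ti + Pi) * (Ti - Pi) - (2 - Pr) * (2 - Pr))
        ((Ti + Pi) * (2 - Pr) + (Pr - 2 * Tr) * (Ti - Pi) + 2 * (2 - Pr) * (Ti - Pi))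
        ((Pr - 2 * Tr) * (2 - Pr) - (Ti - Pi) * (Ti - Pi))).
      intros y. specialize (Hy y). simpl in *. lra.
    - assert (- (2 * (Ti - Pi)) <= 0); [|lra].
      eapply (nonneg_cubic_lead _ (2 * (2 - Pr) + (Ti + Pi) * (Ti - Pi) - (2 - Pr) * (2 - Pr))
        (- ((Ti + Pi) * (2 - Pr) + (Pr - 2 * Tr) * (Ti - Pi) + 2 * (2 - Pr) * (Ti - Pi)))
        ((Pr - 2 * Tr) * (2 - Pr) - (Ti - Pi) * (Ti - Pi))).
      intros y. specialize (Hy (- y)). simpl in *. lra. }
  subst Pi. set (A := Pr / 2). set (c := A - Tr).
  assert (EPr : Pr = 2 * A) by (unfold A; field). assert (ETr : Tr = A - c) by (unfold c; ring).
  exists A, Ti, c. rewrite <- EPr, <- ETr. split; [|auto].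
  assert (Hq : forall y, 0 <= (1 - A) * (A * y ^ 2 + Ti * y + c)).
  { intros y. specialize (Hy y). rewrite EPr, ETr in Hy. simpl in *. lra. }
  destruct (Rlt_dec A 1) as [H1|H1].
  - left. assert (Q : 0 <= A /\ 0 <= c /\ Ti * Ti <= 4 * A * c).
    { apply nonneg_quadratic. intros y. specialize (Hq y).
      apply Rmult_le_reg_l with (1 - A); lra. }
    destruct Q as (Q1 & Q2 & Q3). auto.
  - destruct (Req_dec A 1) as [H2|H2].
    (* At [A = 1] the inequality is void. The bound comes from the point itself: with [d = x + i z],
       [4 c - b^2 = 4 (1 - x^2) (1 + z^2)], where [b] is [Ti]. *)
    + right. split; auto. destruct d as [x z]. unfold Cmult in Hd; simpl in Hd. injection Hd as E1 E2.
      unfold Re in Hd1; simpl in Hd1. apply Rabs_def2 in Hd1. rewrite H2 in ETr.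
      assert (c = 1 - x * x + z * z) by lra. subst c. rewrite <- E2.
      assert (0 < (1 - x * x) * (1 + z * z)) by (apply Rmult_lt_0_compat; nra). nra.
    + exfalso. destruct (nonneg_quadratic (- A) (- Ti) (- c)) as [Q1 _]; [|lra].
      intros y. specialize (Hq y). apply Rmult_le_reg_l with (A - 1); [lra|]. lra.
Qed.

(** For a root [d = x + i z] and [v = Re n], the inequality [Key] on [t] amounts to
    [(x^2 - v^2) (z^2 + v^2) < 0], that is, to [|x| < v]. *)
Lemma geodesic_coordinate_root (A b c : R) (n : C) : admissible_coefficients A b c -> 0 < Re n ->
  exists d : C, (d * d)%C = (A * n * n + (0, b)%R * n - c)%C /\ Rabs (Re d) < Re n.
Proof.
  intros Hadm Hn. set (t := (A * n * n + (0, b)%R * n - c)%C).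
  destruct (Csqrt_exists t) as [d Hd]. exists d. split; auto.
  destruct n as [v y]. unfold Re in Hn; simpl in Hn.
  set (q := A * y ^ 2 + b * y + c).
  assert (Hr : Re t = A * (v * v) - q) by (unfold t, q, Re, Cmult, Cminus, Cplus, Copp, RtoC; simpl; ring).
  assert (Hi : Im t = v * (2 * A * y + b)) by (unfold t, q, Im, Cmult, Cminus, Cplus, Copp, RtoC; simpl; ring).
  assert (Key : (v * (2 * A * y + b)) * (v * (2 * A * y + b)) < 4 * (v * v) * ((1 - A) * (v * v) + q)).
  { assert (Hv : 0 < v * v) by nra.
    replace (v * (2 * A * y + b) * (v * (2 * A * y + b))) with ((v * v) * (4 * A * q - (4 * A * c - b * b)))
      by (unfold q; ring).
    replace (4 * (v * v) * ((1 - A) * (v * v) + q)) with ((v * v) * (4 * ((1 - A) * (v * v)) + 4 * q)) by ring.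
    apply Rmult_lt_compat_l; auto.
    destruct Hadm as [((A0 & A1) & c0 & Hb)|(-> & Hb)].
    - assert (Hq : 0 <= q).
      { destruct A0 as [A0|A0].
        - apply Rmult_le_reg_l with (4 * A); [lra|]. rewrite Rmult_0_r.
          replace (4 * A * q) with ((2 * A * y + b) * (2 * A * y + b) + (4 * A * c - b * b)) by (unfold q; ring).
          assert (0 <= (2 * A * y + b) * (2 * A * y + b)) by (apply Rle_0_sqr). lra.
        - assert (b = 0) by nra. unfold q. subst b. rewrite <- A0. lra. }
      assert (0 < (1 - A) * (v * v)) by (apply Rmult_lt_0_compat; lra).
      assert (0 <= (1 - A) * q) by (apply Rmult_le_pos; lra). lra.
    - lra. }
  destruct d as [x z]. unfold Re; simpl.
  assert (E1 : x * x - z * z = A * (v * v) - q).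
  { rewrite <- Hr, <- Hd. unfold Re, Cmult; simpl; ring. }
  assert (E2 : 2 * (x * z) = v * (2 * A * y + b)).
  { rewrite <- Hi, <- Hd. unfold Im, Cmult; simpl; ring. }
  apply Rnot_le_lt. intros F.
  assert (F2 : v * v <= x * x).
  { apply Rsqr_le_abs_1. rewrite (Rabs_pos_eq v); lra. }
  assert (z2 : 0 <= z * z) by nra.
  rewrite <- E2 in Key. replace (2 * (x * z) * (2 * (x * z))) with (4 * (x * x) * (z * z)) in Key by ring.
  replace (4 * (v * v) * ((1 - A) * (v * v) + q)) with (4 * (v * v) * (v * v - (x * x - z * z))) in Key
    by (rewrite E1; ring).
  nra.
Qed.

Ltac cdiff_rational :=
  lazymatch goal with
  | |- filterdiff (fun x => Cdiv (@?f x) (@?g x)) _ _ => apply (cdiff_div f g); [cdiff_rational | cdiff_rational | ]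
  | |- filterdiff (fun x => Cplus (@?f x) (@?g x)) _ _ => apply (cdiff_plus f g); cdiff_rational
  | |- filterdiff (fun x => Cminus (@?f x) (@?g x)) _ _ => apply (cdiff_minus f g); cdiff_rational
  | |- filterdiff (fun x => Cmult (@?f x) (@?g x)) _ _ => apply (cdiff_mult f g); cdiff_rational
  | |- filterdiff (fun x => x) _ _ => apply filterdiff_id
  | |- filterdiff (fun _ => ?c) _ _ => apply (cdiff_const c)
  end.

(** * The extremal problem over boundary points and the disc it yields *)

Lemma unit_circle_angle (o : C) : Cmod o = 1 -> exists th, 0 <= th <= 2 * PI /\ o = polar_exp 0 th.
Proof.
  intros Ho. assert (H := Cmod_sqr o). rewrite Ho in H. destruct o as [a b].
  unfold Re, Im in H; simpl in H. unfold polar_exp. rewrite exp_0.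
  assert (Ha : -1 <= a <= 1) by nra.
  assert (Hab := acos_bound a). assert (Hs := sin_acos a Ha).
  assert (Hb : Rabs b = sqrt (1 - a²)).
  { rewrite <- sqrt_Rsqr_abs. f_equal. unfold Rsqr. lra. }
  rewrite <- Hb in Hs.
  destruct (Rle_dec 0 b) as [B|B].
  - exists (acos a). rewrite cos_acos, Hs, Rabs_pos_eq by auto. split; [lra|]. f_equal; ring.
  - exists (2 * PI - acos a). split; [lra|].
    replace (2 * PI - acos a) with (- acos a + 2 * INR 1 * PI) by (simpl; ring).
    rewrite cos_period, sin_period, cos_neg, sin_neg, cos_acos, Hs, Rabs_left by (auto; lra). f_equal; ring.
Qed.

Lemma circle_Re_continuity (g : C -> C) (th : R) :
  ex_filterdiff (V := C_NormedModule) g (locally (polar_exp 0 th : C_NormedModule)) ->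
  continuity_pt (fun t => Re (g (polar_exp 0 t))) th.
Proof.
  intros [l Hl]. apply continuity_pt_filterlim.
  exact (proj2 (closed_form_continuous _ _ _ _ (polar_pullback_closed g 0 th l Hl))).
Qed.

Lemma circle_Im_continuity (g : C -> C) (th : R) :
  ex_filterdiff (V := C_NormedModule) g (locally (polar_exp 0 th : C_NormedModule)) ->
  continuity_pt (fun t => Im (g (polar_exp 0 t))) th.
Proof.
  intros [l Hl].
  apply (continuity_pt_ext (fun t => Re ((fun o => (- Ci * g o)%C) (polar_exp 0 t)))).
  { intros t. unfold Re, Im, Ci, Copp, Cmult; simpl. ring. }
  apply (circle_Re_continuity (fun o => (- Ci * g o)%C)). eexists. apply (cdiff_mult (E := C_NormedModule)); [apply cdiff_const|exact Hl].
Qed.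

Lemma Cmod_polar_exp_0 (th : R) : Cmod (polar_exp 0 th) = 1.
Proof. rewrite Cmod_polar_exp. apply exp_0. Qed.

(** Up to nonzero factors the differential is [v1 - 2 o v2 + o^2 (s v2 - p v1)]. Its values at
    [o = 1] and [o = -1] give [v2 = 0], then [v1 (1 - p) = 0], and [p = 1] is impossible in G. *)
Lemma chart_dm_nondegenerate (s p v1 v2 : C) : G (s, p) ->
  (forall o, Cmod o = 1 -> chart_dm o s p v1 v2 = RtoC 0) -> v1 = RtoC 0 /\ v2 = RtoC 0.
Proof.
  intros HG H.
  assert (H' : forall o, Cmod o = 1 -> (v1 - 2 * (o * v2) + o * o * (s * v2 - p * v1))%C = RtoC 0).
  { intros o Ho. specialize (H o Ho). destruct (chart_image o s p Ho HG) as [HD _].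
    assert (Ho0 : o <> RtoC 0) by (apply Cmod_gt_0; lra). unfold chart_dm in H.
    replace (v1 - 2 * (o * v2) + o * o * (s * v2 - p * v1))%C with
      ((o * v1 - 2 * (o * o * v2) + o * o * o * (s * v2 - p * v1)) / (chart_den o s p * chart_den o s p)
       * (chart_den o s p * chart_den o s p) / o)%C by (field; auto).
    rewrite H. field; auto. }
  assert (P1 := H' (RtoC 1) Cmod_1). assert (P2 := H' (- (1))%C Cmod_m1).
  assert (E2 : v2 = RtoC 0).
  { transitivity (((v1 - 2 * (- (1) * v2) + - (1) * - (1) * (s * v2 - p * v1))
       - (v1 - 2 * (1 * v2) + 1 * 1 * (s * v2 - p * v1))) / 4)%C; [field|]. rewrite P1, P2. field. }
  split; auto. rewrite E2 in P1.
  assert (E1 : (v1 * (1 - p))%C = RtoC 0) by (rewrite <- P1; ring).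
  destruct (Ceq_dec v1 (RtoC 0)) as [E|E]; auto. exfalso.
  destruct (Ceq_dec (1 - p)%C (RtoC 0)) as [F|F]; [|exact (Cmult_neq_0 _ _ E F E1)].
  apply G_iff_defect in HG. unfold G_defect in HG; simpl in HG.
  replace p with (1 - (1 - p))%C in HG by ring. rewrite F in HG.
  replace (1 - 0)%C with (RtoC 1) in HG by ring. rewrite Cmod_1 in HG.
  generalize (Cmod_ge_0 (s - Cconj s * 1)%C). lra.
Qed.

Lemma extremal_boundary_point (s p v1 v2 : C) : G (s, p) -> ~ (v1 = RtoC 0 /\ v2 = RtoC 0) ->
  exists o, Cmod o = 1 /\ chart_dm o s p v1 v2 <> RtoC 0 /\
    forall o', Cmod o' = 1 ->
      Cmod (chart_dm o' s p v1 v2) * Re (chart_m o s p) <= Cmod (chart_dm o s p v1 v2) * Re (chart_m o' s p).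
Proof.
  intros HG Hv.
  assert (Hden : forall o, Cmod o = 1 -> chart_den o s p <> RtoC 0) by (intros; apply chart_image; auto).
  assert (Hpos : forall o, Cmod o = 1 -> 0 < Re (chart_m o s p)).
  { intros o Ho. destruct (chart_image o s p Ho HG) as (_ & d & _ & Hd).
    generalize (Rabs_pos (Re d)); lra. }
  set (a := fun t => chart_dm (polar_exp 0 t) s p v1 v2). set (m := fun t => chart_m (polar_exp 0 t) s p).
  assert (Hda : forall o : C, Cmod o = 1 -> ex_filterdiff (U := C_NormedModule) (V := C_NormedModule)
     (fun o => chart_dm o s p v1 v2) (locally (o : C_NormedModule))).
  { intros o Ho. unfold chart_dm. specialize (Hden o Ho). unfold chart_den in *. eexists.
    cdiff_rational. apply Cmult_neq_0; exact Hden. }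
  assert (Hdm : forall o : C, Cmod o = 1 -> ex_filterdiff (U := C_NormedModule) (V := C_NormedModule)
     (fun o => chart_m o s p) (locally (o : C_NormedModule))).
  { intros o Ho. unfold chart_m. specialize (Hden o Ho). unfold chart_den in *. eexists.
    cdiff_rational. exact Hden. }
  (* The square of the ratio to be maximized: it involves only real and imaginary parts, whose
     continuity on the circle is at hand. *)
  set (f := fun t => (Re (a t) * Re (a t) + Im (a t) * Im (a t)) / (Re (m t) * Re (m t))).
  assert (Hmt : forall t, 0 < Re (m t)) by (intros t; apply Hpos, Cmod_polar_exp_0).
  destruct (continuity_ab_maj f 0 (2 * PI)) as (th & Hmax & Hth).
  { generalize PI_RGT_0; lra. }
  { intros t _. unfold f.
    assert (C1 : continuity_pt (fun t => Re (a t)) t)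
      by (apply (circle_Re_continuity (fun o => chart_dm o s p v1 v2)), Hda, Cmod_polar_exp_0).
    assert (C2 : continuity_pt (fun t => Im (a t)) t)
      by (apply (circle_Im_continuity (fun o => chart_dm o s p v1 v2)), Hda, Cmod_polar_exp_0).
    assert (C3 : continuity_pt (fun t => Re (m t)) t)
      by (apply (circle_Re_continuity (fun o => chart_m o s p)), Hdm, Cmod_polar_exp_0).
    apply (continuity_pt_div (fun t => Re (a t) * Re (a t) + Im (a t) * Im (a t))
      (fun t => Re (m t) * Re (m t))).
    - apply (continuity_pt_plus (fun t => Re (a t) * Re (a t)) (fun t => Im (a t) * Im (a t)));
        apply continuity_pt_mult; auto.
    - apply continuity_pt_mult; auto.
    - specialize (Hmt t). nra. }
  assert (Hineq : forall o', Cmod o' = 1 ->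
      Cmod (chart_dm o' s p v1 v2) * Re (m th) <= Cmod (a th) * Re (chart_m o' s p)).
  { intros o' Ho'. destruct (unit_circle_angle o' Ho') as (t & Ht & ->).
    specialize (Hmax t Ht). fold (a t) (m t). unfold f in Hmax. rewrite <- !Cmod_sqr in Hmax.
    assert (M1 := Hmt t). assert (M2 := Hmt th).
    assert (A1 := Cmod_ge_0 (a t)). assert (A2 := Cmod_ge_0 (a th)).
    apply Rsqr_incr_0_var; [|apply Rmult_le_pos; lra]. unfold Rsqr.
    apply (Rmult_le_compat_r ((Re (m t) * Re (m t)) * (Re (m th) * Re (m th)))) in Hmax; [|nra].
    replace (Cmod (a t) * Cmod (a t) / (Re (m t) * Re (m t)) * (Re (m t) * Re (m t) * (Re (m th) * Re (m th))))
      with (Cmod (a t) * Re (m th) * (Cmod (a t) * Re (m th))) in Hmax by (field; lra).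
    replace (Cmod (a th) * Cmod (a th) / (Re (m th) * Re (m th)) * (Re (m t) * Re (m t) * (Re (m th) * Re (m th))))
      with (Cmod (a th) * Re (m t) * (Cmod (a th) * Re (m t))) in Hmax by (field; lra).
    exact Hmax. }
  exists (polar_exp 0 th). split; [apply Cmod_polar_exp_0|]. split; [|exact Hineq].
  (* A zero maximum would make the differential vanish at every boundary point. *)
  intros F. apply Hv. apply (chart_dm_nondegenerate s p v1 v2 HG). intros o Ho.
  specialize (Hineq o Ho). unfold a in Hineq. rewrite F, Cmod_0, Rmult_0_l in Hineq.
  apply Cmod_eq_0. assert (A1 := Cmod_ge_0 (chart_dm o s p v1 v2)). specialize (Hmt th). nra.
Qed.

(** This is [(m + d + 1) (m - d + 1)] with [d * d = t]. The inverse chart involves [t] only, so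
    discs built from it need no branch of the square root. *)
Definition inv_den (m t : C) : C := (m * m - t + 2 * m + 1)%C.
Definition chart_inverse (o m t : C) : C * C :=
  ((2 * (m * m - t - 1) / (inv_den m t * o))%C, ((m * m - t - 2 * m + 1) / (inv_den m t * (o * o)))%C).

Lemma inv_den_chart (o s p : C) : chart_den o s p <> RtoC 0 ->
  inv_den (chart_m o s p) (chart_t o s p) = (4 / chart_den o s p)%C.
Proof. intros H. unfold inv_den, chart_m, chart_t. unfold chart_den in *. field. exact H. Qed.

Lemma C4_neq_0 : RtoC 4 <> RtoC 0.
Proof. intros F; apply RtoC_inj in F; lra. Qed.

Lemma chart_inverse_chart (o s p : C) : chart_den o s p <> RtoC 0 -> o <> RtoC 0 ->
  chart_inverse o (chart_m o s p) (chart_t o s p) = (s, p).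
Proof.
  intros H Ho. unfold chart_inverse. rewrite inv_den_chart by auto.
  assert (H4 := C4_neq_0).
  apply (f_equal2 pair); unfold chart_m, chart_t; unfold chart_den in *; field; auto.
Qed.

Lemma chart_m_chart_inverse (o m t : C) : inv_den m t <> RtoC 0 -> o <> RtoC 0 ->
  chart_m o (fst (chart_inverse o m t)) (snd (chart_inverse o m t)) = m.
Proof.
  intros H Ho. assert (H4 := C4_neq_0). unfold chart_inverse; simpl.
  assert (E : chart_den o (2 * (m * m - t - 1) / (inv_den m t * o))%C
    ((m * m - t - 2 * m + 1) / (inv_den m t * (o * o)))%C = (4 / inv_den m t)%C).
  { unfold chart_den. unfold inv_den in *. field. auto. }
  unfold chart_m. rewrite E. unfold inv_den in *. field. auto.
Qed.

Definition chart_inverse_d1 (o m t m' t' : C) : C :=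
  (2 * ((2 * m * m' - t') * inv_den m t - (m * m - t - 1) * (2 * m * m' - t' + 2 * m'))
    / (inv_den m t * inv_den m t * o))%C.
Definition chart_inverse_d2 (o m t m' t' : C) : C :=
  (((2 * m * m' - t' - 2 * m') * inv_den m t - (m * m - t - 2 * m + 1) * (2 * m * m' - t' + 2 * m'))
    / (inv_den m t * inv_den m t * (o * o)))%C.

Lemma chart_inverse_differential (o : C) (m t : C_NormedModule -> C) (z : C_NormedModule) (lm lt : C -> C) :
  o <> RtoC 0 -> cdiff m z lm -> cdiff t z lt -> inv_den (m z) (t z) <> RtoC 0 ->
  cdiff2 (fun w => chart_inverse o (m w) (t w)) z
    (fun h => (chart_inverse_d1 o (m z) (t z) (lm h) (lt h), chart_inverse_d2 o (m z) (t z) (lm h) (lt h))).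
Proof.
  intros Ho Hm Ht Hden.
  assert (Hq := cdiff_minus _ _ z _ _ (cdiff_mult m m z lm lm Hm Hm) Ht).
  assert (H2m := cdiff_mult _ _ z _ _ (cdiff_const (RtoC 2) z) Hm).
  assert (Hd := cdiff_plus _ _ z _ _ (cdiff_plus _ _ z _ _ Hq H2m) (cdiff_const (RtoC 1) z)).
  assert (N1 : (inv_den (m z) (t z) * o)%C <> RtoC 0) by (apply Cmult_neq_0; auto).
  assert (N2 : (inv_den (m z) (t z) * (o * o))%C <> RtoC 0) by (repeat apply Cmult_neq_0; auto).
  assert (H1 := cdiff_div _ _ z _ _
     (cdiff_mult _ _ z _ _ (cdiff_const (RtoC 2) z) (cdiff_minus _ _ z _ _ Hq (cdiff_const (RtoC 1) z)))
     (cdiff_mult _ _ z _ _ Hd (cdiff_const o z)) N1).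
  assert (H2 := cdiff_div _ _ z _ _
     (cdiff_plus _ _ z _ _ (cdiff_minus _ _ z _ _ Hq H2m) (cdiff_const (RtoC 1) z))
     (cdiff_mult _ _ z _ _ Hd (cdiff_const (o * o)%C z)) N2).
  eapply filterdiff_ext_lin; [exact (cdiff_pair _ _ z _ _ H1 H2)|].
  intros h. simpl. apply (f_equal2 (@pair C C)).
  - unfold chart_inverse_d1. unfold inv_den in *. field. auto.
  - unfold chart_inverse_d2. unfold inv_den in *. field. auto.
Qed.

Lemma chart_inverse_d_chart (o s p v1 v2 k : C) : chart_den o s p <> RtoC 0 -> o <> RtoC 0 ->
  chart_inverse_d1 o (chart_m o s p) (chart_t o s p)
    (k * chart_dm o s p v1 v2)%C (k * chart_dt o s p v1 v2)%C = (k * v1)%C /\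
  chart_inverse_d2 o (chart_m o s p) (chart_t o s p)
    (k * chart_dm o s p v1 v2)%C (k * chart_dt o s p v1 v2)%C = (k * v2)%C.
Proof.
  intros H Ho. assert (H4 := C4_neq_0). unfold chart_inverse_d1, chart_inverse_d2. rewrite inv_den_chart by auto.
  unfold chart_m, chart_t, chart_dm, chart_dt. unfold chart_den in *. split; field; auto.
Qed.

Lemma boundary_shift_unit (o : C) (y : R) : Cmod o = 1 ->
  (1 - (0, y)%R)%C <> RtoC 0 /\ Cmod (boundary_shift o (0, y)%R) = 1.
Proof.
  intros Ho.
  assert (N : (1 - (0, y)%R)%C <> RtoC 0).
  { intros F. apply (f_equal fst) in F. simpl in F. lra. }
  split; auto. unfold boundary_shift. rewrite Cmod_div, Cmod_mult, Cmod_opp, Ho by auto.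
  replace (1 + (0, y)%R)%C with (Cconj (1 - (0, y)%R)%C)
    by (unfold Cconj, Cminus, Cplus, Copp, RtoC; simpl; f_equal; ring).
  rewrite Cmod_conj. apply Cmod_gt_0 in N. field. lra.
Qed.

Lemma Re_mult_R (r : R) (z : C) : Re (RtoC r * z)%C = r * Re z.
Proof. unfold Re, Cmult, RtoC; simpl. ring. Qed.

(* In the half-plane coordinate at an extremal boundary point, extremality against all other
   boundary points becomes the family of inequalities of [extremal_coefficients]. *)
Lemma extremal_inequality (o s p v1 v2 d : C) (u be : R) :
  Cmod o = 1 -> G (s, p) -> chart_m o s p = (u, be) -> chart_dm o s p v1 v2 = RtoC u -> 0 < u ->
  (d * d)%C = (chart_t o s p / (u * u))%C -> Rabs (Re d) < 1 ->
  (forall o', Cmod o' = 1 -> Cmod (chart_dm o' s p v1 v2) <= Re (chart_m o' s p)) ->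
  forall y : R, let M := (1, - y)%R : C in
    Cmod (M * M - chart_dt o s p v1 v2 / (u * u) * M + chart_t o s p / (u * u))%C <=
    Re (M * Cconj (M * M - chart_t o s p / (u * u)))%C.
Proof.
  intros Ho HG Em Edm Hu Hd Hd1 Hext y M.
  destruct (chart_image o s p Ho HG) as [HD _].
  (* With this shift [m - j] becomes [u M], where [M = 1 - i y]; as [y] varies, [j] runs over the
     imaginary axis. *)
  set (y0 := be + u * y). set (j := (0, y0)%R : C).
  destruct (boundary_shift_unit o y0 Ho) as [Nj Uj]. fold j in Nj, Uj.
  assert (Hu0 : RtoC u <> RtoC 0) by (intros F; apply RtoC_inj in F; lra).
  set (T := (chart_t o s p / (u * u))%C) in *. set (T' := (chart_dt o s p v1 v2 / (u * u))%C).
  set (N := (M * M - T)%C).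
  assert (HN : N <> RtoC 0).
  { unfold N. rewrite <- Hd. replace (M * M - d * d)%C with ((M - d) * (M + d))%C by ring.
    apply Rabs_def2 in Hd1. destruct d as [dx dy]. unfold Re in Hd1; simpl in Hd1.
    apply Cmult_neq_0; intros F; apply (f_equal fst) in F; unfold M in F; simpl in F; lra. }
  assert (EM : (chart_m o s p - j)%C = (u * M)%C).
  { rewrite Em. unfold j, M, y0, Cminus, Cplus, Copp, Cmult, RtoC; simpl. f_equal; ring. }
  assert (ET : chart_t o s p = (u * u * T)%C) by (unfold T; field; auto).
  assert (ET' : chart_dt o s p v1 v2 = (u * u * T')%C) by (unfold T'; field; auto).
  assert (EW : ((chart_m o s p - j) * (chart_m o s p - j) - chart_t o s p)%C = (u * u * N)%C).
  { rewrite EM, ET. unfold N. ring. }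
  assert (HW : ((chart_m o s p - j) * (chart_m o s p - j) - chart_t o s p)%C <> RtoC 0).
  { rewrite EW. repeat apply Cmult_neq_0; auto. }
  specialize (Hext _ Uj).
  rewrite (chart_m_shift o s p j HD Nj HW) in Hext.
  rewrite (chart_dm_shift o s p v1 v2 j HD Nj HW) in Hext.
  rewrite EW, EM, Edm, ET, ET' in Hext.
  set (ka := 1 + y0 * y0). assert (Hka : 0 < ka) by (unfold ka; nra).
  assert (Ej : (1 - j * j)%C = RtoC ka).
  { unfold j, ka, Cminus, Cplus, Copp, Cmult, RtoC; simpl. f_equal; ring. }
  rewrite Ej in Hext.
  set (X := (M * M - T' * M + T)%C).
  (* Both sides of the extremality inequality carry the positive factor [ka / u], which is then
     cancelled. *)
  replace (RtoC ka * ((u * M * (u * u * T') - u * M * (u * M) * u - u * u * T * u) / (u * u * N * (u * u * N))))%C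
    with (- (RtoC (ka / u) * (X / (N * N))))%C in Hext
    by (unfold X; rewrite RtoC_div by lra; field; auto).
  rewrite re_plus, Cmod_opp, Cmod_mult, Cmod_R, Rabs_pos_eq in Hext
    by (left; apply Rdiv_lt_0_compat; auto).
  replace (RtoC ka * (u * M / (u * u * N)))%C with (RtoC (ka / u) * (M / N))%C in Hext
    by (rewrite RtoC_div by lra; field; auto).
  rewrite Re_mult_R in Hext.
  replace (Re (- j)%C) with 0 in Hext by (unfold j, Re, Copp; simpl; ring).
  rewrite Rplus_0_l in Hext. apply Rmult_le_reg_l in Hext; [|apply Rdiv_lt_0_compat; auto].
  apply Cmod_gt_0 in HN as HN'.
  assert (E2 : (M * Cconj N)%C = (RtoC (Cmod N * Cmod N) * (M / N))%C).
  { assert (E := Cmod2_conj N). simpl in E. rewrite Rmult_1_r, RtoC_mult in E.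
    rewrite RtoC_mult, E. field; auto. }
  rewrite E2, Re_mult_R. rewrite Cmod_div, Cmod_mult in Hext by (apply Cmult_neq_0; auto).
  apply (Rmult_le_compat_l (Cmod N * Cmod N)) in Hext; [|nra].
  replace (Cmod N * Cmod N * (Cmod X / (Cmod N * Cmod N))) with (Cmod X) in Hext by (field; lra).
  exact Hext.
Qed.

Lemma chart_dm_scal (o s p v1 v2 k : C) : chart_den o s p <> RtoC 0 ->
  chart_dm o s p (k * v1)%C (k * v2)%C = (k * chart_dm o s p v1 v2)%C.
Proof. intros H. unfold chart_dm. unfold chart_den in *. field. exact H. Qed.

(** Over the right half-plane [n], the disc has m affine and t quadratic in [n], with coefficients
    read off the 1-jet of the chart at [(s, p)]. Since m is affine in [n], solving for [n] gives the
    left inverse on all of G. *)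
Lemma extremal_geodesic (s p v1 v2 : C) : G (s, p) -> ~ (v1 = RtoC 0 /\ v2 = RtoC 0) ->
  exists (k : C_NormedModule -> C2) (c : C2 -> C_NormedModule) (lk : C_NormedModule -> C2) (ka : C),
    holomorphic_on unit_disc k /\ maps_into unit_disc G k /\
    holomorphic_on G c /\ maps_into G unit_disc c /\
    (forall z, unit_disc z -> c (k z) = z) /\ k (RtoC 0) = (s, p) /\
    cdiff2 k (RtoC 0 : C_NormedModule) lk /\ lk (RtoC 1) = ((ka * v1)%C, (ka * v2)%C) /\ ka <> RtoC 0.
Proof.
  intros HG Hv. destruct (extremal_boundary_point s p v1 v2 HG Hv) as (o & Ho & Hdm & Hext).
  destruct (chart_image o s p Ho HG) as (HD & d0 & Hd0 & Hd1).
  assert (Ho0 : o <> RtoC 0) by (apply Cmod_gt_0; lra).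
  destruct (chart_m o s p) as [u be] eqn:Em. unfold Re in Hd1 at 2; simpl in Hd1.
  assert (Hu : 0 < u) by (generalize (Rabs_pos (Re d0)); lra).
  assert (Hu0 : RtoC u <> RtoC 0) by (intros F; apply RtoC_inj in F; lra).
  (* Rescaling the direction by [ka] makes the differential of m equal to [u = Re m], so that
     extremality reads [|dm| <= Re m] at every boundary point, with equality at [o]. *)
  set (mu := chart_dm o s p v1 v2) in *. set (ka := (RtoC u / mu)%C).
  assert (Hka : ka <> RtoC 0).
  { unfold ka, Cdiv. apply Cmult_neq_0; auto. intros F. apply Hu0.
    transitivity (RtoC u * / mu * mu)%C; [field; auto|]. rewrite <- (Cmult_assoc (RtoC u)), F. ring. }
  set (w1 := (ka * v1)%C). set (w2 := (ka * v2)%C).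
  assert (Edm : chart_dm o s p w1 w2 = RtoC u).
  { unfold w1, w2. rewrite chart_dm_scal by auto. fold mu. unfold ka. field; auto. }
  assert (Hmu : 0 < Cmod mu) by (apply Cmod_gt_0; auto).
  assert (Hext' : forall o', Cmod o' = 1 -> Cmod (chart_dm o' s p w1 w2) <= Re (chart_m o' s p)).
  { intros o' Ho'. specialize (Hext o' Ho'). unfold Re at 1 in Hext; simpl in Hext.
    destruct (chart_image o' s p Ho' HG) as [HD' _].
    unfold w1, w2. rewrite chart_dm_scal, Cmod_mult by auto.
    unfold ka. rewrite Cmod_div, Cmod_R, Rabs_pos_eq by (auto; lra).
    apply Rmult_le_reg_l with (Cmod mu); auto.
    replace (Cmod mu * (u / Cmod mu * Cmod (chart_dm o' s p v1 v2)))
      with (Cmod (chart_dm o' s p v1 v2) * u) by (field; lra). exact Hext. }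
  set (d := (d0 / u)%C).
  assert (Hd : (d * d)%C = (chart_t o s p / (u * u))%C) by (rewrite <- Hd0; unfold d; field; auto).
  assert (Hdr : Rabs (Re d) < 1).
  { replace d with (RtoC (/ u) * d0)%C by (unfold d; rewrite RtoC_inv by lra; field; auto).
    rewrite Re_mult_R, Rabs_mult, Rabs_pos_eq by (left; apply Rinv_0_lt_compat; auto).
    apply Rmult_lt_reg_l with u; auto. rewrite <- Rmult_assoc, Rinv_r by lra. lra. }
  destruct (extremal_coefficients (chart_t o s p / (u * u))%C (chart_dt o s p w1 w2 / (u * u))%C d Hd Hdr)
    as (A & b & c & Hadm & ET & ET').
  { exact (extremal_inequality o s p w1 w2 d u be Ho HG Em Edm Hu Hd Hdr Hext'). }
  (* At [n = 1], [t] is [u^2 (A - c + i b)] and its [n]-derivative is [u^2 (2 A + i b)]: the value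
     and differential of the chart along [(w1, w2)]. *)
  pose (n := fun z : C_NormedModule => ((1 + z) / (1 - z))%C).
  pose (m := fun z : C_NormedModule => (RtoC u * n z + (0, be)%R)%C).
  pose (t := fun z : C_NormedModule => (RtoC u * RtoC u * (RtoC A * n z * n z + (0, b)%R * n z - RtoC c))%C).
  pose (k := fun z : C_NormedModule => chart_inverse o (m z) (t z) : C2).
  pose (g := fun x : C2 => ((chart_m o (fst x) (snd x) - (0, be)%R) / RtoC u)%C).
  assert (Hn : forall z : C, Cmod z < 1 -> (1 - z)%C <> RtoC 0 /\ 0 < Re (n z)) by (intros; apply cayley_re_pos; auto).
  assert (Hroot : forall z : C, Cmod z < 1 -> exists d, (d * d)%C = t z /\ Rabs (Re d) < Re (m z)).
  { intros z Hz. destruct (geodesic_coordinate_root A b c (n z) Hadm (proj2 (Hn z Hz))) as (e & He & He').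
    exists (RtoC u * e)%C. split.
    - unfold t. rewrite <- He. ring.
    - unfold m. rewrite re_plus, !Re_mult_R. replace (Re (0, be)%R) with 0 by reflexivity.
      rewrite Rplus_0_r, Rabs_mult, Rabs_pos_eq by lra. apply Rmult_lt_compat_l; auto. }
  assert (Hden : forall z : C, Cmod z < 1 -> inv_den (m z) (t z) <> RtoC 0).
  { intros z Hz. destruct (Hroot z Hz) as (e & He & He'). unfold inv_den. rewrite <- He.
    apply chart_inverse_den; auto. }
  assert (Hnd : forall z : C_NormedModule, Cmod z < 1 -> exists l, cdiff n z l).
  { intros z Hz. unfold n. eexists. cdiff_rational. apply (Hn z Hz). }
  assert (Hmd : forall z l, cdiff n z l -> cdiff m z (fun h => RtoC u * l h)%C).
  { intros z l Hl. unfold m. eapply filterdiff_ext_lin.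
    - apply cdiff_plus; [apply cdiff_mult; [apply cdiff_const|exact Hl]|apply cdiff_const].
    - intros h. simpl. ring. }
  assert (Htd : forall z l, cdiff n z l -> cdiff t z (fun h => RtoC u * RtoC u * (2 * RtoC A * n z + (0, b)%R) * l h)%C).
  { intros z l Hl. unfold t. eapply filterdiff_ext_lin.
    - apply cdiff_mult; [apply cdiff_const|]. apply cdiff_minus; [|apply cdiff_const].
      apply cdiff_plus; apply cdiff_mult; [| exact Hl |apply cdiff_const| exact Hl].
      apply cdiff_mult; [apply cdiff_const | exact Hl].
    - intros h. simpl. ring. }
  assert (H01 : Cmod (RtoC 0) < 1) by (rewrite Cmod_0; lra).
  assert (Hn0 : n (RtoC 0) = RtoC 1) by (unfold n; field).
  assert (Em0 : m (RtoC 0) = chart_m o s p).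
  { unfold m. rewrite Hn0, Em. unfold Cplus, Cmult, RtoC; simpl. f_equal; ring. }
  assert (Et0 : t (RtoC 0) = chart_t o s p).
  { unfold t. rewrite Hn0. transitivity (RtoC u * RtoC u * (chart_t o s p / (RtoC u * RtoC u)))%C; [|field; auto].
    rewrite ET. f_equal. unfold Cminus, Cplus, Copp, Cmult, RtoC; simpl. f_equal; ring. }
  assert (Hgre : forall x : C2, G x -> 0 < Re (g x)).
  { intros x Hx. destruct x as [x1 x2]. destruct (chart_image o x1 x2 Ho Hx) as (_ & e & _ & He).
    assert (Eg : g (x1, x2) = (RtoC (/ u) * (chart_m o x1 x2 - (0, be)%R))%C).
    { unfold g; cbn [fst snd]. rewrite RtoC_inv by lra. unfold Cdiv. apply Cmult_comm. }
    rewrite Eg, Re_mult_R. apply Rmult_lt_0_compat; [apply Rinv_0_lt_compat; auto|].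
    unfold Cminus. rewrite re_plus. replace (Re (- (0, be)%R)%C) with (- 0) by reflexivity.
    generalize (Rabs_pos (Re e)). lra. }
  assert (Hgk : forall z : C, Cmod z < 1 -> g (k z) = n z).
  { intros z Hz. unfold g, k. rewrite chart_m_chart_inverse by auto. unfold m. field; auto. }
  destruct (Hnd (RtoC 0) H01) as [ln0 Hln0].
  assert (Hln01 : ln0 (RtoC 1) = RtoC 2).
  { rewrite (cdiff_unique n (RtoC 0) ln0 _ Hln0
      (cdiff_div (E := C_NormedModule) (fun z => 1 + z)%C (fun z => 1 - z)%C (RtoC 0) _ _
        (cdiff_plus (E := C_NormedModule) _ _ (RtoC 0) _ _ (cdiff_const (RtoC 1) _) (filterdiff_id _))
        (cdiff_minus (E := C_NormedModule) _ _ (RtoC 0) _ _ (cdiff_const (RtoC 1) _) (filterdiff_id _)) (proj1 (Hn (RtoC 0) H01)))).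
    match goal with |- ?a = ?b => change (@eq C a b) end. field. }
  assert (Hk0 := chart_inverse_differential o m t (RtoC 0) _ _ Ho0 (Hmd _ _ Hln0) (Htd _ _ Hln0) (Hden _ H01)).
  exists k, (fun x => (g x - 1) / (g x + 1))%C.
  (* The 2 is the derivative of the Cayley transform [n] at 0. *)
  eexists. exists (2 * ka)%C.
  split; [|split; [|split; [|split; [|split; [|split; [|split; [exact Hk0|split]]]]]]].
  - intros z Hz. destruct (Hnd z Hz) as [l Hl]. eexists.
    apply (chart_inverse_differential o m t z _ _ Ho0 (Hmd _ _ Hl) (Htd _ _ Hl) (Hden z Hz)).
  - intros z Hz. destruct (Hroot z Hz) as (e & He & He').
    assert (K := chart_inverse_G o (m z) e Ho He'). rewrite He in K. exact K.
  - intros x Hx. assert (Hx' := Hgre x Hx). destruct (inverse_cayley_disc _ Hx') as [N _].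
    assert (HDx : chart_den o (fst x) (snd x) <> RtoC 0).
    { destruct x as [x1 x2]. apply (chart_image o x1 x2 Ho Hx). }
    assert (F1 : cdiff (fun x : C2 => (fst x : C)) x (fun x : C2 => (fst x : C))).
    { apply filterdiff_linear. apply (is_linear_fst (K := C_AbsRing) (U := C_NormedModule) (V := C_NormedModule)). }
    assert (F2 : cdiff (fun x : C2 => (snd x : C)) x (fun x : C2 => (snd x : C))).
    { apply filterdiff_linear. apply (is_linear_snd (K := C_AbsRing) (U := C_NormedModule) (V := C_NormedModule)). }
    assert (Hg : exists l, cdiff g x l).
    { assert (P2 := cdiff_mult _ _ x _ _ (cdiff_const (o * o)%C x) F2).
      assert (P1 := cdiff_mult _ _ x _ _ (cdiff_const o x) F1).
      assert (D1 := cdiff_plus _ _ x _ _ (cdiff_minus _ _ x _ _ (cdiff_const (RtoC 1) x) P1) P2).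
      eexists. exact (cdiff_div _ _ x _ _ (cdiff_minus _ _ x _ _
         (cdiff_div _ _ x _ _ (cdiff_minus _ _ x _ _ (cdiff_const (RtoC 1) x) P2) D1 HDx)
         (cdiff_const ((0, be)%R : C) x)) (cdiff_const (RtoC u) x) Hu0). }
    destruct Hg as [l Hl]. eexists.
    exact (cdiff_div _ _ x _ _ (cdiff_minus _ _ x _ _ Hl (cdiff_const (RtoC 1) x))
       (cdiff_plus _ _ x _ _ Hl (cdiff_const (RtoC 1) x)) N).
  - intros x Hx. exact (proj2 (inverse_cayley_disc _ (Hgre x Hx))).
  - intros z Hz. rewrite (Hgk z Hz). destruct (Hn z Hz) as [N _]. unfold n.
    match goal with |- ?a = ?b => change (@eq C a b) end. field. split; [exact N|].
    intros F. assert (F2 : RtoC 2 = RtoC 0) by (rewrite <- F; ring). apply RtoC_inj in F2. lra.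
  - unfold k. rewrite Em0, Et0. apply chart_inverse_chart; auto.
  - rewrite Em0, Et0, Hln01, Hn0.
    destruct (chart_inverse_d_chart o s p w1 w2 (RtoC 2) HD Ho0) as [I1 I2].
    replace (RtoC u * 2)%C with (2 * chart_dm o s p w1 w2)%C by (rewrite Edm; ring).
    replace (RtoC u * RtoC u * (2 * RtoC A * 1 + (0, b)%R) * 2)%C with (2 * chart_dt o s p w1 w2)%C.
    + rewrite I1, I2. unfold w1, w2. rewrite !Cmult_assoc. reflexivity.
    + transitivity (RtoC u * RtoC u * (chart_dt o s p w1 w2 / (RtoC u * RtoC u)) * 2)%C; [field; auto|].
      rewrite ET'. f_equal. f_equal. unfold Cplus, Cmult, RtoC; simpl. f_equal; ring.
  - apply Cmult_neq_0; auto. intros F; apply RtoC_inj in F; lra.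
Qed.

(** * Retracts and geodesics *)

Lemma unit_disc_0 : unit_disc (RtoC 0).
Proof. change (Cmod (RtoC 0) < 1). rewrite Cmod_0. lra. Qed.

Lemma G_0 : G (RtoC 0, RtoC 0).
Proof.
  exists (RtoC 0), (RtoC 0). split; [apply unit_disc_0|split; [apply unit_disc_0|]].
  rewrite Cplus_0_l, Cmult_0_l. reflexivity.
Qed.

Lemma G_not_disc_factorization (k : C_NormedModule -> C2) (c : C2 -> C_NormedModule) :
  holomorphic_on unit_disc k -> holomorphic_on G c -> maps_into G unit_disc c ->
  ~ (forall x : C2, G x -> k (c x) = x).
Proof.
  intros Hk Hc HcD Hid. set (o := (RtoC 0, RtoC 0) : C2).
  destruct (Hc o G_0) as [lc Hlc]. destruct (Hk (c o) (HcD o G_0)) as [lk Hlk].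
  assert (H1 : cdiff2 (fun x => k (c x)) o (fun x => lk (lc x))).
  { exact (filterdiff_comp' (V := C_NormedModule) (W := C2) c k o lc lk Hlc Hlk). }
  assert (H2 : cdiff2 (fun x => k (c x)) o (fun x => x)).
  { apply (filterdiff_ext_locally (fun x : C2 => x)); [|apply filterdiff_id].
    apply locally_norm_iff. destruct (G_open o G_0) as (d & Hd & H). exists d; split; auto.
    intros y Hy. symmetry. auto. }
  assert (E : forall v, lc v = RtoC 0 -> v = zero).
  { intros v Hv. rewrite <- (cdiff2_unique _ o _ _ H1 H2 v), Hv.
    exact (linear_zero lk (proj1 Hlk)). }
  set (e1 := (RtoC 1, RtoC 0) : C2). set (e2 := (RtoC 0, RtoC 1) : C2).
  assert (Z1 : lc e1 = RtoC 0).
  { assert (Z : plus (scal (lc e2 : C) e1) (scal (- lc e1 : C)%C e2) = (zero : C2)).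
    { apply E. rewrite (linear_plus lc (proj1 Hlc)), !(linear_scal lc (proj1 Hlc)).
      assert (A : forall a b : C, (a * b + - b * a)%C = RtoC 0) by (intros; ring). apply A. }
    assert (A : forall a b : C, (a * 0 + - b * 1)%C = RtoC 0 -> b = RtoC 0).
    { intros a b F. transitivity (- (a * 0 + - b * 1))%C; [ring|]. rewrite F. ring. }
    exact (A (lc e2) (lc e1) (f_equal snd Z)). }
  apply E in Z1. apply (f_equal fst) in Z1. change (RtoC 1 = RtoC 0) in Z1.
  apply RtoC_inj in Z1. lra.
Qed.

Theorem theorem1p3 (V : C2 -> Prop) (hV : forall x : C2, V x -> G x) :
  nontrivial_retract G V <-> complex_geodesic G V.
Proof.
  split.
  - intros ((rho & Hrho & Him) & Hnt). assert (Hrho' := Hrho). destruct Hrho' as (Hhol & Hmap & Hidem).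
    set (a := rho (RtoC 0, RtoC 0)). assert (Ga : G a) by (apply Hmap, G_0).
    assert (Ra : rho a = a) by (apply Hidem, G_0).
    clearbody a.
    destruct (Hhol a Ga) as [L HL].
    destruct (classic (forall v, L v = zero)) as [L0|L0].
    { exfalso. apply Hnt. left. exists a. intros x. rewrite (Him x). split.
      - intros (y & Hy & <-). exact (retraction_point_propagates rho Hrho a L Ga Ra HL L0 y Hy).
      - intros ->. exists a. auto. }
    (* Since [L] is idempotent, its nonzero value [v = L w] is a fixed vector, and the geodesic is
       built in that direction. *)
    apply not_all_ex_not in L0. destruct L0 as [w Hw].
    assert (LLw := retraction_differential_idempotent rho Hrho a L Ga Ra HL w).
    destruct (L w) as [v1 v2] eqn:Ew. set (v := (v1, v2) : C2) in *.
    assert (Hv : ~ (v1 = RtoC 0 /\ v2 = RtoC 0)).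
    { intros [-> ->]. apply Hw. reflexivity. }
    destruct a as [s p]. set (a := (s, p) : C2) in *.
    destruct (extremal_geodesic s p v1 v2 Ga Hv)
      as (k & c & lk & ka & Hk & HkG & Hc & HcD & Hck & Hk0 & Hlk & Elk & Hka).
    change (k (RtoC 0) = a) in Hk0.
    assert (D0 := unit_disc_0). destruct (Hc a Ga) as [lc Hlc].
    assert (E1 : lc (lk (RtoC 1)) = RtoC 1).
    { assert (H1 : cdiff (fun z => c (k z)) (RtoC 0 : C_NormedModule) (fun h => lc (lk h))).
      { apply (filterdiff_comp' (V := C2) (W := C_NormedModule) k c (RtoC 0) lk lc Hlk).
        rewrite Hk0. exact Hlc. }
      apply (cdiff_unique (fun z => c (k z)) (RtoC 0) (fun h => lc (lk h)) (fun h => h)); auto.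
      apply (filterdiff_ext_locally (fun z => z)); [|apply filterdiff_id].
      apply locally_norm_iff. exists 1. split; [lra|]. intros z Hz. symmetry. apply Hck.
      change (Cmod (z - 0)%C < 1) in Hz. change (Cmod z < 1).
      replace (z : C) with (z - 0)%C by ring. exact Hz. }
    assert (ELk : L (lk (RtoC 1)) = lk (RtoC 1)).
    { rewrite Elk. change (L (scal ka v) = scal ka v). rewrite (linear_scal L (proj1 HL)).
      f_equal. exact LLw. }
    pose (h := fun z => rho (k z)).
    assert (Hlh : forall z, unit_disc z -> ex_filterdiff h (locally z)).
    { intros z Hz. destruct (Hk z Hz) as [l1 Hl1]. destruct (Hhol (k z) (HkG z Hz)) as [l2 Hl2]. eexists.
      exact (filterdiff_comp' (V := C2) (W := C2) k rho z l1 l2 Hl1 Hl2). }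
    assert (Hself : disc_selfmap_tangent_id (RtoC 0) (fun z => c (h z))).
    { split; [|split; [|split]].
      - intros z Hz. destruct (Hlh z Hz) as [l1 Hl1].
        destruct (Hc (h z) (Hmap _ (HkG z Hz))) as [l2 Hl2]. eexists.
        exact (filterdiff_comp' (V := C2) (W := C_NormedModule) h c z l1 l2 Hl1 Hl2).
      - intros z Hz. apply HcD, Hmap, HkG, Hz.
      - unfold h. rewrite Hk0, Ra, <- Hk0. apply Hck, D0.
      - exists (fun x => lc (L (lk x))). split; [|rewrite ELk; exact E1].
        apply (filterdiff_comp' (V := C2) (W := C_NormedModule) h c (RtoC 0) (fun x => L (lk x)) lc).
        + apply (filterdiff_comp' (V := C2) (W := C2) k rho (RtoC 0) lk L Hlk). rewrite Hk0. exact HL.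
        + unfold h. rewrite Hk0, Ra. exact Hlc. }
    assert (Hch : forall z, unit_disc z -> c (h z) = z).
    { intros z Hz. apply (cartan_rigidity_disc (fun z => c (h z)) z Hself Hz). }
    assert (HhG : maps_into unit_disc G h) by (intros z Hz; apply Hmap, HkG, Hz).
    assert (Hrh : forall z, unit_disc z -> rho (h z) = h z) by (intros z Hz; apply Hidem, HkG, Hz).
    assert (Hne : exists y, G y /\ rho y <> y).
    { apply NNPP. intros N. apply Hnt. right. intros x. split; [apply hV|]. intros Hx.
      apply Him. exists x. split; auto. apply NNPP. intros N'. apply N. exists x; auto. }
    exists h, c. split; [exact Hlh|]. split; [exact HhG|]. split; [exact Hc|]. split; [exact HcD|].
    split; [exact Hch|]. intros y. rewrite (Him y). split.
    + intros (x & Hx & <-). exact (retract_contained_in_disc rho Hrho h c Hlh HhG Hc HcD Hch Hrh Hne x Hx).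
    + intros (z & Hz & <-). exists (k z). split; [apply HkG, Hz|reflexivity].
  - intros (k & c & Hk & HkG & Hc & HcD & Hck & Him). split.
    + exists (fun x => k (c x)). split; [split; [|split]|].
      * intros x Hx. destruct (Hc x Hx) as [l1 Hl1]. destruct (Hk (c x) (HcD x Hx)) as [l2 Hl2]. eexists.
        exact (filterdiff_comp' (V := C_NormedModule) (W := C2) c k x l1 l2 Hl1 Hl2).
      * intros x Hx. apply HkG, HcD, Hx.
      * intros x Hx. rewrite Hck; [reflexivity|apply HcD, Hx].
      * intros y. rewrite (Him y). split.
        -- intros (z & Hz & <-). exists (k z). split; [apply HkG, Hz|]. rewrite Hck; auto.
        -- intros (x & Hx & <-). exists (c x). split; [apply HcD, Hx|reflexivity].
    + intros [(a & Ha)|HVG].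
      (* A left inverse makes [k] injective, so its range contains two points. *)
      * assert (D0 := unit_disc_0).
        assert (D1 : unit_disc (RtoC (/ 2))).
        { change (Cmod (RtoC (/ 2)) < 1). rewrite Cmod_R, Rabs_pos_eq; lra. }
        assert (K0 : k (RtoC 0) = a) by (apply Ha, Him; exists (RtoC 0); auto).
        assert (K1 : k (RtoC (/ 2)) = a) by (apply Ha, Him; exists (RtoC (/ 2)); auto).
        assert (F : RtoC 0 = RtoC (/ 2)).
        { rewrite <- (Hck _ D0), <- (Hck _ D1), K0, K1. reflexivity. }
        apply RtoC_inj in F. lra.
      * apply (G_not_disc_factorization k c Hk Hc HcD). intros x Hx.
        apply HVG, Him in Hx. destruct Hx as (z & Hz & <-). rewrite Hck; auto.
Qed.
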